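(* Let $G\in\mathbb{C}^{m\times m}$ be positive definite. Then the reproducing kernel Hilbert space $\mathcal{H}_G$ is a de Branges space $\mathcal{B}(\mathfrak{E})$ with respect to $\mathbb{C}_+$ if and only if $G$ is a block Hankel matrix. Moreover, in this case the blocks $E_\pm$ of $\mathfrak{E}=\begin{bmatrix}E_-&E_+\end{bmatrix}$ may be specified by the formulas $$E_+(\lambda)=\rho_\alpha(\lambda)F(\lambda)\Gamma F(\alpha)^*\,(\rho_\alpha(\alpha)F(\alpha)\Gamma F(\alpha)^* )^{-1/2}=\frac{\rho_\alpha(\lambda)}{\sqrt{\rho_\alpha(\alpha)}}F(\lambda)\mathfrak{z}_{\alpha}$$ and $$E_-(\lambda)=\rho_{\overline{\alpha}}(\lambda)F(\lambda)\Gamma F(\overline{\alpha})^*\,(\rho_\alpha(\alpha)F(\overline{\alpha})\Gamma F(\overline{\alpha})^* )^{-1/2}=\frac{\rho_{\overline{\alpha}}(\lambda)}{\sqrt{\rho_\alpha(\alpha)}}F(\lambda)\mathfrak{z}_{\overline{\alpha}}$$ for any choice of the point $\alpha\in\mathbb{C}_+$, where $\rho_\omega(\lambda)=-2\pi i(\lambda-\overline{\omega})$.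
   Context: $\mathbb{C}_+$ is the open upper half-plane. $p,n\ge 1$ are fixed integers, $m=(n+1)p$, and $F(\lambda)=\begin{bmatrix}I_p&\lambda I_p&\cdots&\lambda^nI_p\end{bmatrix}$ for $\lambda\in\mathbb{C}$. $G$ is viewed as a block matrix with blocks $g_{ij}\in\mathbb{C}^{p\times p}$, $i,j=0,\ldots,n$; it is block Hankel if $g_{ij}$ depends only on $i+j$. $\Gamma=G^{-1}$. $\mathcal{H}_G=\{Fu:\,u\in\mathbb{C}^m\}$ is the Hilbert space of $p\times 1$ vector polynomials with inner product $\langle Fu,Fv\rangle_{\mathcal{H}_G}=v^*Gu$; its reproducing kernel is $K_\omega(\lambda)=F(\lambda)\Gamma F(\omega)^*$. For $\beta\in\mathbb{C}$, $\mathfrak{z}_\beta=\Gamma F(\beta)^*(F(\beta)\Gamma F(\beta)^* )^{-1/2}\in\mathbb{C}^{m\times p}$. A $p\times 2p$ entire matrix valued function $\mathfrak{E}=\begin{bmatrix}E_-&E_+\end{bmatrix}$ with $p\times p$ blocks $E_\pm$ is a de Branges matrix with respect to $\mathbb{C}_+$ if $\det E_+(\lambda)\neq 0$ for $\lambda\in\mathbb{C}_+$ and $E_+^{-1}E_-$ is a $p\times p$ inner function on $\mathbb{C}_+$ (holomorphic and contractive in $\mathbb{C}_+$ with unitary boundary values a.e. on $\mathbb{R}$). The associated de Branges space with respect to $\mathbb{C}_+$ is $\mathcal{B}(\mathfrak{E})=\{\text{entire } p\times 1\text{ vector valued } f:\ E_+^{-1}f\in H_2^p\ominus E_+^{-1}E_-H_2^p\}$,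 where $H_2^p=H_2^p(\mathbb{C}_+)$ is the vector Hardy space, with inner product $\langle f,g\rangle_{\mathcal{B}(\mathfrak{E})}=\int_{-\infty}^\infty g(\mu)^*(E_+(\mu)E_+(\mu)^* )^{-1}f(\mu)\,d\mu$; its reproducing kernel is $\frac{E_+(\lambda)E_+(\omega)^*-E_-(\lambda)E_-(\omega)^*}{-2\pi i(\lambda-\overline{\omega})}$ for $\lambda\ne\overline{\omega}$. ''$\mathcal{H}_G$ is a de Branges space $\mathcal{B}(\mathfrak{E})$'' means that $\mathcal{H}_G=\mathcal{B}(\mathfrak{E})$ as Hilbert spaces (equivalently, as reproducing kernel Hilbert spaces with the same kernel) for some such $\mathfrak{E}$. *)

(* Defs.v *)
From mathcomp Require Import all_boot all_order all_algebra complex.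
From mathcomp Require Import all_classical all_reals all_analysis.
Set Implicit Arguments.
Unset Strict Implicit.
Unset Printing Implicit Defensive.
Import Order.TTheory GRing.Theory Num.Theory numFieldNormedType.Exports.
Local Open Scope classical_set_scope.
Local Open Scope ring_scope.
Local Open Scope complex_scope.
Local Open Scope sesquilinear_scope.

Section Matrices.
Variable R : realType.
Local Notation C := R[i].

Definition posdefmx k (A : 'M[C]_k) : Prop :=
  A \is hermsymmx /\ forall x : 'cV[C]_k, x != 0 -> 0 < (x^t* *m A *m x) 0 0.

(* A^{-1/2} for A positive definite: the inverse of the unique positive
   definite S with S ^ 2 = A. *)
Definition invsqrtmx k (A : 'M[C]_k) : 'M[C]_k :=
  invmx (xget 0 [set S | posdefmx S /\ S *m S = A]).

Definition sqnorm k (v : 'cV[C]_k) : R :=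
  \sum_i (complex.Re (v i 0) ^+ 2 + complex.Im (v i 0) ^+ 2).

(* The index type 'I_(\sum_(i < n.+1) p) has (n + 1) p elements; it is the one
   for which \mxrow and submxblock cut out blocks of constant size p. *)
Definition block_hankel p n (G : 'M[C]_(\sum_(i < n.+1) p)) : Prop :=
  forall i j k l : 'I_n.+1, (i + j = k + l)%N ->
    submxblock G i j = submxblock G k l.

Definition Fmx p n (z : C) : 'M[C]_(p, \sum_(i < n.+1) p) :=
  \mxrow_(j < n.+1) (z ^+ j)%:M.

Definition zmx p n (G : 'M[C]_(\sum_(i < n.+1) p)) (b : C)
    : 'M[C]_(\sum_(i < n.+1) p, p) :=
  invmx G *m (Fmx p n b)^t*
    *m invsqrtmx (Fmx p n b *m invmx G *m (Fmx p n b)^t*).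

Definition rho (w z : C) : C := - 2 * pi%:C * 'i%C * (z - w^*%C).

End Matrices.

Section HardyAndDeBranges.
Variable R : realType.
Local Notation C := R[i].
Local Notation leb := (@lebesgue_measure R).

Definition upper_half_plane : set C := [set z | 0 < complex.Im z].

(* Complex differentiability: the base field of R[i]^o is R[i]. *)
Definition holomorphic_on (D : set C) k l (f : C -> 'M[C]_(k, l)) : Prop :=
  forall z, D z -> forall i j,
    derivable (fun w : C^o => f w i j : C^o) (z : C^o) 1.

Definition entire k l (f : C -> 'M[C]_(k, l)) : Prop := holomorphic_on setT f.

Definition Cintegral (f : R -> C) : C :=
  (\int[leb]_x complex.Re (f x)) +i* (\int[leb]_x complex.Im (f x)).

(* fb is a boundary function on R of f, a function on the upper half-plane *)
Definition boundary_of k l (f : C -> 'M[C]_(k, l)) (fb : R -> 'M[C]_(k, l))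
    : Prop :=
  (forall i j, measurable_fun setT (fun x => complex.Re (fb x i j)) /\
               measurable_fun setT (fun x => complex.Im (fb x i j))) /\
  {ae leb, forall x, forall i j,
    f (x +i* y) i j @[y --> 0^'+] --> (fb x i j : C^o)}.

Definition hardy2 p (h : C -> 'cV[C]_p) : Prop :=
  holomorphic_on upper_half_plane h /\
  (ereal_sup [set \int[leb]_x (sqnorm (h (x +i* y)))%:E | y in `]0%R, +oo[ ]
     < +oo)%E.

(* Orthogonality in the Hardy space, whose inner product is the one of L_2(R)
   on boundary functions.  By Fatou's theorem every element of the Hardy space
   has a boundary function, unique almost everywhere, so the quantification
   over gb and kb is neither vacuous nor a choice. *)
Definition hardy2_orth p (g k : C -> 'cV[C]_p) : Prop :=
  forall gb kb : R -> 'cV[C]_p, boundary_of g gb -> boundary_of k kb ->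
    Cintegral (fun x => ((kb x)^t* *m gb x) 0 0) = 0.

Definition inner_function p (b : C -> 'M[C]_p) : Prop :=
  [/\ holomorphic_on upper_half_plane b,
      forall z, upper_half_plane z ->
        forall v : 'cV[C]_p, sqnorm (b z *m v) <= sqnorm v
    & exists2 bb : R -> 'M[C]_p, boundary_of b bb &
        {ae leb, forall x, bb x \is unitarymx}].

(* E z = [E_-(z) E_+(z)] *)
Definition Eminus p (E : C -> 'M[C]_(p, p + p)) (z : C) : 'M[C]_p :=
  lsubmx (E z).
Definition Eplus p (E : C -> 'M[C]_(p, p + p)) (z : C) : 'M[C]_p :=
  rsubmx (E z).

Definition de_branges_matrix p (E : C -> 'M[C]_(p, p + p)) : Prop :=
  [/\ entire E,
      forall z, upper_half_plane z -> \det (Eplus E z) != 0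
    & inner_function (fun z => invmx (Eplus E z) *m Eminus E z)].

Definition de_branges_space p (E : C -> 'M[C]_(p, p + p))
    : set (C -> 'cV[C]_p) :=
  [set f | [/\ entire f,
      hardy2 (fun z => invmx (Eplus E z) *m f z)
    & forall h, hardy2 h ->
        hardy2_orth (fun z => invmx (Eplus E z) *m f z)
                    (fun z => invmx (Eplus E z) *m Eminus E z *m h z)]].

(* E_+(x) may be singular at isolated real x, where the integrand takes an
   irrelevant value. *)
Definition de_branges_inner p (E : C -> 'M[C]_(p, p + p))
    (f g : C -> 'cV[C]_p) : C :=
  Cintegral (fun x => ((g x%:C)^t*
    *m invmx (Eplus E x%:C *m (Eplus E x%:C)^t*) *m f x%:C) 0 0).

(* H_G = B(E) as Hilbert spaces.  The vector space underlying H_G does not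
   depend on G; its inner product does, and u is determined by F u. *)
Definition HG_is_de_branges_space p n (G : 'M[C]_(\sum_(i < n.+1) p))
    (E : C -> 'M[C]_(p, p + p)) : Prop :=
  [/\ de_branges_matrix E,
      range (fun (u : 'cV[C]_(\sum_(i < n.+1) p)) z => Fmx p n z *m u)
        = de_branges_space E
    & forall u v : 'cV[C]_(\sum_(i < n.+1) p),
        de_branges_inner E (fun z => Fmx p n z *m u) (fun z => Fmx p n z *m v)
        = (v^t* *m G *m u) 0 0].

End HardyAndDeBranges.

(* Main.v *)
Require Import Defs.
From mathcomp Require Import all_boot all_order all_algebra complex.
From mathcomp Require Import all_classical all_reals all_analysis.
From mathcomp Require Import measurable_realfun ring lra.
Set Implicit Arguments.
Unset Strict Implicit.
Unset Printing Implicit Defensive.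
Import Order.TTheory GRing.Theory Num.Theory numFieldNormedType.Exports.
Local Open Scope classical_set_scope.
Local Open Scope ring_scope.
Local Open Scope complex_scope.
Local Open Scope sesquilinear_scope.

Local Notation Re := complex.Re.
Local Notation Im := complex.Im.

(** Suppose that the Gram matrix [G] is block Hankel, and let [K z w] be the
    reproducing kernel [F z *m invmx G *m (F w)^t*].

    Multiplication by the variable is then symmetric for the form of [G], so
    multiplying by [(z - conj a) / (z - a)] is an isometry of the space of
    polynomials vanishing at [a] onto the space of those vanishing at [conj a]
    ([division_isometry]).  Comparing the reproducing kernels of the two
    subspaces, each of which is [K] minus the contribution of one point
    ([kernel_isometry]), gives the identity
    [Ep z (Ep w)^* - Em z (Em w)^* = rho w z K z w] for the stated [Ep] and [Em]
    ([kernel_formula]).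

    Any entire pair with this identity realizes the space.  Positivity of [K]
    makes [Ep] invertible on the closed upper half-plane and [theta], the
    quotient of [Em] by [Ep], an inner function, contractive inside and unitary
    on the line.  Moreover the quotient by [Ep] of a kernel [K z w v] is
    [(rho w z)^-1] times the difference of a constant and [theta] times a
    constant ([quot_kernel]), and every polynomial is a finite sum of kernels
    ([kernel_span]).  The Cauchy formula in the Hardy space evaluates all
    integrals against such quotients: a polynomial is in the Hardy space after
    division by [Ep] and is orthogonal to the range of [theta]
    ([quot_pol_orth]).  Conversely, an element [f] of the de Branges space
    satisfies [f w = F w *m (invmx G *m moment f)] for [w] in the upper
    half-plane ([reproduction]), hence everywhere, so that it is a polynomial;
    and for a polynomial [F u] this reads [moment (F u) = G u], which is the
    equality of the inner products.

    The converse is immediate: in a de Branges space the inner product of two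
    monomials is an integral of [x ^ (i + j)] against a fixed matrix density
    ([realization_hankel]).

    The analysis needed is built from the existence of the complex derivative
    alone: Goursat's theorem for rectangles, an identity theorem for functions
    vanishing on a half-plane ([identity_upper]), and the Cauchy formula for
    boundary values of Hardy functions ([hardy_cauchy]).  The latter is obtained
    without a general theory of boundary values, as a limit of integrals over
    horizontal lines: mean square bounds replace a dominating function
    ([weak_limit_integral0]), and rectangles whose vertical sides carry little
    mass are found by exchanging integrations ([exists_small_section]). *)

(** * Complex differentiability *)

Section ComplexBasics.
Variable R : realType.
Local Notation C := R[i].
Local Notation normc := (@ComplexField.Normc.normc R).

Lemma normr_normc (z : C) : `|z| = (normc z)%:C. Proof. by []. Qed.
Lemma normc_sqr (z : C) : normc z ^+ 2 = Re z ^+ 2 + Im z ^+ 2.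
Proof. by case: z => a b /=; rewrite sqr_sqrtr // addr_ge0 ?sqr_ge0. Qed.
Lemma normc_ge0 (z : C) : 0 <= normc z.
Proof. by case: z => a b; exact: sqrtr_ge0. Qed.
Lemma Re_le_normc (z : C) : `|Re z| <= normc z.
Proof. by case: z => a b /=; rewrite -sqrtr_sqr ler_wsqrtr // lerDl sqr_ge0. Qed.
Lemma Im_le_normc (z : C) : `|Im z| <= normc z.
Proof. by case: z => a b /=; rewrite -sqrtr_sqr ler_wsqrtr // lerDr sqr_ge0. Qed.
Lemma normc_le (z : C) : normc z <= `|Re z| + `|Im z|.
Proof.
case: z => a b /=; rewrite -(ger0_norm (addr_ge0 (normr_ge0 a) (normr_ge0 b))).
rewrite -sqrtr_sqr ler_wsqrtr // sqrrD !real_normK ?num_real //.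
by rewrite -addrA [X in _ <= _ + X]addrC lerD2l lerDl mulrn_wge0 ?mulr_ge0.
Qed.
Lemma normc_eq0 (z : C) : (normc z == 0) = (z == 0).
Proof.
apply/eqP/eqP; first exact: ComplexField.Normc.eq0_normc.
by move=> ->; rewrite ComplexField.Normc.normc0.
Qed.
Lemma normc_gt0 (z : C) : (0 < normc z) = (z != 0).
Proof. by rewrite lt_neqAle normc_ge0 andbT eq_sym normc_eq0. Qed.
Lemma normcD (x y : C) : normc (x + y) <= normc x + normc y.
Proof. exact: (le_normcD (x : Rcomplex R)). Qed.
Lemma normcNn (x : C) : normc (- x) = normc x.
Proof. exact: (normcN (x : Rcomplex R)). Qed.
Lemma normcB (x y : C) : normc (x - y) <= normc x + normc y.
Proof. by rewrite -(normcNn y) normcD. Qed.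
Lemma normcMM (x y : C) : normc (x * y) = normc x * normc y.
Proof. exact: ComplexField.Normc.normcM. Qed.
Lemma normcVV (x : C) : normc x^-1 = (normc x)^-1.
Proof. exact: ComplexField.Normc.normcV. Qed.
Lemma normcX (x : C) k : normc (x ^+ k) = normc x ^+ k.
Proof.
elim: k => [|k IH]; first by rewrite !expr0 ComplexField.Normc.normc1.
by rewrite !exprS normcMM IH.
Qed.
Lemma normc_real (x : R) : normc x%:C = `|x|.
Proof. by rewrite /= expr0n /= addr0 sqrtr_sqr. Qed.

Lemma nbhsC_normc (z : C) (P : set C) :
  nbhs (z : C^o) P <-> exists2 d : R, 0 < d & forall w, normc (w - z) < d -> P w.
Proof.
split.
  move=> /nbhs_ballP[e /= e0 H]; have eE : e = (Re e)%:C.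
    by apply/esym/RRe_real; rewrite gtr0_real.
  exists (Re e); first by rewrite eE ltcR in e0.
  by move=> w Hw; apply: H; rewrite /ball /= eE distrC normr_normc ltcR.
move=> [d d0 H]; apply/nbhs_ballP; exists d%:C => /=; first by rewrite ltcR.
by move=> w; rewrite /ball /= distrC normr_normc ltcR; exact: H.
Qed.

Lemma cont_Re : continuous (fun z : C^o => Re (z : C) : R^o).
Proof.
move=> z P /nbhs_ballP[e /= e0 HP]; apply/nbhsC_normc; exists e => // w Hw.
apply: HP; rewrite /ball /= distrC; apply: le_lt_trans Hw.
by rewrite -raddfB /=; exact: Re_le_normc.
Qed.

Lemma cont_Im : continuous (fun z : C^o => Im (z : C) : R^o).
Proof.
move=> z P /nbhs_ballP[e /= e0 HP]; apply/nbhsC_normc; exists e => // w Hw.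
apply: HP; rewrite /ball /= distrC; apply: le_lt_trans Hw.
by rewrite -raddfB /=; exact: Im_le_normc.
Qed.

Lemma cvg_complex (T : Type) (F : set_system T) (FF : Filter F) (f : T -> C) (l : C) :
  (Re (f x) @[x --> F] --> Re l) -> (Im (f x) @[x --> F] --> Im l) ->
  f x @[x --> F] --> (l : C^o).
Proof.
move=> hr hi P /nbhsC_normc[e e0 HP].
have e20 : 0 < e / 2 by rewrite divr_gt0.
move/cvgrPdist_lt/(_ _ e20): hr => hr; move/cvgrPdist_lt/(_ _ e20): hi => hi.
rewrite /fmap /=; near=> x; apply: HP; apply: (le_lt_trans (normc_le _)).
rewrite [e](splitr e) ltrD //= raddfB distrC; near: x; [exact: hr|exact: hi].
Unshelve. all: by end_near. Qed.

Lemma cont_horiz (y : R) : continuous (fun x : R => (x +i* y : C^o)).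
Proof.
by move=> x; apply: cvg_complex => /=; [exact: cvg_id|exact: cvg_cst].
Qed.
Lemma cont_vert (x : R) : continuous (fun y : R => (x +i* y : C^o)).
Proof.
by move=> y; apply: cvg_complex => /=; [exact: cvg_cst|exact: cvg_id].
Qed.

Definition holo (f : C -> C) (z : C) := derivable (f : C^o -> C^o) (z : C^o) 1.

Lemma holo_approx f z : holo f z -> exists d : C, forall e : R, 0 < e ->
  exists2 r : R, 0 < r & forall w, normc (w - z) < r ->
    normc (f w - f z - d * (w - z)) <= e * normc (w - z).
Proof.
move=> /cvg_ex[d hd]; exists d => e e0.
have : nbhs (d : C^o) [set w | normc (w - d) < e].
  by apply/nbhsC_normc; exists e.
move=> /hd /nbhs_ballP[r /= r0 H]; have rE : r = (Re r)%:C.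
  by apply/esym/RRe_real; rewrite gtr0_real.
exists (Re r); first by rewrite rE ltcR in r0.
move=> w Hw; have [->|wz] := eqVneq w z.
  by rewrite !subrr mulr0 subr0 ComplexField.Normc.normc0 mulr0.
have wz' : w - z != 0 by rewrite subr_eq0.
have := H (w - z); rewrite /ball /= sub0r normrN normr_normc rE ltcR => /(_ Hw wz').
rewrite /GRing.scale /= mulr1 subrK => Hlt.
have -> : f w - f z - d * (w - z) = ((w - z)^-1 * (f w - f z) - d) * (w - z).
  by rewrite mulrBl mulrAC mulVf // mul1r.
by rewrite normcMM ler_wpM2r ?normc_ge0 // ltW.
Qed.

Lemma holo_cont f z : holo f z -> {for (z : C^o), continuous (f : C^o -> C^o)}.
Proof. by move=> /derivable1_diffP /differentiable_continuous. Qed.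

End ComplexBasics.

(** * Integrals of complex functions of a real variable *)

Section ComplexIntegral.
Variable R : realType.
Local Notation C := R[i].
Local Notation leb := (@lebesgue_measure R).
Local Notation normc := (@ComplexField.Normc.normc R).

Definition Cint (D : set R) (g : R -> C) : C :=
  (\int[leb]_(x in D) Re (g x)) +i* (\int[leb]_(x in D) Im (g x)).

Definition cintegrable (D : set R) (g : R -> C) :=
  leb.-integrable D (fun x => (Re (g x))%:E) /\
  leb.-integrable D (fun x => (Im (g x))%:E).

Lemma cReD (x y : C) : Re (x + y) = Re x + Re y. Proof. exact: raddfD. Qed.
Lemma cImD (x y : C) : Im (x + y) = Im x + Im y. Proof. exact: raddfD. Qed.
Lemma cReB (x y : C) : Re (x - y) = Re x - Re y. Proof. exact: raddfB. Qed.
Lemma cImB (x y : C) : Im (x - y) = Im x - Im y. Proof. exact: raddfB. Qed.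
Lemma cReN (x : C) : Re (- x) = - Re x. Proof. exact: raddfN. Qed.
Lemma cImN (x : C) : Im (- x) = - Im x. Proof. exact: raddfN. Qed.
Lemma cReM (x y : C) : Re (x * y) = Re x * Re y - Im x * Im y.
Proof. by case: x; case: y. Qed.
Lemma cImM (x y : C) : Im (x * y) = Re x * Im y + Im x * Re y.
Proof. by case: x; case: y. Qed.

Lemma C_eqP (x y : C) : Re x = Re y -> Im x = Im y -> x = y.
Proof. by case: x; case: y => /= ? ? ? ? -> ->. Qed.

Section OnDomain.
Variable D : set R.
Hypothesis mD : measurable D.

Lemma eq_Cint (f g : R -> C) : {in D, f =1 g} -> Cint D f = Cint D g.
Proof.
by move=> fg; congr Complex; apply: eq_Rintegral => x xD; rewrite fg.
Qed.

Lemma cintegrableD (f g : R -> C) : cintegrable D f -> cintegrable D g ->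
  cintegrable D (fun x => f x + g x).
Proof.
move=> [f1 f2] [g1 g2]; split.
  by under eq_fun do rewrite cReD EFinD; exact: integrableD.
by under eq_fun do rewrite cImD EFinD; exact: integrableD.
Qed.

Lemma CintD (f g : R -> C) : cintegrable D f -> cintegrable D g ->
  Cint D (fun x => f x + g x) = Cint D f + Cint D g.
Proof.
move=> [f1 f2] [g1 g2]; apply: C_eqP.
  by rewrite cReD /= -RintegralD //; apply: eq_Rintegral => x _; rewrite cReD.
by rewrite cImD /= -RintegralD //; apply: eq_Rintegral => x _; rewrite cImD.
Qed.

Lemma cintegrableZ (k : C) (f : R -> C) : cintegrable D f ->
  cintegrable D (fun x => k * f x).
Proof.
move=> [f1 f2]; split.
  under eq_fun do rewrite cReM EFinB !EFinM.
  by apply: integrableB => //; exact: integrableZl.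
under eq_fun do rewrite cImM EFinD !EFinM.
by apply: integrableD => //; exact: integrableZl.
Qed.

Let RintegralZl' r (f : R -> R) : measurable D -> leb.-integrable D (EFin \o f) ->
  \int[leb]_(x in D) (r * f x) = r * \int[leb]_(x in D) f x.
Proof. by move=> ? ?; exact: RintegralZl. Qed.

Lemma CintZ (k : C) (f : R -> C) : cintegrable D f ->
  Cint D (fun x => k * f x) = k * Cint D f.
Proof.
move=> [f1 f2].
have g1 (a : R) : leb.-integrable D (fun x => (a * Re (f x))%:E).
  by under eq_fun do rewrite EFinM; exact: integrableZl.
have g2 (a : R) : leb.-integrable D (fun x => (a * Im (f x))%:E).
  by under eq_fun do rewrite EFinM; exact: integrableZl.
apply: C_eqP.
  rewrite cReM /= -(RintegralZl' (Re k) mD f1) -(RintegralZl' (Im k) mD f2).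
  rewrite -RintegralB //; [|exact: (g1 (Re k))|exact: (g2 (Im k))].
  by apply: eq_Rintegral => x _; rewrite cReM.
rewrite cImM /= -(RintegralZl' (Re k) mD f2) -(RintegralZl' (Im k) mD f1).
rewrite -RintegralD //; [|exact: (g2 (Re k))|exact: (g1 (Im k))].
by apply: eq_Rintegral => x _; rewrite cImM.
Qed.

Lemma cintegrableN (f : R -> C) : cintegrable D f -> cintegrable D (fun x => - f x).
Proof.
by move=> /(cintegrableZ (-1)); under eq_fun do rewrite mulN1r.
Qed.

Lemma cintegrableB (f g : R -> C) : cintegrable D f -> cintegrable D g ->
  cintegrable D (fun x => f x - g x).
Proof. by move=> fi /cintegrableN; exact: cintegrableD. Qed.

Lemma CintB (f g : R -> C) : cintegrable D f -> cintegrable D g ->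
  Cint D (fun x => f x - g x) = Cint D f - Cint D g.
Proof.
move=> fi gi; rewrite CintD //; last exact: cintegrableN.
rewrite -[- Cint D g]mulN1r -CintZ //.
by congr (_ + _); apply: eq_Cint => x _; rewrite mulN1r.
Qed.

Lemma cintegrable0 : cintegrable D (fun=> 0).
Proof. by split; exact: integrable0. Qed.

Lemma Cint0 : Cint D (fun=> 0) = 0.
Proof. by apply: C_eqP; rewrite /= Rintegral_cst // mul0r. Qed.

Lemma cintegrable_sum (I : Type) (s : seq I) (f : I -> R -> C) :
  (forall i, cintegrable D (f i)) -> cintegrable D (fun x => \sum_(i <- s) f i x).
Proof.
move=> fi; elim: s => [|i s IH].
  by under eq_fun do rewrite big_nil; exact: cintegrable0.
by under eq_fun do rewrite big_cons; exact: cintegrableD.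
Qed.

Lemma Cint_sum (I : Type) (s : seq I) (f : I -> R -> C) :
  (forall i, cintegrable D (f i)) ->
  Cint D (fun x => \sum_(i <- s) f i x) = \sum_(i <- s) Cint D (f i).
Proof.
move=> fi; elim: s => [|i s IH].
  by under eq_fun do rewrite big_nil; rewrite big_nil Cint0.
under eq_fun do rewrite big_cons.
by rewrite big_cons -IH -CintD //; exact: cintegrable_sum.
Qed.

Let norm_le (h : R -> R) : leb.-integrable D (EFin \o h) ->
  `|\int[leb]_(x in D) h x| <= \int[leb]_(x in D) `|h x|.
Proof. by move=> ?; exact: le_normr_Rintegral. Qed.

Lemma normc_Cint (f : R -> C) (b : R -> R) : cintegrable D f ->
  leb.-integrable D (EFin \o b) -> (forall x, D x -> normc (f x) <= b x) ->
  normc (Cint D f) <= 2 * \int[leb]_(x in D) b x.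
Proof.
move=> [f1 f2] bi fb; apply: (le_trans (normc_le _)) => /=.
rewrite mulr_natl mulr2n; apply: lerD.
  apply: (le_trans (norm_le f1)); apply: le_Rintegral => //.
    exact: integrable_norm f1.
  by move=> x Dx; exact: le_trans (Re_le_normc _) (fb _ Dx).
apply: (le_trans (norm_le f2)); apply: le_Rintegral => //.
  exact: integrable_norm f2.
by move=> x Dx; exact: le_trans (Im_le_normc _) (fb _ Dx).
Qed.

End OnDomain.

Definition seg_cont (a b : R) (g : R -> C) := forall x, a <= x <= b ->
  {for x, continuous (g : R -> C^o)}.

Lemma seg_contRe a b g : seg_cont a b g -> {within `[a, b], continuous (fun x => Re (g x))}.
Proof.
move=> gc; apply: continuous_in_subspaceT => x; rewrite inE /= in_itv /= => xab.
apply: (@continuous_comp R C^o R^o g (fun z => Re (z : C)) x); first exact: gc.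
exact: cont_Re.
Qed.

Lemma seg_contIm a b g : seg_cont a b g -> {within `[a, b], continuous (fun x => Im (g x))}.
Proof.
move=> gc; apply: continuous_in_subspaceT => x; rewrite inE /= in_itv /= => xab.
apply: (@continuous_comp R C^o R^o g (fun z => Im (z : C)) x); first exact: gc.
exact: cont_Im.
Qed.

Lemma seg_cont_sub a b c d g : a <= c -> d <= b -> seg_cont a b g -> seg_cont c d g.
Proof.
move=> ac db gc x /andP[cx xd]; apply: gc.
by rewrite (le_trans ac cx) (le_trans xd db).
Qed.

Lemma seg_cintegrable a b g : seg_cont a b g -> cintegrable `[a, b] g.
Proof.
move=> gc; split.
  apply: continuous_compact_integrable; first exact: segment_compact.
  exact: seg_contRe.
apply: continuous_compact_integrable; first exact: segment_compact.
exact: seg_contIm.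
Qed.

Lemma Rint_split (f : R -> R) a c b : a <= c <= b ->
  leb.-integrable `[a, b] (EFin \o f) ->
  \int[leb]_(x in `[a, b]) f x = \int[leb]_(x in `[a, c]) f x + \int[leb]_(x in `[c, b]) f x.
Proof.
move=> /andP[ac cb] fi.
have := Rintegral_itvB fi (x := c); rewrite !bnd_simp => /(_ ac cb) H.
rewrite Rintegral_itv_obnd_cbnd in H; first by rewrite -H addrC subrK.
apply: integrableS fi => //.
by move=> x /=; rewrite !in_itv /= => /andP[/ltW cx ->]; rewrite (le_trans ac cx).
Qed.

Lemma Cint_split g a c b : a <= c <= b -> seg_cont a b g ->
  Cint `[a, b] g = Cint `[a, c] g + Cint `[c, b] g.
Proof.
move=> acb /seg_cintegrable[g1 g2]; apply: C_eqP.
  by rewrite cReD /= (Rint_split acb g1).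
by rewrite cImD /= (Rint_split acb g2).
Qed.

Lemma normc_seg_Cint g a b M : a <= b -> seg_cont a b g ->
  (forall x, a <= x <= b -> normc (g x) <= M) ->
  normc (Cint `[a, b] g) <= 2 * M * (b - a).
Proof.
move=> ab gc gM; rewrite -mulrA.
have -> : M * (b - a) = \int[leb]_(x in `[a, b]) (cst M x).
  rewrite Rintegral_cst //= lebesgue_measure_itv /= lte_fin.
  move: ab; rewrite le_eqVlt => /orP[/eqP ->|ab]; first by rewrite ltxx subrr.
  by rewrite ab -EFinB.
apply: normc_Cint => //; first exact: seg_cintegrable.
apply: continuous_compact_integrable; first exact: segment_compact.
by apply: continuous_subspaceT; exact: cst_continuous.
Qed.

End ComplexIntegral.

(** * Goursat's theorem for rectangles *)

Section Goursat.
Variable R : realType.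
Local Notation C := R[i].
Local Notation normc := (@ComplexField.Normc.normc R).

(** The counterclockwise contour integral along the boundary of the rectangle
    [[a, b] x [c, d]]. *)
Definition rectint (f : C -> C) (a b c d : R) : C :=
  Cint `[a, b] (fun x => f (x +i* c)) - Cint `[a, b] (fun x => f (x +i* d))
  + 'i%C * (Cint `[c, d] (fun y => f (b +i* y)) - Cint `[c, d] (fun y => f (a +i* y))).

Definition rect_side_cont (f : C -> C) a b c d :=
  [/\ seg_cont a b (fun x => f (x +i* c)), seg_cont a b (fun x => f (x +i* d)),
      seg_cont c d (fun y => f (b +i* y)) & seg_cont c d (fun y => f (a +i* y))].

Lemma seg_cont_horiz (f : C -> C) a b y :
  (forall x, a <= x <= b -> {for (x +i* y : C^o), continuous (f : C^o -> C^o)}) ->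
  seg_cont a b (fun x => f (x +i* y)).
Proof.
move=> fc x xab.
apply: (@continuous_comp R C^o C^o (fun x => x +i* y) f x); last exact: fc.
exact: cont_horiz.
Qed.

Lemma seg_cont_vert (f : C -> C) a b x :
  (forall y, a <= y <= b -> {for (x +i* y : C^o), continuous (f : C^o -> C^o)}) ->
  seg_cont a b (fun y => f (x +i* y)).
Proof.
move=> fc y yab.
apply: (@continuous_comp R C^o C^o (fun y => x +i* y) f y); last exact: fc.
exact: cont_vert.
Qed.

Lemma rect_cont_side (f : C -> C) a b c d : a <= b -> c <= d ->
  (forall x y, a <= x <= b -> c <= y <= d ->
     {for (x +i* y : C^o), continuous (f : C^o -> C^o)}) ->
  rect_side_cont f a b c d.
Proof.
move=> ab cd fc; split.
- by apply: seg_cont_horiz => x xab; apply: fc; rewrite ?lexx.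
- by apply: seg_cont_horiz => x xab; apply: fc; rewrite ?lexx ?cd.
- by apply: seg_cont_vert => y ycd; apply: fc; rewrite ?lexx ?ab.
- by apply: seg_cont_vert => y ycd; apply: fc; rewrite ?lexx ?ab.
Qed.

Lemma rectint_splitv f a e b c d : a <= e <= b ->
  seg_cont a b (fun x => f (x +i* c)) -> seg_cont a b (fun x => f (x +i* d)) ->
  rectint f a b c d = rectint f a e c d + rectint f e b c d.
Proof.
by move=> aeb fc fd; rewrite /rectint (Cint_split aeb fc) (Cint_split aeb fd); ring.
Qed.

Lemma rectint_splith f a b c e d : c <= e <= d ->
  seg_cont c d (fun y => f (a +i* y)) -> seg_cont c d (fun y => f (b +i* y)) ->
  rectint f a b c d = rectint f a b c e + rectint f a b e d.
Proof.
by move=> ced fa fb; rewrite /rectint (Cint_split ced fa) (Cint_split ced fb); ring.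
Qed.

Lemma rectintB f g a b c d : rect_side_cont f a b c d -> rect_side_cont g a b c d ->
  rectint (fun z => f z - g z) a b c d = rectint f a b c d - rectint g a b c d.
Proof.
move=> [f1 f2 f3 f4] [g1 g2 g3 g4]; rewrite /rectint.
by rewrite !CintB //; do ?exact: seg_cintegrable; ring.
Qed.

Lemma rectintZ k f a b c d : rect_side_cont f a b c d ->
  rectint (fun z => k * f z) a b c d = k * rectint f a b c d.
Proof.
move=> [f1 f2 f3 f4]; rewrite /rectint.
by rewrite !CintZ //; do ?exact: seg_cintegrable; ring.
Qed.

Lemma rectint_le f a b c d M : a <= b -> c <= d -> rect_side_cont f a b c d ->
  (forall x y, a <= x <= b -> c <= y <= d ->
     [|| x == a, x == b, y == c | y == d] -> normc (f (x +i* y)) <= M) ->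
  normc (rectint f a b c d) <= 4 * M * ((b - a) + (d - c)).
Proof.
move=> ab cd [f1 f2 f3 f4] fM; rewrite /rectint.
apply: (le_trans (normcD _ _)).
have -> : 4 * M * (b - a + (d - c)) = (2 * M * (b - a) + 2 * M * (b - a)) +
   (2 * M * (d - c) + 2 * M * (d - c)) by ring.
apply: lerD.
  apply: (le_trans (normcB _ _)); apply: lerD.
    by apply: normc_seg_Cint => // x xab; apply: fM; rewrite ?lexx ?eqxx ?orbT.
  by apply: normc_seg_Cint => // x xab; apply: fM; rewrite ?lexx ?cd ?eqxx ?orbT.
have normci : normc 'i%C = 1 by rewrite /= expr0n expr1n /= add0r sqrtr1.
rewrite normcMM normci mul1r.
apply: (le_trans (normcB _ _)); apply: lerD.
  by apply: normc_seg_Cint => // x xab; apply: fM; rewrite ?lexx ?ab ?eqxx ?orbT.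
by apply: normc_seg_Cint => // x xab; apply: fM; rewrite ?lexx ?ab ?eqxx ?orbT.
Qed.

Lemma cont_affine (p q : C) : continuous (fun z : C^o => p + q * (z : C) : C^o).
Proof.
move=> z; apply: continuousD; first exact: cst_continuous.
by apply: continuousM; [exact: cst_continuous|exact: cvg_id].
Qed.

Lemma Cint_cst (a b : R) (k : C) : a <= b -> Cint `[a, b] (fun=> k) = k * (b - a)%:C.
Proof.
move=> ab; case: k => k1 k2; apply: C_eqP; rewrite /= Rintegral_cst //= lebesgue_measure_itv /= lte_fin;
  move: ab; rewrite le_eqVlt => /orP[/eqP ->|ab].
- by rewrite ltxx /=; ring.
- by rewrite ab /=; ring.
- by rewrite ltxx /=; ring.
- by rewrite ab /=; ring.
Qed.

(** The integrands on opposite sides of the rectangle differ by a constant. *)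
Lemma rectint_affine (p q : C) a b c d : a <= b -> c <= d ->
  rectint (fun z => p + q * z) a b c d = 0.
Proof.
move=> ab cd; have ch u v y := @seg_cont_horiz (fun z => p + q * z) u v y
  (fun x _ => @cont_affine p q (x +i* y)).
have cv u v x := @seg_cont_vert (fun z => p + q * z) u v x
  (fun y _ => @cont_affine p q (x +i* y)).
rewrite /rectint -!CintB //; do ?[exact: seg_cintegrable].
rewrite (_ : (fun x => _) = fun=> q * (0 +i* (c - d))); last first.
  by apply/funext => x; apply: C_eqP; rewrite !(cReB, cImB, cReD, cImD, cReM, cImM) /=; ring.
rewrite [X in _ * Cint _ X](_ : _ = fun=> q * (b - a)%:C); last first.
  by apply/funext => x; apply: C_eqP; rewrite !(cReB, cImB, cReD, cImD, cReM, cImM) /=; ring.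
rewrite !Cint_cst //.
by apply: C_eqP; rewrite !(cReB, cImB, cReD, cImD, cReM, cImM) /=; ring.
Qed.

Lemma nested_point (u : nat -> R) (L : R) : 0 <= L ->
  (forall k, u k <= u k.+1 <= u k + L / 2 ^+ k.+1) ->
  exists x, forall k, u k <= x <= u k + L / 2 ^+ k.
Proof.
move=> L0 H.
have um i j : (i <= j)%N -> u i <= u j.
  elim: j => [|j IH]; first by rewrite leqn0 => /eqP ->.
  rewrite leq_eqVlt => /orP[/eqP -> //|/IH h]; apply: le_trans h _.
  by case/andP: (H j).
have vm i j : (i <= j)%N -> u j + L / 2 ^+ j <= u i + L / 2 ^+ i.
  elim: j => [|j IH]; first by rewrite leqn0 => /eqP ->.
  rewrite leq_eqVlt => /orP[/eqP -> //|/IH h]; apply: le_trans h.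
  case/andP: (H j) => _; rewrite exprS invfM => h.
  have -> : L / 2 ^+ j = L * (2^-1 / 2 ^+ j) + L * (2^-1 / 2 ^+ j).
    by field; rewrite expf_neq0.
  by move: h; set t := L * _; lra.
have ub j k : u j <= u k + L / 2 ^+ k.
  have [jk|/ltnW kj] := leqP j k.
    apply: (le_trans (um _ _ jk)); rewrite lerDl mulr_ge0 ?invr_ge0 ?exprn_ge0 //.
  apply: le_trans (vm _ _ kj); rewrite lerDl mulr_ge0 ?invr_ge0 ?exprn_ge0 //.
have hs : has_sup (range u).
  by split; [exists (u 0%N), 0%N | exists (u 0%N + L / 2 ^+ 0) => _ [k _ <-]; exact: ub].
exists (sup (range u)) => k; apply/andP; split.
  by apply: sup_upper_bound => //; exists k.
by apply: ge_sup; [exists (u 0%N), 0%N | move=> _ [j _ <-]; exact: ub].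
Qed.

Lemma half_pow_lt (S r : R) : 0 < r -> exists k, S / 2 ^+ k < r.
Proof.
move=> r0; have [k hk] : exists k : nat, S / r < k%:R.
  by exists (Num.truncn (S / r)).+1; exact: truncnS_gt.
exists k; rewrite ltr_pdivrMr ?exprn_gt0 // mulrC -ltr_pdivrMr //.
by apply: (lt_le_trans hk); rewrite -natrX ler_nat ltnW // ltn_expl.
Qed.

(** Bisection: a rectangle with a large integral has a quarter with a
    proportionally large one; the common point of the resulting nested
    sequence would contradict differentiability there, because affine
    functions integrate to zero. *)
Lemma goursat f a b c d : a <= b -> c <= d ->
  (forall x y, a <= x <= b -> c <= y <= d -> holo f (x +i* y)) ->
  rectint f a b c d = 0.
Proof.
move=> ab cd fh.
set L := b - a; set H := d - c; set S := L + H.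
have L0 : 0 <= L by rewrite subr_ge0.
have H0 : 0 <= H by rewrite subr_ge0.
pose I k (q : R * R) := normc (rectint f q.1 (q.1 + L / 2 ^+ k) q.2 (q.2 + H / 2 ^+ k)).
pose inside k (q : R * R) := (a <= q.1 /\ q.1 + L / 2 ^+ k <= b) /\
                             (c <= q.2 /\ q.2 + H / 2 ^+ k <= d).
(* [S] is half the perimeter; halving the sides divides [S ^+ 2] by four, the
   number of quarters. *)
suff bnd e : 0 < e -> I 0%N (a, c) <= e * S ^+ 2.
  apply/eqP; rewrite -normc_eq0; apply/eqP/le_anti; rewrite normc_ge0 andbT.
  have aL : a + L = b by rewrite /L; lra.
  have cH : c + H = d by rewrite /H; lra.
  move: bnd; rewrite /I /= !expr0 !divr1 aL cH => bnd.
  apply/ler_addgt0Pr => e e0; rewrite add0r.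
  have S0 : 0 < S ^+ 2 + 1 by rewrite ltr_wpDl ?sqr_ge0.
  apply: (le_trans (bnd (e / (S ^+ 2 + 1)) _)); first by rewrite divr_gt0.
  by rewrite mulrAC ler_pdivrMr // ler_pM2l // lerDl.
move=> e0; rewrite leNgt; apply/negP => big0.
pose bad k q := inside k q /\ e * (S / 2 ^+ k) ^+ 2 < I k q.
pose next k (q q' : R * R) := (q.1 <= q'.1 <= q.1 + L / 2 ^+ k.+1) /\
                              (q.2 <= q'.2 <= q.2 + H / 2 ^+ k.+1).
have step k q : bad k q -> exists q', next k q q' /\ bad k.+1 q'.
  move=> [[[aq1 q1b] [cq2 q2d]] Ibig].
  set l := L / 2 ^+ k.+1; set h := H / 2 ^+ k.+1.
  have l0 : 0 <= l by rewrite mulr_ge0 // invr_ge0 exprn_ge0.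
  have h0 : 0 <= h by rewrite mulr_ge0 // invr_ge0 exprn_ge0.
  have Lk : L / 2 ^+ k = l + l by rewrite /l exprS invfM; field; rewrite expf_neq0.
  have Hk : H / 2 ^+ k = h + h by rewrite /h exprS invfM; field; rewrite expf_neq0.
  have fcont x y : a <= x <= b -> c <= y <= d ->
      {for (x +i* y : C^o), continuous (f : C^o -> C^o)}.
    by move=> xab ycd; apply: holo_cont; exact: fh.
  have hsplit : rectint f q.1 (q.1 + L / 2 ^+ k) q.2 (q.2 + H / 2 ^+ k) =
     (rectint f q.1 (q.1 + l) q.2 (q.2 + h) +
      rectint f q.1 (q.1 + l) (q.2 + h) (q.2 + h + h)) +
     (rectint f (q.1 + l) (q.1 + l + l) q.2 (q.2 + h) +
      rectint f (q.1 + l) (q.1 + l + l) (q.2 + h) (q.2 + h + h)).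
    have h1 : q.1 + L / 2 ^+ k <= b by [].
    have h2 : q.2 + H / 2 ^+ k <= d by [].
    rewrite Lk in h1 *; rewrite Hk in h2 *; rewrite (addrA q.1) in h1 *; rewrite (addrA q.2) in h2 *.
    have X x : q.1 <= x <= q.1 + l + l -> a <= x <= b.
      by move=> /andP[qx xq]; rewrite (le_trans aq1 qx) (le_trans xq h1).
    have Y y : q.2 <= y <= q.2 + h + h -> c <= y <= d.
      by move=> /andP[qx xq]; rewrite (le_trans cq2 qx) (le_trans xq h2).
    rewrite (@rectint_splitv f q.1 (q.1 + l) (q.1 + l + l)); first last.
    - apply: seg_cont_horiz => x /X ?; apply: fcont => //.
      by apply: Y; rewrite lexx andbT -addrA lerDl addr_ge0.
    - apply: seg_cont_horiz => x /X ?; apply: fcont => //.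
      by apply: Y; rewrite lexx -addrA lerDl addr_ge0.
    - by rewrite !lerDl l0.
    congr (_ + _); apply: rectint_splith; rewrite ?lerDl ?h0 //.
    - apply: seg_cont_vert => y /Y ?; apply: fcont => //.
      by apply: X; rewrite lexx -addrA lerDl addr_ge0.
    - apply: seg_cont_vert => y /Y ?; apply: fcont => //.
      by apply: X; rewrite !lerDl l0.
    - apply: seg_cont_vert => y /Y ?; apply: fcont => //.
      by apply: X; rewrite !lerDl l0.
    - apply: seg_cont_vert => y /Y ?; apply: fcont => //.
      by apply: X; rewrite lexx andbT -addrA lerDl addr_ge0.
  have hsum : I k q <= I k.+1 q + I k.+1 (q.1, q.2 + h) +
     (I k.+1 (q.1 + l, q.2) + I k.+1 (q.1 + l, q.2 + h)).
    rewrite /I hsplit; apply: (le_trans (normcD _ _)).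
    by apply: lerD; exact: normcD.
  have eE : e * (S / 2 ^+ k) ^+ 2 = 4 * (e * (S / 2 ^+ k.+1) ^+ 2).
    by rewrite (exprS 2 k); field; rewrite expf_neq0.
  have ins q' : q'.1 = q.1 \/ q'.1 = q.1 + l -> q'.2 = q.2 \/ q'.2 = q.2 + h ->
      next k q q' /\ inside k.+1 q'.
    case: q' => u v; rewrite /next /inside -/l -/h /= => h1 h2.
    rewrite Lk addrA in q1b; rewrite Hk addrA in q2d.
    have hu : (q.1 <= u <= q.1 + l) /\ (a <= u /\ u + l <= b).
      by case: h1 => ->; rewrite ?lexx ?lerDl ?l0 ?aq1 ?q1b ?(le_trans aq1) ?lerDl ?(le_trans _ q1b) ?lerDl.
    have hv : (q.2 <= v <= q.2 + h) /\ (c <= v /\ v + h <= d).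
      by case: h2 => ->; rewrite ?lexx ?lerDl ?h0 ?cq2 ?q2d ?(le_trans cq2) ?lerDl ?(le_trans _ q2d) ?lerDl.
    by case: hu => hu1 hu2; case: hv => hv1 hv2.
  have pick q' : q'.1 = q.1 \/ q'.1 = q.1 + l -> q'.2 = q.2 \/ q'.2 = q.2 + h ->
      (exists q', next k q q' /\ bad k.+1 q') \/ I k.+1 q' <= e * (S / 2 ^+ k.+1) ^+ 2.
    move=> h1 h2; have [n1 n2] := ins q' h1 h2.
    have [le|lt] := lerP (I k.+1 q') (e * (S / 2 ^+ k.+1) ^+ 2); first by right.
    by left; exists q'.
  have [//|i1] := pick q (or_introl erefl) (or_introl erefl).
  have [//|i2] := pick (q.1, q.2 + h) (or_introl erefl) (or_intror erefl).
  have [//|i3] := pick (q.1 + l, q.2) (or_intror erefl) (or_introl erefl).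
  have [//|i4] := pick (q.1 + l, q.2 + h) (or_intror erefl) (or_intror erefl).
  exfalso; move: Ibig; rewrite eE ltNge => /negP; apply; apply: (le_trans hsum).
  set X := e * _ in i1 i2 i3 i4 *; have -> : 4 * X = X + X + (X + X) by ring.
  by do ?[apply: lerD].
have /choice[nx nxP] : forall kq : nat * (R * R), exists q', bad kq.1 kq.2 ->
    next kq.1 kq.2 q' /\ bad kq.1.+1 q'.
  move=> [k q]; have [hb|nb] := pselect (bad k q); last by exists q.
  by have [q' hq'] := step _ _ hb; exists q'.
pose fix qs k := if k is k'.+1 then nx (k', qs k') else (a, c).
have qbad k : bad k (qs k).
  elim: k => [|k IH]; last by have [] := nxP (k, qs k) IH.
  split; last by rewrite expr0 divr1.
  by rewrite /inside /= !expr0 !divr1 /L /H; split; split; lra.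
have qnext k : next k (qs k) (qs k.+1) by have [] := nxP (k, qs k) (qbad k).
have [xs hxs] := @nested_point (fun k => (qs k).1) L L0 (fun k => (qnext k).1).
have [ys hys] := @nested_point (fun k => (qs k).2) H H0 (fun k => (qnext k).2).
have xsab : a <= xs <= b.
  by move: (hxs 0%N); rewrite /= expr0 divr1 /L => /andP[? ?]; apply/andP; split; lra.
have yscd : c <= ys <= d.
  by move: (hys 0%N); rewrite /= expr0 divr1 /H => /andP[? ?]; apply/andP; split; lra.
have [D fD] := holo_approx (fh _ _ xsab yscd).
have e40 : 0 < e / 4 by rewrite divr_gt0.
have [r r0 fr] := fD _ e40.
have [k hk] := half_pow_lt S r0.
have [[[i1 i2] [i3 i4]] Ibig] := qbad k.
have /andP[x1 x2] := hxs k; have /andP[y1 y2] := hys k.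
move: Ibig; rewrite ltNge => /negP; apply.
have Lk0 : 0 <= L / 2 ^+ k by rewrite mulr_ge0 // invr_ge0 exprn_ge0.
have Hk0 : 0 <= H / 2 ^+ k by rewrite mulr_ge0 // invr_ge0 exprn_ge0.
rewrite /I; set a' := (qs k).1 in i1 i2 x1 x2 *; set c' := (qs k).2 in i3 i4 y1 y2 *.
set zs := xs +i* ys in fr fD *.
have ha : a' <= a' + L / 2 ^+ k by rewrite lerDl.
have hc : c' <= c' + H / 2 ^+ k by rewrite lerDl.
set b' := a' + L / 2 ^+ k in i2 x2 ha *; set d' := c' + H / 2 ^+ k in i4 y2 hc *.
have sc : rect_side_cont f a' b' c' d'.
  apply: rect_cont_side => // x y /andP[xa xb] /andP[yc yd].
  apply: holo_cont; apply: fh; first by rewrite (le_trans i1 xa) (le_trans xb i2).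
  by rewrite (le_trans i3 yc) (le_trans yd i4).
have sa : rect_side_cont (fun z => (f zs - D * zs) + D * z) a' b' c' d'.
  by apply: rect_cont_side => // x y _ _; exact: cont_affine.
have sr : rect_side_cont (fun z => f z - (f zs - D * zs + D * z)) a' b' c' d'.
  case: sc sa => s1 s2 s3 s4 [t1 t2 t3 t4].
  by split => x xab; apply: continuousB;
    [exact: s1|exact: t1|exact: s2|exact: t2|exact: s3|exact: t3|exact: s4|exact: t4].
have small x y : a' <= x <= b' -> c' <= y <= d' ->
    [|| x == a', x == b', y == c' | y == d'] ->
    normc (f (x +i* y) - (f zs - D * zs + D * (x +i* y))) <= e / 4 * (S / 2 ^+ k).
  move=> /andP[xa xb] /andP[yc yd] _.
  have nz : normc (x +i* y - zs) <= S / 2 ^+ k.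
    apply: (le_trans (normc_le _)); rewrite /S mulrDl.
    apply: lerD; rewrite ler_norml.
      by move: x1 x2 xa xb; rewrite /zs /b'; clear; move=> *; apply/andP; split => /=; lra.
    by move: y1 y2 yc yd; rewrite /zs /d'; clear; move=> *; apply/andP; split => /=; lra.
  have -> : f (x +i* y) - (f zs - D * zs + D * (x +i* y)) =
     f (x +i* y) - f zs - D * (x +i* y - zs) by ring.
  by apply: (le_trans (fr _ (le_lt_trans nz hk))); rewrite ler_pM2l.
have -> : rectint f a' b' c' d' =
    rectint (fun z => f z - (f zs - D * zs + D * z)) a' b' c' d'.
  by rewrite rectintB // rectint_affine // subr0.
apply: (le_trans (rectint_le ha hc sr small)).
have -> : b' - a' + (d' - c') = S / 2 ^+ k.
  by rewrite /b' /d' /S; clear; ring.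
by rewrite le_eqVlt; apply/orP; left; apply/eqP; clear; field; rewrite expf_neq0.
Qed.

End Goursat.

(** * Removable singularities *)

Section Holomorphy.
Variable R : realType.
Local Notation C := R[i].
Local Notation normc := (@ComplexField.Normc.normc R).

Lemma holoM (f g : C -> C) z : holo f z -> holo g z -> holo (fun z => f z * g z) z.
Proof. exact: derivableM. Qed.
Lemma holoV (f : C -> C) z : f z != 0 -> holo f z -> holo (fun z => (f z)^-1) z.
Proof. exact: derivableV. Qed.
Lemma holoD (f g : C -> C) z : holo f z -> holo g z -> holo (fun z => f z + g z) z.
Proof. exact: derivableD. Qed.
Lemma holoB (f g : C -> C) z : holo f z -> holo g z -> holo (fun z => f z - g z) z.
Proof. exact: derivableB. Qed.
Lemma holo_cst (k : C) z : holo (fun=> k) z.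
Proof. exact: derivable_cst. Qed.
Lemma holo_id z : holo (fun z : C => z) z.
Proof. exact: derivable_id. Qed.

Lemma holoX (f : C -> C) k z : holo f z -> holo (fun z => f z ^+ k) z.
Proof.
move=> fh; elim: k => [|k IH].
  rewrite (_ : (fun z => f z ^+ 0) = fun=> 1); first exact: holo_cst.
  by apply/funext => w; rewrite expr0.
rewrite (_ : (fun z => f z ^+ k.+1) = fun z => f z * f z ^+ k); first exact: holoM.
by apply/funext => w; exact: exprS.
Qed.

Lemma holo_sum (I : Type) (s : seq I) (P : pred I) (f : I -> C -> C) z :
  (forall i, P i -> holo (f i) z) -> holo (fun z => \sum_(i <- s | P i) f i z) z.
Proof.
move=> fh; elim: s => [|i s IH].
  rewrite (_ : (fun z => _) = fun=> 0); first exact: holo_cst.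
  by apply/funext => w; rewrite big_nil.
have [Pi|nPi] := boolP (P i); last first.
  rewrite (_ : (fun z => _) = fun z => \sum_(i <- s | P i) f i z) //.
  by apply/funext => w; rewrite big_cons (negbTE nPi).
rewrite (_ : (fun z => _) = fun z => f i z + \sum_(i <- s | P i) f i z).
  exact: (holoD (fh _ Pi) IH).
by apply/funext => w; rewrite big_cons Pi.
Qed.

Lemma holo_prod (I : Type) (s : seq I) (P : pred I) (f : I -> C -> C) z :
  (forall i, P i -> holo (f i) z) -> holo (fun z => \prod_(i <- s | P i) f i z) z.
Proof.
move=> fh; elim: s => [|i s IH].
  rewrite (_ : (fun z => _) = fun=> 1); first exact: holo_cst.
  by apply/funext => w; rewrite big_nil.
have [Pi|nPi] := boolP (P i); last first.
  rewrite (_ : (fun z => _) = fun z => \prod_(i <- s | P i) f i z) //.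
  by apply/funext => w; rewrite big_cons (negbTE nPi).
rewrite (_ : (fun z => _) = fun z => f i z * \prod_(i <- s | P i) f i z).
  exact: (holoM (fh _ Pi) IH).
by apply/funext => w; rewrite big_cons Pi.
Qed.

Lemma holo_near0 (f : C -> C) z r : 0 < r ->
  (forall w, normc (w - z) < r -> f w = 0) -> holo f z.
Proof.
move=> r0 f0; apply/cvg_ex; exists 0; apply: cvg_near_cst.
have r0' : 0 < r%:C by rewrite ltcR.
apply/nbhs_ballP; exists r%:C => // h hr _.
have {}hr : normc h < r.
  by move: hr; change (`|0 - h| < r%:C -> normc h < r); rewrite sub0r normrN normr_normc ltcR.
rewrite /=.
rewrite !f0 ?subrr ?scaler0 //; first by rewrite ComplexField.Normc.normc0.
by rewrite /GRing.scale /= mulr1 addrK.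
Qed.

(** The difference quotient has a removable singularity, as it is bounded. *)
Lemma holo_bounded_quot (f : C -> C) w : holo f w ->
  exists M r : R, 0 < r /\ forall z, z != w -> normc (z - w) < r ->
    normc ((f z - f w) / (z - w)) <= M.
Proof.
move=> /holo_approx[D hD]; have [r r0 hr] := hD 1 ltr01.
exists (normc D + 1), r; split=> // z zw zr.
have zw0 : z - w != 0 by rewrite subr_eq0.
have n0 : 0 < normc (z - w) by rewrite normc_gt0.
rewrite normcMM normcVV ler_pdivrMr //.
have -> : f z - f w = D * (z - w) + (f z - f w - D * (z - w)) by ring.
apply: (le_trans (normcD _ _)); rewrite mulrDl lerD //; first by rewrite normcMM.
exact: hr.
Qed.

Lemma seg_bounded (g : R -> C) a b : a <= b -> seg_cont a b g ->
  exists2 M : R, 0 <= M & forall x, a <= x <= b -> normc (g x) <= M.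
Proof.
move=> ab gc.
have ce : {within `[a, b], continuous (fun x => `|Re (g x)| + `|Im (g x)|)}.
  apply: continuous_in_subspaceT => x; rewrite inE /= in_itv /= => xab.
  have cr := @continuous_comp R C^o R^o g (fun z => Re (z : C)) x (gc _ xab) (@cont_Re _ _).
  have ci := @continuous_comp R C^o R^o g (fun z => Im (z : C)) x (gc _ xab) (@cont_Im _ _).
  by apply: cvgD; apply: cvg_norm; [exact: cr|exact: ci].
have [c _ hc] := EVT_max ab ce.
exists (`|Re (g c)| + `|Im (g c)|); first exact: addr_ge0.
move=> x xab; apply: (le_trans (normc_le _)); apply: hc.
by rewrite in_itv.
Qed.

(** The singularity is enclosed in a square of size [e], whose integral is at
    most a multiple of [e]. *)
Lemma goursat_punctured f a b c d wx wy M r : a < wx < b -> c < wy < d ->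
  (forall z, a <= Re z <= b -> c <= Im z <= d -> z != wx +i* wy -> holo f z) ->
  0 < r ->
  (forall z, z != wx +i* wy -> normc (z - (wx +i* wy)) < r -> normc (f z) <= M) ->
  rectint f a b c d = 0.
Proof.
move=> /andP[aw wb] /andP[cw wd] fh r0 fM.
have hol x y : a <= x <= b -> c <= y <= d -> (x != wx) || (y != wy) -> holo f (x +i* y).
  by move=> xab ycd ne; apply: fh => //; rewrite eq_complex negb_and.
have cont x y : a <= x <= b -> c <= y <= d -> (x != wx) || (y != wy) ->
    {for (x +i* y : C^o), continuous (f : C^o -> C^o)}.
  by move=> xab ycd ne; apply: holo_cont; exact: hol.
pose m := Num.min (Num.min (wx - a) (b - wx)) (Num.min (Num.min (wy - c) (d - wy)) (r / 4)).
have m0 : 0 < m by rewrite /m !lt_min !subr_gt0 aw wb cw wd divr_gt0.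
suff bnd e : 0 < e <= 1 -> normc (rectint f a b c d) <= e * (16 * M * m).
  apply/eqP; rewrite -normc_eq0; apply/eqP/le_anti; rewrite normc_ge0 andbT.
  apply/ler_addgt0Pr => e e0; rewrite add0r.
  set K := 16 * M * m in bnd *.
  have K0 : 0 < `|K| + 1 by rewrite ltr_wpDl.
  have t0 : 0 < Num.min 1 (e / (`|K| + 1)) by rewrite lt_min ltr01 divr_gt0.
  apply: (le_trans (bnd (Num.min 1 (e / (`|K| + 1))) _)).
    by rewrite t0 ge_min lexx.
  apply: (@le_trans _ _ (Num.min 1 (e / (`|K| + 1)) * `|K|)).
    by rewrite ler_pM2l // ler_norm.
  apply: (@le_trans _ _ (e / (`|K| + 1) * `|K|)).
    by rewrite ler_wpM2r // ge_min lexx orbT.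
  by rewrite mulrAC ler_pdivrMr // ler_pM2l // lerDl.
move=> /andP[e0 e1]; set h := e * m.
have h0 : 0 < h by rewrite mulr_gt0.
have hm : h <= m by rewrite /h ler_piMl // ltW.
have : h <= m by []. rewrite {2}/m !le_min => /andP[/andP[h1 h2] /andP[/andP[h3 h4] h5]].
have a1 : a <= wx - h by lra.
have b1 : wx + h <= b by lra.
have c1 : c <= wy - h by lra.
have d1 : wy + h <= d by lra.
have lx : wx - h < wx by rewrite gtrBl.
have gx : wx < wx + h by rewrite ltrDl.
have ly : wy - h < wy by rewrite gtrBl.
have gy : wy < wy + h by rewrite ltrDl.
have ab : a <= b by apply: ltW; exact: lt_trans wb.
have cd : c <= d by apply: ltW; exact: lt_trans wd.
have hz y : c <= y <= d -> y != wy -> seg_cont a b (fun x => f (x +i* y)).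
  by move=> yc yw; apply: seg_cont_horiz => x xab; apply: cont; rewrite ?yw ?orbT.
have vt x : a <= x <= b -> x != wx -> seg_cont c d (fun y => f (x +i* y)).
  by move=> xc xw; apply: seg_cont_vert => y yab; apply: cont; rewrite ?xw.
have c' : c <= c <= d by rewrite lexx cd.
have d' : c <= d <= d by rewrite lexx cd.
have cne : c != wy by rewrite lt_eqF.
have dne : d != wy by rewrite gt_eqF.
have z1 : rectint f a (wx - h) c d = 0.
  apply: goursat => // x y /andP[ax xh] ycd; apply: hol => //.
    by rewrite ax (le_trans xh) // ltW // (lt_trans lx).
  by rewrite lt_eqF // (le_lt_trans xh).
have z2 : rectint f (wx + h) b c d = 0.
  apply: goursat => // x y /andP[ax xh] ycd; apply: hol => //.
    by rewrite xh andbT (le_trans _ ax) // ltW // (lt_trans aw).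
  by rewrite gt_eqF // (lt_le_trans gx).
have sub x : wx - h <= x <= wx + h -> a <= x <= b.
  by move=> /andP[l g]; rewrite (le_trans a1 l) (le_trans g b1).
have suby y : wy - h <= y <= wy + h -> c <= y <= d.
  by move=> /andP[l g]; rewrite (le_trans c1 l) (le_trans g d1).
have z3 : rectint f (wx - h) (wx + h) c (wy - h) = 0.
  apply: goursat => // [|x y /sub xab /andP[cy yh]]; first by rewrite ltW // (lt_trans lx).
  apply: hol => //; first by rewrite cy (le_trans yh) // ltW // (lt_trans ly).
  by rewrite (lt_eqF (le_lt_trans yh ly)) orbT.
have z4 : rectint f (wx - h) (wx + h) (wy + h) d = 0.
  apply: goursat => // [|x y /sub xab /andP[cy yh]]; first by rewrite ltW // (lt_trans lx).
  apply: hol => //; first by rewrite yh andbT (le_trans _ cy) // ltW // (lt_trans cw).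
  by rewrite (gt_eqF (lt_le_trans gy cy)) orbT.
have lh : wx - h <= wx + h by rewrite ltW // (lt_trans lx).
have lhy : wy - h <= wy + h by rewrite ltW // (lt_trans ly).
have s1 : a <= wx - h <= b by rewrite a1 (le_trans lh b1).
have s2 : a <= wx + h <= b by rewrite b1 (le_trans a1 lh).
have s3 : c <= wy - h <= d by rewrite c1 (le_trans lhy d1).
have s4 : c <= wy + h <= d by rewrite d1 (le_trans c1 lhy).
have n1 : wx - h != wx by rewrite lt_eqF.
have n2 : wx + h != wx by rewrite gt_eqF.
have n3 : wy - h != wy by rewrite lt_eqF.
have n4 : wy + h != wy by rewrite gt_eqF.
rewrite (rectint_splitv s1 (hz _ c' cne) (hz _ d' dne)) z1 add0r.
rewrite (@rectint_splitv _ _ _ (wx + h)); first last.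
- by apply: seg_cont_sub (hz _ d' dne).
- by apply: seg_cont_sub (hz _ c' cne).
- by rewrite lh b1.
rewrite z2 addr0 (rectint_splith s3 (vt _ s1 n1) (vt _ s2 n2)) z3 add0r.
rewrite (@rectint_splith _ _ _ _ _ (wy + h)); first last.
- by apply: seg_cont_sub (vt _ s2 n2).
- by apply: seg_cont_sub (vt _ s1 n1).
- by rewrite lhy d1.
rewrite z4 addr0.
have -> : e * (16 * M * m) = 4 * M * ((wx + h - (wx - h)) + (wy + h - (wy - h))).
  by rewrite /h; clear; ring.
apply: rectint_le => //.
  split; [exact: seg_cont_sub (hz _ s3 n3)|exact: seg_cont_sub (hz _ s4 n4)
         |exact: seg_cont_sub (vt _ s2 n2)|exact: seg_cont_sub (vt _ s1 n1)].
move=> x y /andP[xl xg] /andP[yl yg] bd; apply: fM.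
  rewrite eq_complex negb_and /=; case/or4P: bd => /eqP ->; rewrite ?n1 ?n2 ?n3 ?n4 ?orbT //.
apply: (le_lt_trans (normc_le _)) => /=.
have ix : `|x - wx| <= h by rewrite ler_norml; apply/andP; split; lra.
have iy : `|y - wy| <= h by rewrite ler_norml; apply/andP; split; lra.
apply: (le_lt_trans (lerD ix iy)); move: r0 h5 h0; clear; lra.
Qed.

End Holomorphy.

(** * An identity theorem *)

Section Identity.
Variable R : realType.
Local Notation C := R[i].
Local Notation leb := (@lebesgue_measure R).
Local Notation normc := (@ComplexField.Normc.normc R).

Lemma cRe_inv (z : C) : Re z^-1 = Re z / (Re z ^+ 2 + Im z ^+ 2).
Proof. by case: z. Qed.
Lemma cIm_inv (z : C) : Im z^-1 = - (Im z / (Re z ^+ 2 + Im z ^+ 2)).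
Proof. by case: z. Qed.
Lemma cRe_Ni (z : C) : Re (- 'i%C * z) = Im z.
Proof. by rewrite mulNr cReN cReM /= mul0r mul1r sub0r opprK. Qed.
Lemma cRe_i (z : C) : Re ('i%C * z) = - Im z.
Proof. by rewrite cReM /= mul0r mul1r sub0r. Qed.

Lemma seg_Re_ge (g : R -> C) a b m : a <= b -> seg_cont a b g ->
  (forall x, a <= x <= b -> m <= Re (g x)) -> m * (b - a) <= Re (Cint `[a, b] g).
Proof.
move=> ab gc gm.
have -> : m * (b - a) = \int[leb]_(x in `[a, b]) (cst m x).
  have := Cint_cst m%:C ab; move=> /(congr1 (@complex.Re R)) /=.
  by rewrite mul0r subr0.
apply: le_Rintegral => //.
- apply: continuous_compact_integrable; first exact: segment_compact.
  by apply: continuous_subspaceT; exact: cst_continuous.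
- by have [] := seg_cintegrable gc.
Qed.

Lemma geometric_le0 (A B q : R) : 0 <= q < 1 -> (forall N, A <= B * q ^+ N) -> A <= 0.
Proof.
move=> /andP[q0 q1] H; apply/ler_addgt0Pr => e e0; rewrite add0r.
have cv : B * q ^+ N @[N --> \oo] --> (B * 0 : R).
  by apply: cvgM; [exact: cvg_cst|apply: cvg_expr; rewrite ger0_norm].
move/cvgrPdist_lt/(_ _ e0): cv => [N _ hN].
apply: (le_trans (H N)); have := hN N (leqnn N).
by rewrite mulr0 sub0r normrN => /ltW; apply: le_trans; exact: ler_norm.
Qed.

(** The winding number of the boundary of a rectangle about an interior point
    does not vanish: each side contributes a nonnegative imaginary part. *)
Lemma rectint_inv_neq0 (x y l1 l2 k1 k2 : R) : 0 < l1 -> 0 < l2 -> 0 < k1 -> 0 < k2 ->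
  rect_side_cont (fun z => (z - (x +i* y))^-1) (x - l1) (x + l2) (y - k1) (y + k2) ->
  rectint (fun z => (z - (x +i* y))^-1) (x - l1) (x + l2) (y - k1) (y + k2) != 0.
Proof.
move=> l10 l20 k10 k20 sc; have [s1 s2 s3 s4] := sc.
set K := rectint _ _ _ _ _.
suff h : 0 < Im K by apply/negP => /eqP e; rewrite e ltxx in h.
have ab : x - l1 <= x + l2 by lra.
have cd : y - k1 <= y + k2 by lra.
have zcont k (g : R -> C) a b : seg_cont a b g -> seg_cont a b (fun t => k * g t).
  by move=> gc t tab; apply: continuousM; [exact: cst_continuous|exact: gc].
rewrite -cRe_Ni /K /rectint.
set I1 := Cint _ _; set I2 := Cint _ _; set I3 := Cint _ _; set I4 := Cint _ _.
have -> : - 'i%C * (I1 - I2 + 'i%C * (I3 - I4)) =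
   - 'i%C * I1 + 'i%C * I2 + I3 + -1 * I4 :> C.
  have ii : 'i%C * 'i%C = -1 :> C by rewrite -expr2 sqr_i.
  set J := 'i%C in ii *; transitivity (- J * I1 + J * I2 - (J * J) * (I3 - I4)); first by ring.
  by rewrite ii; ring.
rewrite /I1 /I2 /I4 -!CintZ //; do ?exact: seg_cintegrable.
set m := k1 / ((l1 + l2) ^+ 2 + k1 ^+ 2).
have m0 : 0 < m by rewrite divr_gt0 // addr_gt0 ?exprn_gt0 // addr_gt0.
have g1 : m * (x + l2 - (x - l1)) <= Re (Cint `[x - l1, x + l2]
   (fun s => - 'i%C * (s +i* (y - k1) - (x +i* y))^-1)).
  apply: (seg_Re_ge ab (zcont _ _ _ _ s1)).
  move=> s /andP[s1' s2']; rewrite cRe_Ni cIm_inv cReB cImB /=.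
  have -> : y - k1 - y = - k1 by ring.
  have p1 : 0 < (l1 + l2) ^+ 2 + k1 ^+ 2 by rewrite addr_gt0 ?exprn_gt0 // addr_gt0.
  have p2 : 0 < (s - x) ^+ 2 + k1 ^+ 2 by rewrite ltr_wpDl ?sqr_ge0 ?exprn_gt0.
  rewrite mulNr opprK sqrrN /m ler_pM2l // lef_pV2 ?posrE //.
  rewrite lerD2r -subr_ge0 subr_sqr.
  by apply: mulr_ge0; move: s1' s2' l10 l20; clear; lra.
have g2 : 0 * (x + l2 - (x - l1)) <= Re (Cint `[x - l1, x + l2]
   (fun s => 'i%C * (s +i* (y + k2) - (x +i* y))^-1)).
  apply: (seg_Re_ge ab (zcont _ _ _ _ s2)).
  move=> s _; rewrite cRe_i cIm_inv cReB cImB /= opprK.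
  have -> : y + k2 - y = k2 by ring.
  by rewrite divr_ge0 ?ltW // ltr_wpDl ?sqr_ge0 ?exprn_gt0.
have g3 : 0 * (y + k2 - (y - k1)) <= Re I3.
  apply: (seg_Re_ge cd s3) => t _; rewrite cRe_inv cReB cImB /=.
  have -> : x + l2 - x = l2 by ring.
  by rewrite divr_ge0 ?ltW // ltr_wpDr ?sqr_ge0 ?exprn_gt0.
have g4 : 0 * (y + k2 - (y - k1)) <= Re (Cint `[y - k1, y + k2]
   (fun t => -1 * ((x - l1) +i* t - (x +i* y))^-1)).
  apply: (seg_Re_ge cd (zcont _ _ _ _ s4)).
  move=> t _; rewrite mulN1r cReN cRe_inv cReB cImB /=.
  have -> : x - l1 - x = - l1 by ring.
  by rewrite mulNr opprK divr_ge0 ?ltW // ltr_wpDr ?sqr_ge0 // sqrrN exprn_gt0.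
rewrite !mul0r in g2 g3 g4; rewrite !cReD.
apply: (@lt_le_trans _ _ (m * (x + l2 - (x - l1)))).
  by rewrite mulr_gt0 // subr_gt0; lra.
have fin (X A1 A2 A3 A4 : R) : X <= A1 -> 0 <= A2 -> 0 <= A3 -> 0 <= A4 ->
  X <= A1 + A2 + A3 + A4 by lra.
exact: fin.
Qed.

(** Let [w0] lie straight above [w] in the upper half-plane.  The products of
    [g] with powers of [(w - w0) / (z - w0)] are again entire and take the
    same value at [w], but on the boundary of a suitable rectangle with [w0] on
    its upper side they tend to zero: where [g] does not vanish, [z] is further
    from [w0] than [w] is. *)
Lemma identity_upper (g : C -> C) : (forall z, holo g z) ->
  (forall z, 0 < Im z -> g z = 0) -> forall w, g w = 0.
Proof.
move=> gh g0 [x y]; set w := x +i* y.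
(* [T] puts [w0] above the line, and the lower, left and right sides of the
   rectangle below are at distance [T + 1] at least from [w0]. *)
set T := 1 + `|y|; set w0 := x +i* (y + T).
have T1 : 1 <= T by rewrite /T lerDl.
have T0 : 0 < T by rewrite (lt_le_trans ltr01).
have yT0 : 0 < y + T by rewrite /T; have := ler_norm (- y); rewrite normrN; lra.
pose psi N z := g z * ((w - w0) / (z - w0)) ^+ N.
have psih N z : holo (psi N) z.
  have [->|zw0] := eqVneq z w0.
    apply: (@holo_near0 _ _ _ (y + T)) => // v hv; rewrite /psi g0 ?mul0r //.
    have := le_lt_trans (Im_le_normc _) hv; rewrite cImB /= ltr_norml => /andP[]; lra.
  apply: holoM => //; apply: holoX; apply: holoM; first exact: holo_cst.
  apply: holoV; first by rewrite subr_eq0.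
  by apply: holoB; [exact: holo_id|exact: holo_cst].
have ww0 : w - w0 != 0.
  by rewrite subr_eq0 eq_complex /= negb_and orbC; apply/orP; left; apply/negP => /eqP; lra.
have psiw N : psi N w = g w by rewrite /psi divff // expr1n mulr1.
set a := x - (T + 1); set b := x + (T + 1); set c := y - 1; set d := y + T.
have ab : a <= b by rewrite /a /b; lra.
have cd : c <= d by rewrite /c /d; lra.
have nw u v : [|| u == a, u == b, v == c | v == d] -> u +i* v - w != 0 /\ 1 <= normc (u +i* v - w).
  move=> h; suff h1 : 1 <= normc (u +i* v - w) by split => //; rewrite -normc_gt0 (lt_le_trans ltr01).
  case/or4P: h => /eqP ->.
  - apply: le_trans (Re_le_normc _); rewrite /= /a ler_normr; apply/orP; right; lra.
  - apply: le_trans (Re_le_normc _); rewrite /= /b ler_normr; apply/orP; left; lra.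
  - apply: le_trans (Im_le_normc _); rewrite /= /c ler_normr; apply/orP; right; lra.
  - apply: le_trans (Im_le_normc _); rewrite /= /d ler_normr; apply/orP; left; lra.
have invh z : z - w != 0 -> holo (fun z => (z - w)^-1) z.
  by move=> zw; apply: holoV => //; apply: holoB; [exact: holo_id|exact: holo_cst].
have side (f : C -> C) : (forall u v, [|| u == a, u == b, v == c | v == d] -> holo f (u +i* v)) ->
    rect_side_cont f a b c d.
  move=> fh; split; [apply: seg_cont_horiz|apply: seg_cont_horiz|apply: seg_cont_vert|apply: seg_cont_vert];
  by move=> t _; apply: holo_cont; apply: fh; rewrite eqxx ?orbT.
have sinv : rect_side_cont (fun z => (z - w)^-1) a b c d.
  by apply: side => u v /nw[nz _]; exact: invh.
have spsi N : rect_side_cont (fun z => psi N z * (z - w)^-1) a b c d.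
  by apply: side => u v /nw[nz _]; apply: holoM => //; exact: invh.
have sgw : rect_side_cont (fun z => g w * (z - w)^-1) a b c d.
  by apply: side => u v /nw[nz _]; apply: holoM; [exact: holo_cst|exact: invh].
set K := rectint (fun z => (z - w)^-1) a b c d.
have T10 : 0 < T + 1 by rewrite addr_gt0.
have K0 : K != 0 := rectint_inv_neq0 T10 T10 ltr01 T0 sinv.
have key N : g w * K = rectint (fun z => psi N z * (z - w)^-1) a b c d.
  apply/esym/eqP; rewrite -subr_eq0 /K -(rectintZ (g w) sinv).
  rewrite -(rectintB (spsi N) sgw); apply/eqP.
  have [M [r [r0 hM]]] := holo_bounded_quot (psih N w).
  apply: (@goursat_punctured _ _ _ _ _ _ x y M r) => //.
  - by rewrite /a /b; apply/andP; split; lra.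
  - by rewrite /c /d; apply/andP; split; lra.
  - move=> z _ _; rewrite -/w -subr_eq0 => zw.
    have h1 := holoM (psih N z) (invh z zw).
    have h2 := holoM (@holo_cst R (g w) z) (invh z zw).
    exact: (holoB h1 h2).
  - by move=> z zw zr; rewrite -mulrBl -(psiw N); exact: hM.
have gside u v : {for (u +i* v : C^o), continuous (g : C^o -> C^o)} by exact: holo_cont.
have [M1 M10 hM1] := seg_bounded ab (seg_cont_horiz (fun u _ => gside u c)).
have [M2 M20 hM2] := seg_bounded cd (seg_cont_vert (fun v _ => gside a v)).
have [M3 M30 hM3] := seg_bounded cd (seg_cont_vert (fun v _ => gside b v)).
set q := T / (T + 1).
have q01 : 0 <= q < 1.
  by rewrite /q divr_ge0 ?ler_wpDr ?(ltW T0) //= ltr_pdivrMr ?mul1r ?ltrDl // ltr_wpDr.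
set M := M1 + M2 + M3.
have M0 : 0 <= M by rewrite !addr_ge0.
have far z : T + 1 <= normc (z - w0) -> normc ((w - w0) / (z - w0)) <= q.
  move=> hz; rewrite normcMM normcVV.
  have -> : normc (w - w0) = T.
    rewrite /w /w0 /= subrr expr0n /= add0r sqrtr_sqr.
    by rewrite opprD addrA subrr add0r normrN gtr0_norm.
  by rewrite /q ler_pM2l // lef_pV2 ?posrE //; exact: lt_le_trans hz.
have bnd N : normc (g w * K) <= 4 * (b - a + (d - c)) * M * q ^+ N.
  rewrite (key N); have -> : 4 * (b - a + (d - c)) * M * q ^+ N =
     4 * (M * q ^+ N) * (b - a + (d - c)) by ring.
  apply: (rectint_le ab cd (spsi N)) => u v uab vcd uv; have [_ n1] := nw _ _ uv.
  rewrite normcMM normcVV; apply: (@le_trans _ _ (normc (psi N (u +i* v)))).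
    by rewrite ler_piMr ?normc_ge0 // invf_le1 // (lt_le_trans ltr01).
  have [v0|v0] := ltP 0 v.
    by rewrite /psi g0 // mul0r ComplexField.Normc.normc0 mulr_ge0 ?exprn_ge0 //; case/andP: q01.
  rewrite /psi normcMM normcX.
  have gM : normc (g (u +i* v)) <= M.
    case/or4P: uv => /eqP e; rewrite e.
    - by apply: (le_trans (hM2 _ vcd)); rewrite /M; move: M10 M30; clear; lra.
    - by apply: (le_trans (hM3 _ vcd)); rewrite /M; move: M10 M20; clear; lra.
    - by apply: (le_trans (hM1 _ uab)); rewrite /M; move: M30 M20; clear; lra.
    - by move: v0; rewrite e /d leNgt yT0.
  apply: ler_pM => //; rewrite ?normc_ge0 ?exprn_ge0 ?normc_ge0 //.
  apply: lerXn2r; rewrite ?nnegrE ?normc_ge0 //; first by case/andP: q01.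
  apply: far; case/or4P: uv => /eqP e; rewrite e.
  - by apply: le_trans (Re_le_normc _); rewrite /= /a ler_normr; apply/orP; right; lra.
  - by apply: le_trans (Re_le_normc _); rewrite /= /b ler_normr; apply/orP; left; lra.
  - by apply: le_trans (Im_le_normc _); rewrite /= /c ler_normr; apply/orP; right; lra.
  - by move: v0; rewrite e /d leNgt yT0.
have := geometric_le0 q01 bnd; rewrite normcMM => h.
have : normc (g w) * normc K == 0 by rewrite eq_le h mulr_ge0 ?normc_ge0.
by rewrite mulf_eq0 !normc_eq0 (negbTE K0) orbF => /eqP.
Qed.

End Identity.

(** * Limits of integrals under a mean square bound *)

Section FatouLemmas.
Context d (T : measurableType d) (R : realType) (mu : {measure set T -> \bar R}).

Lemma fatou_ae (f : nat -> T -> R) (g : T -> R) (c : R) :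
  (forall n, measurable_fun setT (f n)) -> measurable_fun setT g ->
  (forall n x, 0 <= f n x) ->
  {ae mu, forall x, f n x @[n --> \oo] --> g x} ->
  (forall n, (\int[mu]_x (f n x)%:E <= c%:E)%E) ->
  (\int[mu]_x (g x)%:E <= c%:E)%E.
Proof.
move=> mf mg f0 fg fc; pose F n x := (f n x)%:E.
have mF n : measurable_fun setT (F n) by exact/measurable_EFinP.
have E : (\int[mu]_x (g x)%:E = \int[mu]_x limn_einf (F^~ x))%E.
  apply: ae_eq_integral => //.
  - exact/measurable_EFinP.
  - rewrite /limn_einf; apply: measurableT_comp => //.
    by apply: measurable_fun_limn_esup => n; apply: measurableT_comp => //; exact: mF.
  - apply: filterS fg => x fgx _ /=.
    have := @cvg_limn_einf_sup _ (F^~ x) (g x)%:E; rewrite /F => /(_ _)[] //.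
    by apply: cvg_EFin => //; exact: nearW.
rewrite E; apply: (le_trans (fatou mu measurableT mF _)).
  by move=> n x _; rewrite lee_fin.
rewrite limn_einf_lim; apply: lime_le; first exact: is_cvg_einfs.
apply: nearW => n; apply: le_trans (fc n).
by apply: ereal_inf_lbound; exists n => /=.
Qed.

(** Domination by [e * q + e^-1 * B] with [q] of bounded integral and [B]
    integrable is what boundedness in [L^2] gives for products with a fixed
    function of [L^2]; letting [e] tend to zero in Fatou's lemma for the
    positive parts of [e^-1 * B + u n] and [e^-1 * B - u n] replaces a
    dominating function. *)
Section WeakLimit.
Variables (u q : nat -> T -> R) (B v : T -> R) (M : R).
Hypothesis ui : forall n, mu.-integrable setT (EFin \o u n).
Hypothesis mq : forall n, measurable_fun setT (q n).
Hypothesis q0 : forall n x, 0 <= q n x.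
Hypothesis qM : forall n, (\int[mu]_x (q n x)%:E <= M%:E)%E.
Hypothesis Bi : mu.-integrable setT (EFin \o B).
Hypothesis uqB : forall e, 0 < e -> forall n x, `|u n x| <= e * q n x + e^-1 * B x.
Hypothesis mv : measurable_fun setT v.
Hypothesis uv : {ae mu, forall x, u n x @[n --> \oo] --> v x}.
Hypothesis u0 : (\int[mu]_x u n x) @[n --> \oo] --> (0 : R).

Let qi n : mu.-integrable setT (EFin \o q n).
Proof.
apply/integrableP; split; first exact/measurable_EFinP.
apply: (@le_lt_trans _ _ M%:E); last by rewrite ltry.
apply: le_trans (qM n); rewrite le_eqVlt; apply/orP; left; apply/eqP.
by apply: eq_integral => x _ /=; rewrite ger0_norm.
Qed.

Let qMr n : \int[mu]_x q n x <= M.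
Proof.
have fn := integrable_fin_num measurableT (qi n).
by rewrite -lee_fin /Rintegral fineK //; exact: qM.
Qed.

Let mu_ n : measurable_fun setT (u n).
Proof. by apply/measurable_EFinP; exact: (measurable_int _ (ui n)). Qed.

Let mB : measurable_fun setT B.
Proof. by apply/measurable_EFinP; exact: (measurable_int _ Bi). Qed.

Lemma weak_limit_integrable : mu.-integrable setT (EFin \o v).
Proof.
apply/integrableP; split; first exact/measurable_EFinP.
apply: (@le_lt_trans _ _ (M + \int[mu]_x B x)%:E); last by rewrite ltry.
apply: (@fatou_ae (fun n x => `|u n x|) (fun x => `|v x|)) => //.
- by move=> n; exact: measurableT_comp.
- exact: measurableT_comp.
- by apply: filterS uv => x; exact: cvg_norm.
move=> n; apply: (@le_trans _ _ (\int[mu]_x (q n x + B x)%:E)%E).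
  apply: ge0_le_integral => //.
  - by apply/measurable_EFinP; exact: measurableT_comp.
  - by apply/measurable_EFinP; exact: measurable_funD.
  - by move=> x _; have := uqB ltr01 n x; rewrite invr1 !mul1r lee_fin.
rewrite (_ : (\int[mu]_x (q n x + B x)%:E)%E = (\int[mu]_x (q n x + B x))%:E); last first.
  rewrite /Rintegral fineK //; exact: (integrable_fin_num measurableT (integrableD measurableT (qi n) Bi)).
by rewrite lee_fin RintegralD //; rewrite lerD2r.
Qed.

Let one_sided (s : R) : `|s| = 1 -> s * \int[mu]_x v x <= 0.
Proof.
move=> s1; have vi := weak_limit_integrable.
have siv : mu.-integrable setT (EFin \o (fun x => s * v x)).
  by rewrite /comp; under eq_fun do rewrite EFinM; exact: integrableZl.
have siu n : mu.-integrable setT (EFin \o (fun x => s * u n x)).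
  by rewrite /comp; under eq_fun do rewrite EFinM; apply: integrableZl => //; exact: ui.
have eiB e : mu.-integrable setT (EFin \o (fun x => e * B x)).
  by rewrite /comp; under eq_fun do rewrite EFinM; apply: integrableZl => //; exact: Bi.
have eiq e n : mu.-integrable setT (EFin \o (fun x => e * q n x)).
  by rewrite /comp; under eq_fun do rewrite EFinM; apply: integrableZl => //; exact: qi.
have M0 : 0 <= M by apply: le_trans (qMr 0%N); exact: Rintegral_ge0.
suff bnd e dl : 0 < e -> 0 < dl -> s * \int[mu]_x v x <= e * M + dl.
  apply/ler_addgt0Pr => e e0; rewrite add0r.
  have M1 : 0 < M + 1 by rewrite ltr_wpDl.
  apply: (le_trans (bnd (e / 2 / (M + 1)) (e / 2) _ _)); rewrite ?divr_gt0 //.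
  rewrite [X in _ <= X](splitr e) lerD2r mulrAC ler_pdivrMr //.
  by rewrite ler_pM2l ?divr_gt0 // lerDl.
move=> e0 dl0.
pose g x := e^-1 * B x + s * v x.
have gi : mu.-integrable setT (EFin \o g).
  exact: (integrableD measurableT (eiB e^-1) siv).
have [N _ hN] : \forall n \near \oo, s * \int[mu]_x u n x < dl.
  have : s * \int[mu]_x u n x @[n --> \oo] --> s * (0 : R).
    by apply: cvgM => //; exact: cvg_cst.
  move/cvgrPdist_lt/(_ _ dl0); apply: filterS => n.
  by rewrite mulr0 sub0r normrN; apply: le_lt_trans; exact: ler_norm.
set c := e^-1 * \int[mu]_x B x + e * M + dl.
have : (\int[mu]_x (Num.max 0 (g x))%:E <= c%:E)%E.
  pose f n x := Num.max 0 (e^-1 * B x + s * u (n + N)%N x).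
  have mf n : measurable_fun setT (f n).
    apply: measurable_maxr; first exact: measurable_cst.
    by apply: measurable_funD; apply: measurable_funM => //; exact: measurable_cst.
  have mgx : measurable_fun setT (fun x => Num.max 0 (g x)).
    apply: measurable_maxr; first exact: measurable_cst.
    by apply: measurable_funD; apply: measurable_funM => //; exact: measurable_cst.
  have f0 n x : 0 <= f n x by rewrite /f le_max lexx.
  apply: (fatou_ae mf mgx f0).
  - apply: filterS uv => x uvx.
    have cg : (e^-1 * B x + s * u (n + N)%N x) @[n --> \oo] --> g x.
      apply: cvgD; first exact: cvg_cst.
      by apply: cvgM; [exact: cvg_cst|rewrite (cvg_shiftn N (u^~ x))].
    rewrite maxr_absE; rewrite (_ : (fun n => _) = fun n =>
      (0 + (e^-1 * B x + s * u (n + N)%N x) + `|0 - (e^-1 * B x + s * u (n + N)%N x)|) / 2); last first.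
      by apply/funext => n; rewrite /f maxr_absE.
    apply: cvgM; last exact: cvg_cst.
    apply: cvgD; first by apply: cvgD; [exact: cvg_cst|exact: cg].
    by apply: cvg_norm; apply: cvgB; [exact: cvg_cst|exact: cg].
  move=> n; rewrite /f; set m := (n + N)%N.
  have hi : mu.-integrable setT (EFin \o (fun x => (e^-1 * B x + s * u m x) + e * q m x)).
    exact: (integrableD measurableT (integrableD measurableT (eiB e^-1) (siu m)) (eiq e m)).
  have su x : `|s * u m x| <= e * q m x + e^-1 * B x.
    by rewrite normrM s1 mul1r; exact: uqB.
  apply: (@le_trans _ _ (\int[mu]_x ((e^-1 * B x + s * u m x) + e * q m x)%:E)%E).
    apply: ge0_le_integral => //.
    - by move=> x _; rewrite lee_fin le_max lexx.
    - by apply/measurable_EFinP; exact: (mf n).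
    - exact: (measurable_int _ hi).
    move=> x _; rewrite lee_fin /f -/m ge_max.
    have eq0 : 0 <= e * q m x by rewrite mulr_ge0 // ltW.
    by rewrite lerDl eq0 andbT; have := su x; rewrite ler_norml => /andP[]; lra.
  rewrite (_ : (\int[mu]_x _)%E =
     (\int[mu]_x (e^-1 * B x + s * u m x + e * q m x))%:E); last first.
    by rewrite /Rintegral fineK //; exact: (integrable_fin_num measurableT hi).
  rewrite lee_fin RintegralD //; last exact: (integrableD measurableT (eiB e^-1) (siu m)).
  rewrite RintegralD //.
  rewrite (RintegralZl e^-1) // (RintegralZl s) // (RintegralZl e) //.
  have h1 : s * \int[mu]_x u m x < dl by apply: hN; rewrite /= leq_addl.
  have h2 : e * \int[mu]_x q m x <= e * M by rewrite ler_pM2l.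
  by rewrite /c; move: h1 h2; lra.
have gmax : mu.-integrable setT (EFin \o (fun x => Num.max 0 (g x))).
  apply: (le_integrable measurableT) (gi).
    apply/measurable_EFinP; apply: measurable_maxr; first exact: measurable_cst.
    by apply/measurable_EFinP; exact: (measurable_int _ gi).
  move=> x _; rewrite lee_fin ger0_norm ?le_max ?lexx // ge_max normr_ge0.
  exact: ler_norm.
rewrite (_ : (\int[mu]_x _)%E = (\int[mu]_x Num.max 0 (g x))%:E); last first.
  by rewrite /Rintegral fineK //; exact: (integrable_fin_num measurableT gmax).
rewrite lee_fin => hc.
have : \int[mu]_x g x <= c.
  apply: le_trans hc; apply: le_Rintegral => // x _.
  by rewrite le_max lexx orbT.
rewrite /g RintegralD //.
rewrite (RintegralZl e^-1) // (RintegralZl s) // /c.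
lra.
Qed.

Lemma weak_limit_integral0 : \int[mu]_x v x = 0.
Proof.
apply/le_anti; have := one_sided (normr1 R); rewrite mul1r => -> /=.
have := one_sided (s := -1); rewrite normrN normr1 => /(_ erefl).
by rewrite mulN1r oppr_le0.
Qed.

End WeakLimit.
End FatouLemmas.

(** * The Poisson kernel *)

Section PoissonIntegral.
Variable R : realType.
Local Notation leb := (@lebesgue_measure R).

Definition poisson (a c x : R) : R := ((x - a) ^+ 2 + c ^+ 2)^-1.

Lemma poisson_den_gt0 (a c x : R) : 0 < c -> 0 < (x - a) ^+ 2 + c ^+ 2.
Proof. by move=> c0; rewrite ltr_wpDl ?sqr_ge0 ?exprn_gt0. Qed.

Lemma poisson_ge0 (a c x : R) : 0 < c -> 0 <= poisson a c x.
Proof. by move=> c0; rewrite invr_ge0 ltW ?poisson_den_gt0. Qed.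

Lemma poisson_continuous (a c : R) : 0 < c -> continuous (poisson a c).
Proof.
move=> c0 x; apply: cvgV; first by rewrite gt_eqF ?poisson_den_gt0.
by apply: cvgD; [apply: cvgM; apply: cvgB; [exact: cvg_id|exact: cvg_cst|exact: cvg_id|exact: cvg_cst]|exact: cvg_cst].
Qed.

Lemma is_derive_poisson (a c x : R) : 0 < c ->
  is_derive x (1 : R) (fun x => c^-1 * atan ((x - a) / c)) (poisson a c x).
Proof.
move=> c0; have c0' : c != 0 by rewrite gt_eqF.
have d1 : is_derive x (1 : R) (fun x => (x - a) / c) c^-1.
  rewrite (_ : (fun x => _) = c^-1 \*: (id - cst a)); last first.
    by apply/funext => y /=; rewrite mulrC.
  by apply: is_derive_eq; rewrite subr0 /GRing.scale /= mulr1.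
have d2 := @is_derive1_comp _ atan (fun x => (x - a) / c) x _ _ (is_derive1_atan _) d1.
have d3 := @is_deriveZ _ _ _ _ c^-1 _ _ _ d2.
rewrite (_ : (fun x => _) = c^-1 \*: (atan \o (fun x => (x - a) / c))) //.
apply: is_derive_eq; rewrite /poisson /GRing.scale /=.
field; rewrite c0' !gt_eqF //; first exact: poisson_den_gt0.
Qed.

Lemma integral_half_poisson (a c : R) : 0 < c ->
  (\int[leb]_(x in `[a, +oo[) (poisson a c x)%:E = (pi / 2 / c)%:E)%E.
Proof.
move=> c0.
rewrite (@ge0_continuous_FTC2y _ _ (fun x => c^-1 * atan ((x - a) / c)) a (c^-1 * (pi / 2))).
- by rewrite subrr mul0r atan0 mulr0 sube0 mulrC.
- by move=> x _; exact: poisson_ge0.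
- by apply: continuous_subspaceT; exact: poisson_continuous.
- apply: cvgM; first exact: cvg_cst.
  apply: (@cvg_comp _ _ _ (fun x => (x - a) / c) atan _ +oo%R); last exact: cvgy_atan.
  apply/cvgryPge => A; exists (A * c + a); split; first exact: num_real.
  by move=> x /ltW h; rewrite ler_pdivlMr // lerBrDr.
- by move=> x _; have [] := @is_derive_poisson a c x c0.
- have [/derivable1_diffP/differentiable_continuous h _] := @is_derive_poisson a c a c0.
  by apply: cvg_at_right_filter; exact: h.
- by move=> x _; rewrite derive1E; have [_ ->] := @is_derive_poisson a c x c0.
Qed.

Lemma integral_poisson (a c : R) : 0 < c -> (\int[leb]_x (poisson a c x)%:E = (pi / c)%:E)%E.
Proof.
move=> c0.
have mP : measurable_fun setT (poisson a c).
  by apply: continuous_measurable_fun; exact: poisson_continuous.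
have -> : [set: R] = `]-oo, a] `|` `]a, +oo[.
  apply/seteqP; split => x //= _; rewrite !in_itv /= andbT.
  by case: (leP x a); [left|right].
rewrite ge0_integral_setU //=; last first.
- apply/disj_setPS => x /=; rewrite !in_itv /= andbT => -[xa ax].
  by move: (le_lt_trans xa ax); rewrite ltxx.
- by move=> x _; rewrite lee_fin poisson_ge0.
- by apply: measurable_funTS; apply/measurable_EFinP.
rewrite -[X in `]-oo, X]%classic](opprK a).
rewrite ge0_integration_by_substitutionNy; first last.
- by move=> x _; exact: poisson_ge0.
- by apply: continuous_subspaceT; exact: poisson_continuous.
have -> : (fun x => ((poisson a c \o -%R) x)%:E) = (fun x => (poisson (- a) c x)%:E).
  apply/funext => x /=; rewrite /poisson; congr (_%:E); congr (_^-1); congr (_ + _).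
  by rewrite -sqrrN; congr (_ ^+ 2); ring.
rewrite integral_half_poisson // integral_itv_obnd_cbnd; last first.
  by apply: measurable_funTS; apply/measurable_EFinP.
rewrite integral_half_poisson // -EFinD; congr (_%:E).
by field; rewrite gt_eqF.
Qed.

Lemma integrable_poisson (a c : R) : 0 < c -> leb.-integrable setT (EFin \o poisson a c).
Proof.
move=> c0; apply/integrableP; split.
  by apply/measurable_EFinP; apply: continuous_measurable_fun; exact: poisson_continuous.
under eq_integral do rewrite /= ger0_norm ?poisson_ge0 //.
by rewrite integral_poisson // ltry.
Qed.

End PoissonIntegral.

Section ProductMeasurability.
Variable R : realType.
Local Notation T := (measurableTypeR R).

(** Rounding down the second variable gives functions that are piecewise
    constant in it; they converge to [f] by continuity.  Constancy for negative
    [t] allows rounding with natural numbers only. *)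
Lemma measurable_fun_caratheodory (f : T * T -> R) :
  (forall t, measurable_fun [set: T] (fun x => f (x, t))) ->
  (forall x, continuous (fun t : R => f (x, t))) ->
  (forall x t, t < 0 -> f (x, t) = f (x, 0)) ->
  measurable_fun setT f.
Proof.
move=> mf cf f0.
pose s (n : nat) (t : R) : R := Num.max 0 t * n.+1%:R.
have s0 n t : 0 <= s n t by rewrite mulr_ge0 // le_max lexx.
pose r (n : nat) (t : R) : R := (Num.truncn (s n t))%:R / n.+1%:R.
have ms n : measurable_fun [set: T] (s n).
  by apply: measurable_funM => //; apply: measurable_maxr => //; exact: measurable_cst.
have H1 n : measurable_fun [set: T * T] (fun xt => f (xt.1, r n xt.2)).
  move=> _ Y mY; rewrite setTI.
  pose D k : set T := [set t | Num.truncn (s n t) = k].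
  have mD k : measurable (D k).
    have -> : D k = s n @^-1` `[k%:R, k.+1%:R[.
      apply/seteqP; split => t; rewrite /D /= in_itv /= -truncn_eq //.
        by move=> ->.
      by move/eqP.
    by rewrite -[_ @^-1` _]setTI; exact: ms.
  rewrite (_ : _ @^-1` Y =
    \bigcup_k (((fun x => f (x, k%:R / n.+1%:R)) @^-1` Y) `*` D k)); last first.
    apply/seteqP; split => [[x t] /= h|[x t] [k _] [/= h]].
      by exists (Num.truncn (s n t)) => //; split.
    by rewrite /D /r /= => ->.
  apply: bigcup_measurable => k _; apply: measurableX => //.
  by rewrite -[_ @^-1` _]setTI; exact: mf.
suff H2 xt : [set: T * T] xt -> f (xt.1, r n xt.2) @[n --> \oo] --> f xt.
  exact: (measurable_fun_cvg H1 H2).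
case: xt => x t _ /=.
have -> : f (x, t) = f (x, Num.max 0 t).
  have [t0|t0] := ltP t 0; first exact: f0.
  by [].
apply: (@cvg_comp _ _ _ (fun n => r n t) (fun t => f (x, t)) _ (nbhs (Num.max 0 t : R))); last exact: cf.
apply/cvgrPdist_lt => e e0; near=> n.
have /andP[h1 h2] := truncn_itv (s0 n t).
have n0 : 0 < n.+1%:R :> R by [].
have a1 : r n t <= Num.max 0 t by rewrite /r ler_pdivrMr.
have a2 : Num.max 0 t < r n t + n.+1%:R^-1.
  by rewrite /r -[X in _ + X]mul1r -mulrDl ltr_pdivlMr // natr1.
rewrite ger0_norm ?subr_ge0 //; apply: (@lt_trans _ _ n.+1%:R^-1).
  by rewrite ltrBlDl.
by near: n; exact: near_infty_natSinv_lt (PosNum e0).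
Unshelve. all: by end_near. Qed.

End ProductMeasurability.

(** * Vertical lines with small integrals *)

Section SmallSections.
Variable R : realType.
Local Notation leb := (@lebesgue_measure R).
Local Notation T := (measurableTypeR R).

Lemma tonelli_on (f : T * T -> R) (A B : set T) : measurable A -> measurable B ->
  measurable_fun setT f -> (forall xt, 0 <= f xt) ->
  (\int[leb]_(x in A) \int[leb]_(t in B) (f (x, t))%:E =
   \int[leb]_(t in B) \int[leb]_(x in A) (f (x, t))%:E)%E.
Proof.
move=> mA mB mf f0.
pose g := (EFin \o f) \_ (A `*` B).
have mg : measurable_fun setT g.
  apply/(measurable_restrictT _ _).1; first exact: measurableX.
  by apply: measurable_funTS; exact/measurable_EFinP.
have g0 xt : (0 <= g xt)%E by rewrite /g patchE; case: ifP => //; rewrite lee_fin.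
have inA x t : ((x, t) \in A `*` B) = (x \in A) && (t \in B).
  by apply/idP/andP; rewrite !inE.
have E := @fubini_tonelli _ _ T T R leb leb g mg g0.
rewrite [LHS]integral_mkcond [RHS]integral_mkcond.
etransitivity; [|etransitivity; [exact: E|]].
  apply: eq_integral => x _; rewrite patchE; case: ifP => xA.
    rewrite [LHS]integral_mkcond; apply: eq_integral => t _.
    by rewrite /g !patchE inA xA.
  rewrite (_ : (fun y => g (x, y)) = cst 0%E) ?integral0 //.
  by apply/funext => t; rewrite /g !patchE inA xA.
apply: eq_integral => t _; rewrite patchE; case: ifP => tB.
  rewrite [RHS]integral_mkcond; apply: eq_integral => x _.
  by rewrite /g !patchE inA tB andbT.
rewrite (_ : (fun y => g (y, t)) = cst 0%E) ?integral0 //.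
by apply/funext => x; rewrite /g !patchE inA tB andbF.
Qed.

Lemma measurable_section_integral1 (f : T * T -> R) (B : set T) : measurable B ->
  measurable_fun setT f -> (forall xt, 0 <= f xt) ->
  measurable_fun setT (fun x => \int[leb]_(t in B) (f (x, t))%:E)%E.
Proof.
move=> mB mf f0; pose g := (EFin \o f) \_ (setT `*` B).
have mg : measurable_fun setT g.
  apply/(measurable_restrictT _ _).1; first exact: measurableX.
  by apply: measurable_funTS; exact/measurable_EFinP.
have g0 xt : (0 <= g xt)%E by rewrite /g patchE; case: ifP => //; rewrite lee_fin.
have := @measurable_fun_fubini_tonelli_F _ _ T T R leb g mg g0.
congr measurable_fun; apply/funext => x; rewrite /fubini_F [RHS]integral_mkcond.
apply: eq_integral => t _; rewrite /g !patchE; congr (if _ then _ else _).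
by apply/idP/idP; rewrite !inE => // -[].
Qed.

Lemma measurable_section_integral2 (f : T * T -> R) (A : set T) : measurable A ->
  measurable_fun setT f -> (forall xt, 0 <= f xt) ->
  measurable_fun setT (fun t => \int[leb]_(x in A) (f (x, t))%:E)%E.
Proof.
move=> mA mf f0.
apply: (@measurable_section_integral1 (fun xt => f (xt.2, xt.1))) => //.
by apply: (measurableT_comp mf); exact: measurable_swap.
Qed.

(** Otherwise the double integral over a long enough strip, computed in the
    other order, would exceed its bound. *)
Lemma exists_small_section (f : T * T -> R) (y Y M : R) : y <= Y ->
  measurable_fun setT f -> (forall xt, 0 <= f xt) ->
  (forall t, y <= t <= Y -> (\int[leb]_(x in `[0%R, +oo[) (f (x, t))%:E <= M%:E)%E) ->
  forall T0 dl : R, 0 < dl -> exists2 X : R, T0 <= X &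
    (\int[leb]_(t in `[y, Y]) (f (X, t))%:E <= dl%:E)%E.
Proof.
move=> yY mf f0 fM T0 dl dl0; apply: contrapT => none.
pose a := Num.max 0 T0.
have a0 : 0 <= a by rewrite le_max lexx.
have big x : a <= x -> (dl%:E <= \int[leb]_(t in `[y, Y]) (f (x, t))%:E)%E.
  move=> ax; rewrite leNgt; apply/negP => h; apply: none; exists x; last exact: ltW.
  by apply: le_trans ax; rewrite le_max lexx orbT.
pose K := (`|M| * (Y - y) + 1) / dl.
have K0 : 0 < K by rewrite divr_gt0 // ltr_wpDl // mulr_ge0 // subr_ge0.
pose b := a + K.
have ab : a < b by rewrite ltrDl.
have mfx x : measurable_fun setT (fun t => f (x, t)).
  by apply: (measurableT_comp mf); exact: measurable_pair1.
have mft t : measurable_fun setT (fun x => f (x, t)).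
  by apply: (measurableT_comp mf); exact: measurable_pair2.
have low : ((dl * K)%:E <= \int[leb]_(x in `[a, b]) \int[leb]_(t in `[y, Y]) (f (x, t))%:E)%E.
  have -> : (dl * K)%:E = (\int[leb]_(x in `[a, b]) (cst dl%:E x))%E.
    rewrite integral_cst //= lebesgue_measure_itv /= lte_fin ab.
    by rewrite -EFinB -EFinM; congr (_ * _)%:E; rewrite /b; ring.
  apply: ge0_le_integral => //.
  - by move=> x _; rewrite lee_fin ltW.
  - by apply: measurable_funTS; exact: measurable_section_integral1.
  - by move=> x; rewrite /= in_itv /= => /andP[ax _]; exact: big.
have up : (\int[leb]_(x in `[a, b]) \int[leb]_(t in `[y, Y]) (f (x, t))%:E <=
    (`|M| * (Y - y))%:E)%E.
  rewrite tonelli_on //.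
  apply: (@le_trans _ _ (\int[leb]_(t in `[y, Y]) (cst `|M|%:E t))%E).
    apply: ge0_le_integral => //.
    - by move=> t _; apply: integral_ge0 => x _; rewrite lee_fin.
    - by apply: measurable_funTS; exact: measurable_section_integral2.
    - move=> t; rewrite /= in_itv /= => tyY; apply: (@le_trans _ _ M%:E); last first.
        by rewrite lee_fin ler_norm.
      apply: le_trans (fM t tyY); apply: ge0_subset_integral => //.
      - by apply: measurable_funTS; exact/measurable_EFinP.
      - by move=> x _; rewrite lee_fin.
      by move=> x; rewrite /= !in_itv /= andbT => /andP[/(le_trans a0)].
  rewrite integral_cst //= lebesgue_measure_itv /= lte_fin.
  move: yY; rewrite le_eqVlt => /orP[/eqP ->|yY].
    by rewrite ltxx mule0 subrr mulr0.
  by rewrite yY -EFinB -EFinM.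
have := le_trans low up; rewrite lee_fin /K mulrC divfK ?gt_eqF //.
by rewrite gerDl ler10.
Qed.

End SmallSections.

(** * Estimates on rectangles for Hardy functions *)

Lemma Rint_le d (T : measurableType d) (R : realType) (mu : {measure set T -> \bar R})
    (D : set T) (f : T -> R) c : measurable D ->
  mu.-integrable D (EFin \o f) ->
  (\int[mu]_(x in D) (f x)%:E <= c%:E)%E -> \int[mu]_(x in D) f x <= c.
Proof.
move=> mD fi fc; have fn := integrable_fin_num mD fi.
by rewrite -lee_fin /Rintegral fineK.
Qed.

Section HardyCauchy.
Variable R : realType.
Local Notation C := R[i].
Local Notation leb := (@lebesgue_measure R).
Local Notation T := (measurableTypeR R).
Local Notation normc := (@ComplexField.Normc.normc R).

Definition sqmod (z : C) : R := Re z ^+ 2 + Im z ^+ 2.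

Lemma sqmodE z : sqmod z = normc z ^+ 2. Proof. by rewrite normc_sqr. Qed.
Lemma sqmod_ge0 z : 0 <= sqmod z. Proof. by rewrite addr_ge0 ?sqr_ge0. Qed.
Lemma sqmodM x y : sqmod (x * y) = sqmod x * sqmod y.
Proof. by rewrite !sqmodE normcMM exprMn. Qed.
Lemma sqmodV x : sqmod x^-1 = (sqmod x)^-1.
Proof. by rewrite !sqmodE normcVV exprVn. Qed.

Lemma young (e u v : R) : 0 < e -> u * v <= e * u ^+ 2 + e^-1 * v ^+ 2.
Proof.
move=> e0; rewrite -subr_ge0.
have -> : e * u ^+ 2 + e^-1 * v ^+ 2 - u * v =
    e^-1 * ((e * u - v / 2) ^+ 2 + 3 / 4 * v ^+ 2).
  by field; rewrite gt_eqF.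
by rewrite mulr_ge0 ?invr_ge0 ?(ltW e0) // addr_ge0 ?sqr_ge0 // mulr_ge0 ?sqr_ge0 //; lra.
Qed.

Lemma normcM_young (e : R) (x y : C) : 0 < e ->
  normc (x * y) <= e * sqmod x + e^-1 * sqmod y.
Proof. by move=> e0; rewrite normcMM !sqmodE; exact: young. Qed.

Lemma sqmod_continuous : continuous (fun z : C^o => sqmod z : R^o).
Proof.
move=> z.
have h1 := @continuous_comp C^o R^o R^o (fun z => Re (z : C)) (fun x => x ^+ 2) z
  (@cont_Re _ z) (@exprn_continuous R 2 _).
have h2 := @continuous_comp C^o R^o R^o (fun z => Im (z : C)) (fun x => x ^+ 2) z
  (@cont_Im _ z) (@exprn_continuous R 2 _).
exact: (cvgD h1 h2).
Qed.

Lemma cont_seg_integrable (f : R -> R) u v :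
  (forall x, u <= x <= v -> {for x, continuous f}) ->
  leb.-integrable `[u, v] (EFin \o f).
Proof.
move=> fc; apply: continuous_compact_integrable; first exact: segment_compact.
by apply: continuous_in_subspaceT => x; rewrite inE /= in_itv /=; exact: fc.
Qed.

Section FixedFunction.
Variables (h : C -> C) (M : R).
Hypothesis hh : forall z, 0 < Im z -> holo h z.
Hypothesis hM : forall y, 0 < y -> (\int[leb]_x (sqmod (h (x +i* y)))%:E <= M%:E)%E.

Let hc z : 0 < Im z -> {for (z : C^o), continuous (h : C^o -> C^o)}.
Proof. by move=> z0; apply: holo_cont; exact: hh. Qed.

Let sqmodh_cont z : 0 < Im z -> {for (z : C^o), continuous (fun z : C^o => sqmod (h z) : R^o)}.
Proof.
move=> z0; apply: (@continuous_comp C^o C^o R^o h (fun z => sqmod z) z); first exact: hc.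
exact: sqmod_continuous.
Qed.

Let sqmodh_horiz y : 0 < y -> continuous (fun x : R => sqmod (h (x +i* y))).
Proof.
move=> y0 x; apply: (@continuous_comp R C^o R^o (fun x => x +i* y) (fun z => sqmod (h z)) x).
  exact: cont_horiz.
exact: sqmodh_cont.
Qed.

Let sqmodh_vert x y : 0 < y -> {for y, continuous (fun y : R => sqmod (h (x +i* y)))}.
Proof.
move=> y0; apply: (@continuous_comp R C^o R^o (fun y => x +i* y) (fun z => sqmod (h z)) y).
  exact: cont_vert.
exact: sqmodh_cont.
Qed.

(** The bound on horizontal lines controls almost all vertical segments, by
    exchanging integrations. *)
Let vertical_small y Y : 0 < y -> y <= Y -> forall T0 dl : R, 0 < dl ->
  exists2 X : R, T0 <= X &
    (\int[leb]_(t in `[y, Y]) (sqmod (h (X +i* t)) + sqmod (h ((- X) +i* t)))%:E <= dl%:E)%E.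
Proof.
move=> y0 yY T0 dl dl0.
(* [h] may be discontinuous outside the half-plane, so [t] is clipped. *)
pose clip (t : R) := Num.max y (Num.min t Y).
have clip0 t : 0 < clip t by rewrite /clip lt_max y0.
have clipc : continuous clip.
  have hmin : continuous (fun t : R => Num.min t Y).
    move=> t; have h1 : {for t, continuous (fun t : R => t : R^o)} by exact: cvg_id.
    exact: (continuous_min h1 (@cst_continuous R R^o Y t)).
  move=> t; exact: (continuous_max (@cst_continuous R R^o y t) (hmin t)).
have clipE t : y <= t <= Y -> clip t = t.
  by move=> /andP[yt tY]; rewrite /clip (min_l tY) (max_r yt).
pose f (xt : T * T) := sqmod (h (xt.1 +i* clip xt.2)) + sqmod (h ((- xt.1) +i* clip xt.2)).
have mf : measurable_fun setT f.
  apply: measurable_fun_caratheodory.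
  - move=> t; apply: continuous_measurable_fun => x; apply: cvgD.
      exact: sqmodh_horiz.
    apply: (@continuous_comp R R R -%R (fun x => sqmod (h (x +i* clip t)))).
      exact: oppr_continuous.
    exact: sqmodh_horiz.
  - move=> x t; apply: cvgD.
      apply: (@continuous_comp R R R clip (fun y => sqmod (h (x +i* y)))); first exact: clipc.
      exact: sqmodh_vert.
    apply: (@continuous_comp R R R clip (fun y => sqmod (h ((- x) +i* y)))); first exact: clipc.
    exact: sqmodh_vert.
  - move=> x t t0; rewrite /f /=; suff -> : clip t = clip 0 by [].
    have Y0 : 0 < Y by exact: lt_le_trans yY.
    rewrite /clip (min_l (ltW Y0)) (min_l (ltW (lt_trans t0 Y0))).
    by rewrite (max_l (ltW y0)) (max_l (ltW (lt_trans t0 y0))).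
have f0 xt : 0 <= f xt by rewrite addr_ge0 ?sqmod_ge0.
have fM t : y <= t <= Y -> (\int[leb]_(x in `[0%R, +oo[) (f (x, t))%:E <= (M + M)%:E)%E.
  move=> tyY; rewrite /f /= (clipE _ tyY).
  have t0 : 0 < t by case/andP: tyY => yt _; exact: lt_le_trans yt.
  have m1 : measurable_fun setT (fun x : R => (sqmod (h (x +i* t)))%:E).
    by apply/measurable_EFinP; apply: continuous_measurable_fun; exact: sqmodh_horiz.
  under eq_integral do rewrite EFinD.
  rewrite ge0_integralD //=; first last.
  - apply/measurable_EFinP; apply: measurable_funTS; apply: continuous_measurable_fun => x.
    apply: (@continuous_comp R R R -%R (fun x => sqmod (h (x +i* t)))).
      exact: oppr_continuous.
    exact: sqmodh_horiz.
  - by move=> x _; rewrite lee_fin sqmod_ge0.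
  - exact: measurable_funTS.
  - by move=> x _; rewrite lee_fin sqmod_ge0.
  rewrite EFinD; apply: leeD.
    apply: le_trans (hM t0); apply: ge0_subset_integral => //.
    by move=> x _; rewrite lee_fin sqmod_ge0.
  have := @ge0_integration_by_substitutionNy R (fun x => sqmod (h (x +i* t))) 0.
  rewrite oppr0 => <-; first last.
  - by move=> x _; exact: sqmod_ge0.
  - by apply: continuous_subspaceT; exact: sqmodh_horiz.
  apply: le_trans (hM t0); apply: ge0_subset_integral => //.
  by move=> x _; rewrite lee_fin sqmod_ge0.
have [X TX hX] := exists_small_section yY mf f0 fM T0 dl0.
exists X => //; apply: le_trans hX; rewrite le_eqVlt; apply/orP; left; apply/eqP.
by apply: eq_integral => t; rewrite inE /= in_itv /= => tyY; rewrite /f /= clipE.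
Qed.

Variable w : C.
Hypothesis w0 : 0 < Im w.
Hypothesis hw : h w = 0.

Let psi z := h z * (z - w)^-1.

Let psih z : 0 < Im z -> z != w -> holo psi z.
Proof.
move=> z0 zw; apply: (holoM (hh z0)); apply: holoV; first by rewrite subr_eq0.
by apply: holoB; [exact: holo_id|exact: holo_cst].
Qed.

Let psi_cont z : 0 < Im z -> z != w -> {for (z : C^o), continuous (psi : C^o -> C^o)}.
Proof. by move=> ? ?; apply: holo_cont; exact: psih. Qed.

(** Cauchy's theorem moves the integral on the lower side of a rectangle to the
    other sides.  [X] is chosen to make the vertical ones small; on the upper
    one [Y - Im w] makes the square integral of [1 / (z - w)] small, against
    which the weight [e] can be taken small as well. *)
Lemma box_bound y Y (e eta T0 : R) : 0 < y -> y < Im w -> Im w < Y -> 0 < e -> 0 < eta ->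
  exists2 X : R, T0 <= X &
    normc (Cint `[- X, X] (fun x => psi (x +i* y))) <=
      2 * (e * M + e^-1 * (pi / (Y - Im w))) + eta.
Proof.
move=> y0 yb bY e0 eta0.
pose a := Re w; pose b := Im w.
have b0 : 0 < b := w0.
have {}yb : y < b := yb.
have {}bY : b < Y := bY.
have wE : a +i* b = w by rewrite /a /b; case: (w).
have yY : y <= Y by rewrite ltW // (lt_trans yb).
(* On the vertical sides [z - w] has modulus at least [L], so that
   [1 / (z - w)] contributes at most [(Y - y) / L ^ 2 <= eta / 8]. *)
pose L := 1 + 8 * (Y - y) / eta.
have L1 : 1 <= L by rewrite lerDl divr_ge0 ?(ltW eta0) // mulr_ge0 // subr_ge0.
have L0 : 0 < L := lt_le_trans ltr01 L1.
have eta8 : 0 < eta / 8 by rewrite divr_gt0.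
have [X TX hX] := vertical_small y0 yY (Num.max T0 (`|a| + L)) eta8.
move: TX; rewrite ge_max => /andP[T0X LX].
exists X => //.
have X0 : 0 < X by apply: lt_le_trans LX; rewrite ltr_wpDl.
have XX : - X <= X by rewrite ge0_cp // ltW.
have aX : - X < a < X.
  have : `|a| < X by apply: lt_le_trans LX; rewrite ltrDl.
  by rewrite ltr_norml.
have hne x t : (t != b) || (x != a) -> x +i* t != w.
  by move=> ne; rewrite -wE eq_complex /= negb_and orbC.
have pc x t : 0 < t -> (t != b) || (x != a) ->
    {for (x +i* t : C^o), continuous (psi : C^o -> C^o)}.
  by move=> t0 ne; apply: psi_cont => //; exact: hne.
have c1 : seg_cont (- X) X (fun x => psi (x +i* y)).
  by apply: seg_cont_horiz => x _; apply: pc => //; rewrite lt_eqF.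
have Y0 : 0 < Y := lt_trans b0 bY.
have c2 : seg_cont (- X) X (fun x => psi (x +i* Y)).
  by apply: seg_cont_horiz => x _; apply: pc => //; rewrite gt_eqF.
case/andP: (aX) => aX1 aX2.
have c3 : seg_cont y Y (fun t => psi (X +i* t)).
  apply: seg_cont_vert => t /andP[yt _]; apply: pc; first exact: lt_le_trans yt.
  by rewrite (gt_eqF aX2) orbT.
have c4 : seg_cont y Y (fun t => psi ((- X) +i* t)).
  apply: seg_cont_vert => t /andP[yt _]; apply: pc; first exact: lt_le_trans yt.
  by rewrite (lt_eqF aX1) orbT.
have rect0 : rectint psi (- X) X y Y = 0.
  have [M' [r [r0 hr]]] := holo_bounded_quot (hh w0).
  apply: (@goursat_punctured _ _ _ _ _ _ a b M' r) => //.
  - by rewrite yb bY.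
  - move=> z _ /andP[yz _]; rewrite wE => zw.
    by apply: psih => //; exact: lt_le_trans yz.
  - move=> z; rewrite wE => zw zr; rewrite /psi.
    by have := hr _ zw zr; rewrite hw subr0.
have sqmodi x : leb.-integrable `[y, Y] (EFin \o (fun t => sqmod (h (x +i* t)))).
  apply: cont_seg_integrable => t /andP[yt _].
  by apply: sqmodh_vert; exact: lt_le_trans yt.
have cst_i (k : R) u v : leb.-integrable `[u, v] (EFin \o cst k).
  by apply: cont_seg_integrable => t _; exact: cst_continuous.
pose A x := \int[leb]_(t in `[y, Y]) sqmod (h (x +i* t)).
have A0 x : 0 <= A x by apply: Rintegral_ge0 => t _; exact: sqmod_ge0.
have AA : A X + A (- X) <= eta / 8.
  rewrite /A -RintegralD //; apply: Rint_le => //.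
  exact: (integrableD _ (sqmodi X) (sqmodi (- X))).
have YLL : (Y - y) / L ^+ 2 <= eta / 8.
  have Yy : 0 <= Y - y by rewrite subr_ge0.
  have h1 : 8 * (Y - y) / eta <= L by rewrite /L lerDr.
  rewrite ler_pdivrMr ?exprn_gt0 //; apply: (@le_trans _ _ (eta / 8 * L)).
    by move: h1; rewrite ler_pdivrMr // => h1; move: h1; lra.
  by rewrite ler_pM2l // expr2 ler_peMr // ltW.
have side x : `|x| = X -> A x <= eta / 8 ->
    seg_cont y Y (fun t => psi (x +i* t)) ->
    normc (Cint `[y, Y] (fun t => psi (x +i* t))) <= eta / 2.
  move=> xX Ax cx.
  apply: (le_trans (@normc_Cint _ `[y, Y]%classic _ _
    (fun t => sqmod (h (x +i* t)) + (L ^+ 2)^-1) (seg_cintegrable cx) _ _)) => //.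
  - exact: (integrableD _ (sqmodi x) (cst_i (L ^+ 2)^-1 y Y)).
  - move=> t _; rewrite /psi; apply: (le_trans (normcM_young _ _ ltr01)).
    rewrite invr1 !mul1r lerD2l sqmodV lef_pV2 ?posrE ?exprn_gt0 //; last first.
      rewrite sqmodE exprn_gt0 // normc_gt0 subr_eq0; apply: hne.
      by apply/orP; right; apply/eqP => xa; move: LX; rewrite -xX xa gerDl leNgt L0.
    rewrite sqmodE lerXn2r ?nnegrE ?normc_ge0 ?(ltW L0) //.
    apply: le_trans (Re_le_normc _); rewrite cReB /= -/a.
    apply: le_trans (lerB_dist x a); rewrite xX; move: LX; lra.
  rewrite (RintegralD _ (sqmodi x) (cst_i (L ^+ 2)^-1 y Y)) // -/(A x).
  have -> : \int[leb]_(t in `[y, Y]) (cst (L ^+ 2)^-1 t) = (Y - y) / L ^+ 2.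
    have /(congr1 (@complex.Re R)) /= := Cint_cst (L ^+ 2)^-1%:C yY.
    by rewrite mul0r subr0 mulrC.
  by move: YLL Ax; lra.
have AX : A X <= eta / 8 by apply: le_trans AA; rewrite lerDl.
have AmX : A (- X) <= eta / 8 by apply: le_trans AA; rewrite lerDr.
have s1 := side X (gtr0_norm X0) AX c3.
have s2 : normc (Cint `[y, Y] (fun t => psi ((- X) +i* t))) <= eta / 2.
  by apply: side => //; rewrite normrN gtr0_norm.
have Yb0 : 0 < Y - b by rewrite subr_gt0.
have i1 : leb.-integrable `[- X, X] (EFin \o (fun x => sqmod (h (x +i* Y)))).
  by apply: cont_seg_integrable => x _; exact: sqmodh_horiz.
have i2 : leb.-integrable `[- X, X] (EFin \o poisson a (Y - b)).
  by apply: cont_seg_integrable => x _; exact: poisson_continuous.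
have ie (k : R) (f : R -> R) : leb.-integrable `[- X, X] (EFin \o f) ->
    leb.-integrable `[- X, X] (EFin \o (fun x => k * f x)).
  move=> fi; rewrite (_ : EFin \o _ = (fun x => k%:E * (EFin \o f) x)%E) //.
  by apply: integrableZl => //.
have top : normc (Cint `[- X, X] (fun x => psi (x +i* Y))) <=
    2 * (e * M + e^-1 * (pi / (Y - b))).
  apply: (le_trans (@normc_Cint _ `[- X, X]%classic _ _
    (fun x => e * sqmod (h (x +i* Y)) + e^-1 * poisson a (Y - b) x) (seg_cintegrable c2) _ _)) => //.
  - exact: (integrableD _ (ie e _ i1) (ie e^-1 _ i2)).
  - move=> x _; rewrite /psi; apply: (le_trans (normcM_young _ _ e0)).
    by rewrite sqmodV /sqmod cReB cImB.
  rewrite ler_pM2l // (RintegralD _ (ie e _ i1) (ie e^-1 _ i2)) //.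
  rewrite (RintegralZl e _ i1) // (RintegralZl e^-1 _ i2) //.
  apply: lerD; rewrite ler_pM2l ?invr_gt0 //; apply: Rint_le => //.
    apply: le_trans (hM Y0); apply: ge0_subset_integral => //.
      by apply/measurable_EFinP; apply: continuous_measurable_fun; exact: sqmodh_horiz.
    by move=> x _; rewrite lee_fin sqmod_ge0.
  rewrite -(integral_poisson a Yb0); apply: ge0_subset_integral => //.
    by apply/measurable_EFinP; apply: continuous_measurable_fun; exact: poisson_continuous.
  by move=> x _; rewrite lee_fin poisson_ge0.
have -> : Cint `[- X, X] (fun x => psi (x +i* y)) =
    (Cint `[- X, X] (fun x => psi (x +i* Y)) - 'i%C * (Cint `[y, Y] (fun t => psi (X +i* t)) -
      Cint `[y, Y] (fun t => psi ((- X) +i* t)))) + rectint psi (- X) X y Y.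
  by rewrite /rectint; ring.
rewrite rect0 addr0.
apply: (le_trans (normcB _ _)); apply: lerD => //.
have normci : normc 'i%C = 1 by rewrite /= expr0n expr1n /= add0r sqrtr1.
rewrite normcMM normci mul1r; apply: (le_trans (normcB _ _)).
by rewrite [eta in X in _ <= X](splitr eta) lerD.
Qed.

End FixedFunction.
End HardyCauchy.

(** * The Cauchy formula for Hardy functions *)

Lemma ae_imp d (T : measurableType d) (R : realType) (mu : {measure set T -> \bar R})
    (P Q : T -> Prop) : (forall x, P x -> Q x) ->
  {ae mu, forall x, P x} -> {ae mu, forall x, Q x}.
Proof. by move=> PQ; apply: filterS. Qed.

Section CauchyFormula.
Variable R : realType.
Local Notation C := R[i].
Local Notation leb := (@lebesgue_measure R).
Local Notation normc := (@ComplexField.Normc.normc R).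

Definition cmeasurable (f : R -> C) :=
  measurable_fun setT (fun x => Re (f x)) /\ measurable_fun setT (fun x => Im (f x)).

Lemma cmeasurableM f g : cmeasurable f -> cmeasurable g -> cmeasurable (fun x => f x * g x).
Proof.
move=> [f1 f2] [g1 g2]; split.
  under eq_fun do rewrite cReM.
  by apply: measurable_funB; exact: measurable_funM.
under eq_fun do rewrite cImM.
by apply: measurable_funD; exact: measurable_funM.
Qed.

Lemma cmeasurableB f g : cmeasurable f -> cmeasurable g -> cmeasurable (fun x => f x - g x).
Proof.
move=> [f1 f2] [g1 g2]; split.
  by under eq_fun do rewrite cReB; exact: measurable_funB.
by under eq_fun do rewrite cImB; exact: measurable_funB.
Qed.

Lemma cmeasurable_cont (f : R -> C) : continuous (f : R -> C^o) -> cmeasurable f.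
Proof.
move=> fc; split; apply: continuous_measurable_fun => x.
  exact: (@continuous_comp R C^o R^o f (fun z => Re (z : C)) x (fc x) (@cont_Re _ _)).
exact: (@continuous_comp R C^o R^o f (fun z => Im (z : C)) x (fc x) (@cont_Im _ _)).
Qed.

Lemma inv_sub_cont (w z : C) : z != w ->
  {for (z : C^o), continuous (fun z : C^o => (z - w)^-1 : C^o)}.
Proof.
move=> zw; apply: holo_cont; apply: holoV; first by rewrite subr_eq0.
by apply: holoB; [exact: holo_id|exact: holo_cst].
Qed.

Lemma real_neq (w : C) x : Im w != 0 -> x%:C != w.
Proof. by move=> w0; rewrite eq_complex negb_and /= orbC eq_sym w0. Qed.

Lemma inv_real_cont (w : C) : Im w != 0 -> continuous (fun x : R => (x%:C - w)^-1 : C^o).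
Proof.
move=> w0 x.
apply: (@continuous_comp R C^o C^o (fun x => x +i* 0) (fun z => (z - w)^-1) x).
  exact: cont_horiz.
by apply: inv_sub_cont; exact: real_neq.
Qed.

Lemma cvg_scale0 (k : R) (u : nat -> R) : u n @[n --> \oo] --> (0 : R) ->
  k * u n @[n --> \oo] --> (0 : R).
Proof.
move=> u0; have : k * u n @[n --> \oo] --> (k * 0 : R).
  by apply: cvgM; [exact: cvg_cst|exact: u0].
by rewrite mulr0.
Qed.

Lemma cvg_at_right_seq (b : R) : 0 < b -> (b / n.+2%:R) @[n --> \oo] --> (0 : R)^'+.
Proof.
move=> b0 P [e /= e0 He].
have : b / n.+2%:R @[n --> \oo] --> (0 : R).
  apply: (@cvg_scale0 b (fun n => n.+2%:R^-1)).
  by rewrite (cvg_shiftS (fun n => n.+1%:R^-1 : R)); exact: cvg_harmonic.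
move/cvgrPdist_lt/(_ _ e0); apply: filterS => n hn.
by apply: He => //=; rewrite divr_gt0.
Qed.

(** The truncations of [h z / (z - w)] to [[- X n, X n]] at height [b / (n + 2)] have
    integrals tending to zero by the estimate on rectangles, and converge almost
    everywhere to the boundary function. *)
Lemma cauchy_vanishing (h : C -> C) (M : R) (hb : R -> C) (w : C) :
  (forall z, 0 < Im z -> holo h z) ->
  (forall y, 0 < y -> (\int[leb]_x (sqmod (h (x +i* y)))%:E <= M%:E)%E) ->
  cmeasurable hb ->
  {ae leb, forall x, h (x +i* y) @[y --> 0^'+] --> (hb x : C^o)} ->
  0 < Im w -> h w = 0 ->
  cintegrable setT (fun x => hb x * (x%:C - w)^-1) /\
  Cint setT (fun x => hb x * (x%:C - w)^-1) = 0.
Proof.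
move=> hh hM mhb ae_hb w0 hw.
pose a := Re w; pose b := Im w.
have b0 : 0 < b := w0.
have wE : a +i* b = w by rewrite /a /b; case: (w).
pose psi z := h z * (z - w)^-1.
(* [n.+2] keeps the height below [b / 2], away from the pole at [w]. *)
pose y_ n : R := b / n.+2%:R.
have y0 n : 0 < y_ n by rewrite divr_gt0.
have yb n : y_ n <= b / 2.
  by rewrite ler_pM2l // lef_pV2 ?posrE // ler_nat.
have yb' n : y_ n < b by apply: (le_lt_trans (yb n)); rewrite ltr_pdivrMr // ltr_pMr // ltr1n.
pose K := 2 * (M + pi) + 1.
have /choice[X XP] n : exists X, n%:R <= X /\
    normc (Cint `[- X, X] (fun x => psi (x +i* y_ n))) <= K / n.+1%:R.
  have n0 : 0 < n.+1%:R^-1 :> R by rewrite invr_gt0.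
  have bY : b < b + n.+1%:R ^+ 2 by rewrite ltrDl exprn_gt0.
  (* With upper side at height [b + (n + 1) ^ 2] and both weights [1 / (n + 1)],
     the bound is a multiple of [1 / (n + 1)]. *)
  have [X nX hX] := @box_bound R h M hh hM w w0 hw (y_ n) (b + n.+1%:R ^+ 2)
    n.+1%:R^-1 n.+1%:R^-1 n%:R (y0 n) (yb' n) bY n0 n0.
  exists X; split => //; apply: (le_trans hX); rewrite le_eqVlt; apply/orP; left.
  apply/eqP; rewrite -/b addrAC subrr add0r invrK /K.
  have : n.+1%:R != 0 :> R by rewrite pnatr_eq0.
  by move: (n.+1%:R : R) => N N0; field.
have psic n : continuous (fun x : R => psi (x +i* y_ n) : C^o).
  move=> x; apply: (@continuous_comp R C^o C^o (fun x => x +i* y_ n) psi x).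
    exact: cont_horiz.
  have Iy : 0 < Im (x +i* y_ n) := y0 n.
  apply: holo_cont; apply: holoM; first exact: hh.
  apply: holoV; last by apply: holoB; [exact: holo_id|exact: holo_cst].
  by rewrite subr_eq0 -wE eq_complex /= negb_and orbC lt_eqF.
pose q n x := sqmod (h (x +i* y_ n)).
have mq n : measurable_fun setT (q n).
  apply: continuous_measurable_fun => x.
  apply: (@continuous_comp R C^o R^o (fun x => x +i* y_ n) (fun z => sqmod (h z)) x).
    exact: cont_horiz.
  apply: (@continuous_comp C^o C^o R^o h (fun z => sqmod z)); last exact: sqmod_continuous.
  by apply: holo_cont; apply: hh; exact: (y0 n).
have b20 : 0 < b / 2 by rewrite divr_gt0.
have psib n e x : 0 < e -> normc (psi (x +i* y_ n)) <= e * q n x + e^-1 * poisson a (b / 2) x.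
  move=> e0; apply: (le_trans (normcM_young _ _ e0)); rewrite lerD2l ler_pM2l ?invr_gt0 //.
  have D1 : (b / 2) ^+ 2 <= (y_ n - b) ^+ 2.
    rewrite -subr_ge0 subr_sqr; apply: mulr_le0; move: (yb n) b0; lra.
  have D2 : 0 < (b / 2) ^+ 2 by rewrite exprn_gt0.
  have D4 : 0 < (x - a) ^+ 2 + (b / 2) ^+ 2 by exact: poisson_den_gt0.
  have D3 : 0 < (x - a) ^+ 2 + (y_ n - b) ^+ 2.
    exact: (ltr_wpDl (sqr_ge0 _) (lt_le_trans D2 D1)).
  rewrite sqmodV /poisson /sqmod cReB cImB /= -/a -/b lef_pV2 ?posrE //.
  by rewrite lerD2l.
pose v x := hb x * (x%:C - w)^-1.
have mv : cmeasurable v.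
  apply: cmeasurableM => //; apply: cmeasurable_cont; apply: inv_real_cont.
  by rewrite gt_eqF.
have ae_v : {ae leb, forall x, psi (x +i* y_ n) @[n --> \oo] --> (v x : C^o)}.
  move: ae_hb; apply: ae_imp => x hx.
  apply: (@cvg_comp _ _ _ y_ (fun y => psi (x +i* y)) _ _ _ (cvg_at_right_seq b0)).
  apply: cvgM; first exact: hx.
  have := @cont_vert R x 0.
  have zw : x +i* 0 != w by rewrite (@real_neq w x) // gt_eqF.
  move/(@continuous_comp R C^o C^o (fun y => x +i* y) (fun z => (z - w)^-1) 0).
  move=> /(_ (inv_sub_cont zw)) hc.
  exact: (cvg_at_right_filter hc).
have q0 n x : 0 <= q n x by exact: sqmod_ge0.
have qM n : (\int[leb]_x (q n x)%:E <= M%:E)%E by apply: hM; exact: (y0 n).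
have Bi := @integrable_poisson R a (b / 2) b20.
have main (P : C -> R) : (forall z, `|P z| <= normc z) ->
    continuous (fun z : C^o => P z : R^o) ->
    (forall D g, `|\int[leb]_(x in D) P (g x)| <= normc (Cint D g)) ->
    measurable_fun setT (fun x => P (v x)) ->
    leb.-integrable setT (fun x => (P (v x))%:E) /\ \int[leb]_x P (v x) = 0.
  move=> Pn Pc PI mPv.
  pose u n := (fun x => P (psi (x +i* y_ n))) \_ `[- X n, X n].
  have Ppsi n : continuous (fun x : R => P (psi (x +i* y_ n)) : R).
    move=> x; exact: (@continuous_comp R C^o R^o (fun x => psi (x +i* y_ n)) P x (psic n x) (Pc _)).
  have ui n : leb.-integrable setT (EFin \o u n).
    have W : leb.-integrable `[- X n, X n] (EFin \o (fun x => P (psi (x +i* y_ n)))).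
      by apply: cont_seg_integrable => x _; exact: Ppsi.
    by rewrite /u -restrict_EFin; apply: (integrable_mkcond _ _).1 W.
  have uq e : 0 < e -> forall n x, `|u n x| <= e * q n x + e^-1 * poisson a (b / 2) x.
    move=> e0 n x; rewrite /u patchE; case: ifP => _.
      exact: le_trans (Pn _) (psib _ _ _ e0).
    have e1 : 0 <= e^-1 by rewrite invr_ge0 ltW.
    rewrite normr0; apply: addr_ge0; first exact: (mulr_ge0 (ltW e0) (sqmod_ge0 _)).
    exact: (mulr_ge0 e1 (poisson_ge0 _ _ b20)).
  have uv : {ae leb, forall x, u n x @[n --> \oo] --> P (v x)}.
    move: ae_v; apply: ae_imp => x hx.
    have hP : P (psi (x +i* y_ n)) @[n --> \oo] --> P (v x).
      exact: (@cvg_comp _ _ _ (fun n => psi (x +i* y_ n)) P _ _ _ hx (Pc _)).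
    apply: cvg_trans hP; apply: near_eq_cvg.
    near=> n; rewrite /u patchE ifT // inE /= in_itv /= -ler_norml.
    apply: le_trans (XP n).1; near: n; exact: nbhs_infty_ger.
  have u0 : (\int[leb]_x u n x) @[n --> \oo] --> (0 : R).
    have K0 : (K * n.+1%:R^-1) @[n --> \oo] --> (0 : R).
      exact: (@cvg_scale0 K _ (@cvg_harmonic R)).
    apply: (@squeeze_cvgr _ _ _ _ (fun n => - (K * n.+1%:R^-1)) (fun n => K * n.+1%:R^-1)) => //.
      apply: nearW => n; rewrite -ler_norml; apply: le_trans (XP n).2.
      by rewrite /u -Rintegral_mkcond; exact: PI.
    by rewrite -oppr0; exact: cvgN.
  split.
    exact: (@weak_limit_integrable _ _ _ leb u q (poisson a (b / 2)) (fun x => P (v x)) M).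
  exact: (@weak_limit_integral0 _ _ _ leb u q (poisson a (b / 2)) (fun x => P (v x)) M).
have [i1 e1] := main (@complex.Re R) (@Re_le_normc R) (@cont_Re R)
  (fun D g => Re_le_normc (Cint D g)) mv.1.
have [i2 e2] := main (@complex.Im R) (@Im_le_normc R) (@cont_Im R)
  (fun D g => Im_le_normc (Cint D g)) mv.2.
by split => //; apply: C_eqP.
Unshelve. all: by end_near. Qed.

End CauchyFormula.

(** * Vector valued Hardy functions *)

Section HardySpace.
Variable R : realType.
Local Notation C := R[i].
Local Notation leb := (@lebesgue_measure R).

Lemma sqmodD_le (x y : C) : sqmod (x + y) <= 2 * sqmod x + 2 * sqmod y.
Proof.
rewrite /sqmod cReD cImD -subr_ge0.
have -> : 2 * (Re x ^+ 2 + Im x ^+ 2) + 2 * (Re y ^+ 2 + Im y ^+ 2) -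
  ((Re x + Re y) ^+ 2 + (Im x + Im y) ^+ 2) =
  (Re x - Re y) ^+ 2 + (Im x - Im y) ^+ 2 by ring.
by rewrite addr_ge0 ?sqr_ge0.
Qed.

Lemma sqmodN (x : C) : sqmod (- x) = sqmod x.
Proof. by rewrite /sqmod cReN cImN !sqrrN. Qed.

Lemma sqmod_horiz_measurable (h : C -> C) y : (forall z, 0 < Im z -> holo h z) -> 0 < y ->
  measurable_fun setT (fun x : R => sqmod (h (x +i* y))).
Proof.
move=> hh y0; apply: continuous_measurable_fun => x.
apply: (@continuous_comp R C^o R^o (fun x => x +i* y) (fun z => sqmod (h z)) x).
  exact: cont_horiz.
apply: (@continuous_comp C^o C^o R^o h (fun z => sqmod z)); last exact: sqmod_continuous.
by apply: holo_cont; apply: hh.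
Qed.

(** Subtracting from [h] the multiple of [1 / (z - conj w)] that takes the
    same value at [w] reduces to a function vanishing at [w]; for the kernel
    the integral is that of the Poisson kernel. *)
Lemma hardy_cauchy_scalar (h : C -> C) (M : R) (hb : R -> C) (w : C) :
  (forall z, 0 < Im z -> holo h z) ->
  (forall y, 0 < y -> (\int[leb]_x (sqmod (h (x +i* y)))%:E <= M%:E)%E) ->
  cmeasurable hb ->
  {ae leb, forall x, h (x +i* y) @[y --> 0^'+] --> (hb x : C^o)} ->
  0 < Im w ->
  cintegrable setT (fun x => hb x * (x%:C - w)^-1) /\
  Cint setT (fun x => hb x * (x%:C - w)^-1) = (2 * pi)%:C * 'i%C * h w.
Proof.
move=> hh hM mhb ae_hb w0.
pose a := Re w; pose b := Im w; have b0 : 0 < b := w0.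
have wE : w = a +i* b by rewrite /a /b; case: (w).
pose wc := a +i* (- b).
have wc0 : Im wc != 0 by rewrite oppr_eq0 gt_eqF.
pose k := h w * (w - wc).
pose g z := h z - k * (z - wc)^-1.
have zwc z : 0 < Im z -> z - wc != 0.
  move=> z0; rewrite subr_eq0; apply/eqP => /(congr1 (@complex.Im R)) /= e.
  by move: z0; rewrite e oppr_gt0 ltNge ltW.
have hinv z : 0 < Im z -> holo (fun z => (z - wc)^-1) z.
  move=> z0; apply: holoV; first exact: zwc.
  by apply: holoB; [exact: holo_id|exact: holo_cst].
have hk z : 0 < Im z -> holo (fun z => k * (z - wc)^-1) z.
  by move=> z0; apply: holoM; [exact: holo_cst|exact: hinv].
have gh z : 0 < Im z -> holo g z.
  by move=> z0; apply: holoB; [exact: hh|exact: hk].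
have gw : g w = 0 by rewrite /g /k mulfK ?subrr //; exact: zwc.
have gM y : 0 < y -> (\int[leb]_x (sqmod (g (x +i* y)))%:E <=
    (2 * M + 2 * sqmod k * (pi / b))%:E)%E.
  move=> y0.
  have mh : measurable_fun setT (fun x : R => sqmod (h (x +i* y))) by exact: sqmod_horiz_measurable.
  have mp : measurable_fun setT (poisson a b).
    by apply: continuous_measurable_fun; exact: poisson_continuous.
  have c0 : 0 <= 2 * sqmod k by rewrite mulr_ge0 // sqmod_ge0.
  apply: (@le_trans _ _ (\int[leb]_x (2%:E * (sqmod (h (x +i* y)))%:E +
                                      (2 * sqmod k)%:E * (poisson a b x)%:E))%E).
    apply: ge0_le_integral => //.
    - by move=> x _; rewrite lee_fin sqmod_ge0.
    - by apply/measurable_EFinP; exact: sqmod_horiz_measurable.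
    - by apply: emeasurable_funD; apply: measurable_funeM; apply/measurable_EFinP.
    move=> x _; rewrite -!EFinM -EFinD lee_fin /g.
    apply: (le_trans (sqmodD_le _ _)); rewrite sqmodN sqmodM sqmodV lerD2l mulrA.
    apply: ler_wpM2l => //.
    have D1 : b ^+ 2 <= (y + b) ^+ 2.
      by rewrite lerXn2r ?nnegrE ?addr_ge0 ?(ltW b0) ?(ltW y0) // lerDr ltW.
    have D2 : 0 < b ^+ 2 by rewrite exprn_gt0.
    have D3 : 0 < (x - a) ^+ 2 + b ^+ 2 by exact: poisson_den_gt0.
    have D4 : 0 < (x - a) ^+ 2 + (y + b) ^+ 2.
      exact: (ltr_wpDl (sqr_ge0 _) (lt_le_trans D2 D1)).
    rewrite /poisson /sqmod cReB cImB /= opprK lef_pV2 ?posrE //.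
    by rewrite lerD2l.
  rewrite ge0_integralD //; first last.
  - by apply: measurable_funeM; apply/measurable_EFinP.
  - by move=> x _; rewrite -EFinM lee_fin mulr_ge0 // poisson_ge0.
  - by apply: measurable_funeM; apply/measurable_EFinP.
  - by move=> x _; rewrite -EFinM lee_fin mulr_ge0 // sqmod_ge0.
  rewrite ge0_integralZl_EFin //; first last.
  - exact/measurable_EFinP.
  - by move=> x _; rewrite lee_fin sqmod_ge0.
  rewrite ge0_integralZl_EFin //; first last.
  - exact/measurable_EFinP.
  - by move=> x _; rewrite lee_fin poisson_ge0.
  rewrite integral_poisson // (EFinD (2 * M)); apply: leeD; last by rewrite -EFinM.
  by rewrite (EFinM 2) lee_pmul2l //; exact: hM.
pose gb x := hb x - k * (x%:C - wc)^-1.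
have kc : continuous (fun x : R => k * (x%:C - wc)^-1 : C^o).
  by move=> x; apply: cvgM; [exact: cvg_cst|exact: inv_real_cont].
have mgb : cmeasurable gb by apply: cmeasurableB => //; exact: cmeasurable_cont.
have ae_gb : {ae leb, forall x, g (x +i* y) @[y --> 0^'+] --> (gb x : C^o)}.
  move: ae_hb; apply: ae_imp => x hx.
  have zw : x +i* 0 != wc by exact: real_neq.
  have c1 := cvg_at_right_filter (@continuous_comp R C^o C^o (fun y => x +i* y)
    (fun z => (z - wc)^-1) 0 (@cont_vert R x 0) (inv_sub_cont zw)).
  have c2 : k * (x +i* y - wc)^-1 @[y --> 0^'+] --> (k * (x%:C - wc)^-1 : C^o).
    by apply: cvgM; [exact: cvg_cst|exact: c1].
  exact: (@cvgB C C^o R _ _ _ _ _ _ hx c2).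
have [gi g0] := cauchy_vanishing gh gM mgb ae_gb w0 gw.
pose pk x : C := (poisson a b x)%:C.
have pki : cintegrable setT pk.
  by split; [exact: integrable_poisson|exact: integrable0].
have pkI : Cint setT pk = (pi / b)%:C.
  rewrite /Cint /pk /= Rintegral_cst // mul0r; congr Complex.
  by rewrite /Rintegral integral_poisson.
have E x : hb x * (x%:C - w)^-1 = gb x * (x%:C - w)^-1 + k * pk x.
  have -> : pk x = (x%:C - wc)^-1 * (x%:C - w)^-1.
    rewrite /pk /poisson -invfM wE /wc fmorphV; congr (_^-1).
    by apply: C_eqP; rewrite ?cReM ?cImM !cReB !cImB /=; ring.
  by rewrite /gb; ring.
rewrite (_ : (fun x => _) = fun x => gb x * (x%:C - w)^-1 + k * pk x); last first.
  by apply/funext => x; exact: E.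
have kpki := cintegrableZ measurableT k pki.
split; first exact: cintegrableD.
rewrite CintD // g0 add0r CintZ // pkI /k.
have -> : w - wc = (2 * b)%:C * 'i%C.
  by rewrite wE /wc; apply: C_eqP; rewrite ?cReB ?cImB ?cReM ?cImM /=; ring.
have -> : (2 * pi)%:C = (2 * b)%:C * (pi / b)%:C :> C.
  by rewrite -rmorphM /=; congr (_%:C); field; rewrite gt_eqF.
ring.
Qed.

Lemma sqnorm_sqmod p (v : 'cV[C]_p) : sqnorm v = \sum_i sqmod (v i 0).
Proof. by []. Qed.

Lemma sqmod_le_sqnorm p (v : 'cV[C]_p) i : sqmod (v i 0) <= sqnorm v.
Proof.
rewrite sqnorm_sqmod (bigD1 i) //= lerDl sumr_ge0 // => j _; exact: sqmod_ge0.
Qed.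

Lemma sqnorm_ge0 p (v : 'cV[C]_p) : 0 <= sqnorm v.
Proof. by rewrite sqnorm_sqmod sumr_ge0 // => j _; exact: sqmod_ge0. Qed.

Lemma sqnorm_horiz_measurable p (h : C -> 'cV[C]_p) y :
  holomorphic_on (@upper_half_plane R) h -> 0 < y ->
  measurable_fun setT (fun x : R => sqnorm (h (x +i* y))).
Proof.
move=> hh y0; under eq_fun do rewrite sqnorm_sqmod.
apply: measurable_sum => i.
by apply: (@sqmod_horiz_measurable (fun z => h z i 0)) => // z z0; exact: hh.
Qed.

Lemma hardy2_bound p (h : C -> 'cV[C]_p) : hardy2 h -> exists M : R,
  forall y, 0 < y -> (\int[leb]_x (sqnorm (h (x +i* y)))%:E <= M%:E)%E.
Proof.
move=> [_ hs]; set S := ereal_sup _ in hs.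
have ub y : 0 < y -> (\int[leb]_x (sqnorm (h (x +i* y)))%:E <= S)%E.
  move=> y0; apply: ereal_sup_ubound; exists y => //.
  by rewrite /= in_itv /= y0.
have S0 : (0 <= S)%E.
  apply: le_trans (ub 1 ltr01); apply: integral_ge0 => x _.
  by rewrite lee_fin sqnorm_ge0.
exists (fine S) => y y0; rewrite fineK; first exact: ub.
by rewrite ge0_fin_numE.
Qed.

Lemma hardy_cauchy p (h : C -> 'cV[C]_p) (hb : R -> 'cV[C]_p) (w : C) (i : 'I_p) :
  hardy2 h -> boundary_of h hb -> 0 < Im w ->
  cintegrable setT (fun x => hb x i 0 * (x%:C - w)^-1) /\
  Cint setT (fun x => hb x i 0 * (x%:C - w)^-1) = (2 * pi)%:C * 'i%C * h w i 0.
Proof.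
move=> hh [mhb ae_hb] w0; have [M hM] := hardy2_bound hh.
have [hhol _] := hh.
apply: (@hardy_cauchy_scalar (fun z => h z i 0) M (fun x => hb x i 0)) => //.
- by move=> z z0; exact: hhol.
- move=> y y0; apply: le_trans (hM y y0); apply: ge0_le_integral => //.
  + by move=> x _; rewrite lee_fin sqmod_ge0.
  + apply/measurable_EFinP; apply: (@sqmod_horiz_measurable (fun z => h z i 0)) => // z z0.
    exact: hhol.
  + by apply/measurable_EFinP; exact: sqnorm_horiz_measurable.
  + by move=> x _; rewrite lee_fin sqmod_le_sqnorm.
- by move: ae_hb; apply: ae_imp => x; exact.
Qed.

Lemma hardy2_le p (h : C -> 'cV[C]_p) (M : R) :
  holomorphic_on (@upper_half_plane R) h ->
  (forall y, 0 < y -> (\int[leb]_x (sqnorm (h (x +i* y)))%:E <= M%:E)%E) -> hardy2 h.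
Proof.
move=> hh hM; split => //; apply: (@le_lt_trans _ _ M%:E); last by rewrite ltry.
apply: ge_ereal_sup => v [y y0 <-]; apply: hM.
by move: y0; rewrite /= in_itv /= andbT.
Qed.

Lemma hardy2_poisson p (h : C -> 'cV[C]_p) (k : R) :
  holomorphic_on (@upper_half_plane R) h -> 0 <= k ->
  (forall x y, 0 < y -> sqnorm (h (x +i* y)) <= k * poisson 0 1 x) -> hardy2 h.
Proof.
move=> hh k0 hk; apply: (@hardy2_le _ _ (k * pi)) => // y y0.
have mp : measurable_fun setT (poisson 0 1 : R -> R).
  by apply: continuous_measurable_fun; exact: poisson_continuous.
apply: (@le_trans _ _ (\int[leb]_x (k%:E * (poisson 0 1 x)%:E))%E).
  apply: ge0_le_integral => //.
  - by move=> x _; rewrite lee_fin sqnorm_ge0.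
  - by apply/measurable_EFinP; exact: sqnorm_horiz_measurable.
  - by apply: measurable_funeM; apply/measurable_EFinP.
  - by move=> x _; rewrite -EFinM lee_fin hk.
rewrite ge0_integralZl_EFin //; first last.
- exact/measurable_EFinP.
- by move=> x _; rewrite lee_fin poisson_ge0.
by rewrite integral_poisson // divr1 -EFinM.
Qed.

Lemma hardy2_contraction p (h g : C -> 'cV[C]_p) : hardy2 h ->
  holomorphic_on (@upper_half_plane R) g ->
  (forall z, 0 < Im z -> sqnorm (g z) <= sqnorm (h z)) -> hardy2 g.
Proof.
move=> hh gh gle; have [M hM] := hardy2_bound hh; have [hhol _] := hh.
apply: (@hardy2_le _ _ M) => // y y0; apply: le_trans (hM y y0).
apply: ge0_le_integral => //.
- by move=> x _; rewrite lee_fin sqnorm_ge0.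
- by apply/measurable_EFinP; exact: sqnorm_horiz_measurable.
- by apply/measurable_EFinP; exact: sqnorm_horiz_measurable.
- by move=> x _; rewrite lee_fin gle.
Qed.

End HardySpace.

(** * Positive definite matrices and their square roots *)

Section PositiveDefinite.
Variable R : realType.
Local Notation C := R[i].

Lemma ctM m n p (A : 'M[C]_(m, n)) (B : 'M[C]_(n, p)) :
  (A *m B)^t* = B^t* *m A^t*.
Proof. by rewrite trmx_mul map_mxM. Qed.

Lemma ctB m n (A B : 'M[C]_(m, n)) : (A - B)^t* = A^t* - B^t*.
Proof. by rewrite linearB map_mxB. Qed.

Lemma ctZ m n (k : C) (A : 'M[C]_(m, n)) : (k *: A)^t* = k^* *: A^t*.
Proof. by rewrite linearZ /= map_mxZ. Qed.

Lemma ct_inv n (A : 'M[C]_n) : (invmx A)^t* = invmx (A^t*).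
Proof. by rewrite trmx_inv map_invmx. Qed.

Lemma ct0 m n : (0 : 'M[C]_(m, n))^t* = 0.
Proof. by rewrite trmx0 map_mx0. Qed.

Lemma ct_eq0 m n (A : 'M[C]_(m, n)) : (A^t* == 0) = (A == 0).
Proof.
apply/eqP/eqP => [h|->]; last exact: ct0.
by rewrite -[A]trmxCK h ct0.
Qed.

Lemma posdef_ct n (A : 'M[C]_n) : posdefmx A -> A^t* = A.
Proof. by move=> [/is_hermitianmxP /= h _]; rewrite [RHS]h expr0 scale1r. Qed.

Lemma herm_ct n (A : 'M[C]_n) : A^t* = A -> A \is hermsymmx.
Proof. by move=> h; apply/is_hermitianmxP; rewrite /= expr0 scale1r h. Qed.

Lemma posdef_ge0 n (A : 'M[C]_n) (x : 'cV[C]_n) : posdefmx A ->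
  0 <= (x^t* *m A *m x) 0 0.
Proof.
move=> [_ pA]; have [->|/pA /ltW //] := eqVneq x 0.
by rewrite mulmx0 mxE.
Qed.

Lemma posdef_eq0 n (A : 'M[C]_n) (x : 'cV[C]_n) : posdefmx A ->
  x^t* *m A *m x = 0 -> x = 0.
Proof.
move=> [_ pA] h; apply/eqP; apply/negPn/negP => /pA.
by rewrite h mxE ltxx.
Qed.

Lemma posdef_unit n (A : 'M[C]_n) : posdefmx A -> A \in unitmx.
Proof.
move=> pA; rewrite unitmxE unitfE; apply/negP => /det0P[v v0 vA].
have := @posdef_eq0 _ A (v^t*) pA.
rewrite trmxCK vA mul0mx => /(_ erefl) /eqP.
by rewrite ct_eq0 (negbTE v0).
Qed.

Lemma posdef_congr m n (A : 'M[C]_m) (B : 'M[C]_(m, n)) : posdefmx A ->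
  (forall x : 'cV_n, B *m x = 0 -> x = 0) -> posdefmx (B^t* *m A *m B).
Proof.
move=> pA Binj; split.
  by apply: herm_ct; rewrite !ctM trmxCK (posdef_ct pA) mulmxA.
move=> x x0; have -> : x^t* *m (B^t* *m A *m B) *m x = (B *m x)^t* *m A *m (B *m x).
  by rewrite ctM !mulmxA.
by apply: pA.2; apply/eqP => /Binj /eqP; rewrite (negbTE x0).
Qed.

Lemma posdef_inv n (A : 'M[C]_n) : posdefmx A -> posdefmx (invmx A).
Proof.
move=> pA; have uA := posdef_unit pA.
have -> : invmx A = (invmx A)^t* *m A *m invmx A.
  by rewrite ct_inv (posdef_ct pA) mulVmx // mul1mx.
apply: posdef_congr => // x h.
by rewrite -[x]mul1mx -(mulmxV uA) -mulmxA h mulmx0.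
Qed.

Lemma posdefZ n (A : 'M[C]_n) (k : C) : 0 < k -> posdefmx A -> posdefmx (k *: A).
Proof.
move=> k0 pA; split.
  by apply: herm_ct; rewrite ctZ (posdef_ct pA) geC0_conj // ltW.
move=> x x0; rewrite -scalemxAr -scalemxAl mxE mulr_gt0 //; exact: pA.2.
Qed.

Lemma diag_form n (d : 'rV[C]_n) (x : 'cV[C]_n) :
  (x^t* *m diag_mx d *m x) 0 0 = \sum_i d 0 i * `|x i 0| ^+ 2.
Proof.
rewrite -mulmxA mxE; apply: eq_bigr => i _.
by rewrite mul_diag_mx !mxE normCK; ring.
Qed.

Lemma posdef_sqrt_exists n (A : 'M[C]_n) : posdefmx A ->
  exists S, posdefmx S /\ S *m S = A.
Proof.
move=> pA; have nA : A \is normalmx by apply: hermitian_normalmx; case: pA.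
have [P [d [uP AE]]] : exists P d, P \is unitarymx /\ A = invmx P *m diag_mx d *m P.
  exists (spectralmx A), (spectral_diag A); split; first exact: spectral_unitarymx.
  exact/orthomx_spectralP.
have PU : P \in unitmx := unitarymx_unit uP.
have PV : invmx P = P^t* := invmx_unitary uP.
have d0 i : 0 < d 0 i.
  have [x Px] : exists x : 'cV[C]_n, P *m x = delta_mx i 0.
    by exists (invmx P *m delta_mx i 0); rewrite mulmxA mulmxV // mul1mx.
  have x0 : x != 0.
    apply/eqP => h; move: Px; rewrite h mulmx0 => /matrixP /(_ i 0).
    by rewrite !mxE !eqxx => /eqP; rewrite eq_sym oner_eq0.
  have := pA.2 x x0.
  have -> : x^t* *m A *m x = (P *m x)^t* *m diag_mx d *m (P *m x).
    by rewrite {1}AE PV (ctM P x) !mulmxA.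
  rewrite Px diag_form (bigD1 i) //= big1 => [|j ji].
    by rewrite mxE !eqxx normr1 expr1n mulr1 addr0.
  by rewrite mxE (negbTE ji) normr0 expr0n mulr0.
pose s : 'rV[C]_n := \row_i sqrtC (d 0 i).
have s0 i : 0 < s 0 i by rewrite mxE sqrtC_gt0.
pose S := P^t* *m diag_mx s *m P.
exists S; split; last first.
  have PP : P *m P^t* = 1%:M by apply/unitarymxP.
  have -> : S *m S = P^t* *m (diag_mx s *m (P *m P^t*) *m diag_mx s) *m P.
    by rewrite /S; clear; move: (P^t*) (diag_mx s) => X Y; rewrite !mulmxA.
  rewrite PP mulmx1 mulmx_diag [RHS]AE PV (_ : \row_j _ = d) //.
  by apply/rowP => i; rewrite !mxE -expr2 sqrtCK.
have pD : posdefmx (diag_mx s).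
  split.
    apply: herm_ct; rewrite tr_diag_mx map_diag_mx; congr diag_mx; apply/rowP => i.
    by rewrite [LHS]mxE; apply: geC0_conj; exact: ltW.
  move=> x x0; rewrite diag_form lt_def; apply/andP; split; last first.
    by apply: sumr_ge0 => i _; rewrite mulr_ge0 ?exprn_ge0 // ltW.
  apply: contra x0 => /eqP h; apply/eqP/colP => i; rewrite mxE.
  have := @psumr_eq0P _ _ _ _ _ h i erefl => /(_ _)/eqP.
  rewrite mulf_eq0 gt_eqF //= sqrf_eq0 normr_eq0 => hi.
  by apply/eqP; apply: hi => j _; rewrite mulr_ge0 ?exprn_ge0 // ltW.
apply: posdef_congr => // x h.
by rewrite -[x]mul1mx -(mulVmx PU) -mulmxA h mulmx0.
Qed.

Lemma mxtrace_form m n (A : 'M[C]_m) (D : 'M[C]_(m, n)) :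
  \tr (D^t* *m A *m D) = \sum_i ((col i D)^t* *m A *m col i D) 0 0.
Proof.
apply: eq_bigr => i _.
have -> : (col i D)^t* = row i (D^t*) by rewrite tr_col map_row.
rewrite -row_mul [LHS]mxE [RHS]mxE; apply: eq_bigr => k _.
by rewrite [X in _ = X * _]mxE [X in _ = _ * X]mxE.
Qed.

(** For two square roots with difference [D], [S D + D T = 0]; multiplying by [D]
    and taking traces gives [tr (D S D) + tr (D T D) = 0] with both terms
    nonnegative. *)
Lemma posdef_sqrt_unique n (S T : 'M[C]_n) : posdefmx S -> posdefmx T ->
  S *m S = T *m T -> S = T.
Proof.
move=> pS pT ST; apply/eqP; rewrite -subr_eq0; apply/eqP; set D := S - T.
have Dadj : D^t* = D by rewrite ctB !posdef_ct.
have SD : S *m D + D *m T = 0.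
  by rewrite /D mulmxBr mulmxBl ST addrA subrK subrr.
have tr0 : \tr (D^t* *m S *m D) + \tr (D^t* *m T *m D) = 0.
  have : \tr (D *m (S *m D + D *m T)) = 0 by rewrite SD mulmx0 mxtrace0.
  by rewrite mulmxDr mxtraceD Dadj mulmxA (mxtrace_mulC D (D *m T)).
have nn (A : 'M[C]_n) : posdefmx A -> 0 <= \tr (D^t* *m A *m D).
  by move=> pA; rewrite mxtrace_form sumr_ge0 // => i _; exact: posdef_ge0.
have trS : \tr (D^t* *m S *m D) = 0.
  move/eqP: tr0; rewrite (paddr_eq0 (nn S pS) (nn T pT)) => /andP[/eqP h _]; exact: h.
move: trS; rewrite mxtrace_form => trS.
apply/matrixP => i j; rewrite [RHS]mxE.
have h : (col j D)^t* *m S *m col j D = 0.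
  apply/matrixP => a b; rewrite !ord1 [RHS]mxE.
  by apply: (psumr_eq0P _ trS) => // k _; exact: posdef_ge0.
by have /colP /(_ i) := posdef_eq0 pS h; rewrite !mxE.
Qed.

Lemma invsqrtmxP n (A : 'M[C]_n) : posdefmx A ->
  exists S, [/\ posdefmx S, S *m S = A & invsqrtmx A = invmx S].
Proof.
move=> /posdef_sqrt_exists[S0 hS0].
have [h1 h2] : [set S | posdefmx S /\ S *m S = A] (xget 0 [set S | posdefmx S /\ S *m S = A]).
  exact: (xgetI 0 hS0).
by exists (xget 0 [set S | posdefmx S /\ S *m S = A]).
Qed.

Lemma invsqrtmx_sq n (A : 'M[C]_n) : posdefmx A ->
  (invsqrtmx A)^t* = invsqrtmx A /\ invsqrtmx A *m invsqrtmx A = invmx A.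
Proof.
move=> pA; have [S [pS SS ->]] := invsqrtmxP pA.
split; first by rewrite ct_inv posdef_ct.
have uS := posdef_unit pS; have uA := posdef_unit pA.
rewrite -[LHS]mulmx1 -(mulmxV uA) -{1}SS !mulmxA mulmxKV // mulVmx //.
by rewrite mul1mx.
Qed.

Lemma invsqrtmxZ n (A : 'M[C]_n) (k : C) : 0 < k -> posdefmx A ->
  invsqrtmx (k *: A) = (sqrtC k)^-1 *: invsqrtmx A.
Proof.
move=> k0 pA.
have [S [pS SS ->]] := invsqrtmxP pA.
have [T [pT TT ->]] := invsqrtmxP (posdefZ k0 pA).
have sk0 : 0 < sqrtC k by rewrite sqrtC_gt0.
have -> : T = sqrtC k *: S.
  apply: (posdef_sqrt_unique pT (posdefZ sk0 pS)).
  by rewrite TT -scalemxAl -scalemxAr scalerA -expr2 sqrtCK SS.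
by rewrite invmxZ // unitmxZ ?posdef_unit // unitfE gt_eqF.
Qed.

End PositiveDefinite.

(** * Block Hankel matrices and division of polynomials *)

Section KernelIdentity.
Variables (R : realType) (p n : nat).
Local Notation C := R[i].
Local Notation m := (\sum_(i < n.+1) p)%N.

(** Coefficient vectors are indexed by all naturals, so that multiplication by
    the variable is the shift of the index. *)
Definition vecn (T : nat -> 'cV[C]_p) : 'cV[C]_m := \mxcol_(k < n.+1) T k.

Definition shiftn (T : nat -> 'cV[C]_p) k := if k is k'.+1 then T k' else 0.

Definition coefn (u : 'cV[C]_m) (k : nat) : 'cV[C]_p := submxcol u (inord k).

Lemma coefnK u : vecn (coefn u) = u.
Proof.
rewrite -[RHS]submxcolK; apply: eq_mxcol => k.
by rewrite /coefn inord_val.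
Qed.

Lemma vecnB T U : vecn (fun k => T k - U k) = vecn T - vecn U.
Proof. exact: mxcolB. Qed.
Lemma vecnZ (a : C) T : vecn (fun k => a *: T k) = a *: vecn T.
Proof.
rewrite -mul_scalar_mx -[RHS](submxcolK) /=.
rewrite -[LHS]submxcolK; apply: eq_mxcol => k.
by rewrite mul_scalar_mx; apply/matrixP => i j; rewrite !mxE.
Qed.

Lemma Fmx_vecn z T : Fmx p n z *m vecn T = \sum_(k < n.+1) z ^+ k *: T k.
Proof.
rewrite /Fmx /vecn mul_mxrow_mxcol; apply: eq_bigr => k _.
by rewrite mul_scalar_mx.
Qed.

Lemma Fmx_shiftn z T : T n = 0 -> Fmx p n z *m vecn (shiftn T) = z *: (Fmx p n z *m vecn T).
Proof.
move=> Tn; rewrite !Fmx_vecn big_ord_recl scaler0 add0r [in RHS]big_ord_recr /=.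
rewrite Tn scaler0 addr0 scaler_sumr; apply: eq_bigr => k _.
by rewrite scalerA -exprS.
Qed.

Lemma Fmx_ctE (w : C) (v : 'cV[C]_p) :
  (Fmx p n w)^t* *m v = vecn (fun k => (w^*%C) ^+ k *: v) :> 'cV_m.
Proof.
rewrite /Fmx tr_mxrow /vecn.
have -> : map_mx Num.conj (\mxcol_(i < n.+1) ((w ^+ i)%:M : 'M[C]_p)^T) =
      \mxcol_(i < n.+1) (((w^*%C) ^+ i)%:M : 'M[C]_p).
  by apply/matrixP => i j; rewrite !mxE -rmorphXn rmorphMn /= eq_sym.
rewrite mxcol_mul; apply: eq_mxcol => k.
by rewrite mul_scalar_mx.
Qed.

Lemma Fmx_ct_inj w (x : 'cV[C]_p) : (Fmx p n w)^t* *m x = 0 -> x = 0.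
Proof.
rewrite Fmx_ctE => /(congr1 (fun u => submxcol u (ord0 : 'I_n.+1))).
by rewrite /vecn mxcolK submxcol0 expr0 scale1r.
Qed.

(** Synthetic division by [lambda - b]. *)
Lemma Fmx_root b (u : 'cV[C]_m) : Fmx p n b *m u = 0 ->
  exists2 T, T n = 0 & u = vecn (shiftn T) - b *: vecn T.
Proof.
rewrite -[u]coefnK Fmx_vecn; set U := coefn u => Fu.
pose T (k : nat) := \sum_(j < n.+1 | (k < j)%N) b ^+ (j - k.+1) *: U j.
exists T.
  by rewrite /T big_pred0 // => j; rewrite ltnNge -ltnS ltn_ord.
rewrite -vecnZ -vecnB; apply: eq_mxcol => -[[|k] hk] /=.
  rewrite sub0r /T scaler_sumr; move/eqP: Fu; rewrite big_ord_recl expr0 scale1r addr_eq0.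
  move=> /eqP ->; congr (- _); rewrite [RHS]big_mkcond [RHS]big_ord_recl /= add0r.
  apply: eq_bigr => j _; rewrite /= /bump /= add1n scalerA -exprS.
  by rewrite subn1.
rewrite /T (bigD1 (Ordinal hk)) //= subnn expr0 scale1r -[LHS]addr0 -addrA; congr (_ + _).
rewrite scaler_sumr; apply/esym/eqP; rewrite subr_eq0; apply/eqP.
apply: eq_big => [j|j /andP[kj jk]].
  by rewrite [in RHS]ltn_neqAle andbC; congr (_ && _); rewrite eq_sym -val_eqE.
rewrite scalerA -exprS; congr (_ ^+ _ *: _); rewrite subnSK //.
by rewrite ltn_neqAle kj andbT eq_sym -(inj_eq val_inj) in jk *.
Qed.

Lemma mx_eq_col r k (A B : 'M[C]_(r, k)) :
  (forall c : 'cV[C]_k, A *m c = B *m c) -> A = B.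
Proof.
move=> h; apply/matrixP => i j; have := h (delta_mx j 0).
by rewrite -!colE => /matrixP /(_ i 0); rewrite !mxE.
Qed.

Lemma mx_eq_scale r k l (x y : C) (A B : 'M[C]_(r, k)) (P Q : 'M[C]_(k, l)) :
  (forall c : 'cV[C]_l, x *: (A *m (P *m c)) = y *: (B *m (Q *m c))) ->
  x *: (A *m P) = y *: (B *m Q).
Proof. by move=> h; apply: mx_eq_col => c; rewrite -!scalemxAl -!mulmxA. Qed.

Section Hankel.
Variable G : 'M[C]_m.
Hypothesis pG : posdefmx G.
Local Notation Gamma := (invmx G).
Local Notation F := (Fmx p n).

Definition ip (v u : 'cV[C]_m) : 'M[C]_1 := v^t* *m G *m u.

Lemma ipBl a b u : ip (a - b) u = ip a u - ip b u.
Proof. by rewrite /ip ctB !mulmxBl. Qed.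
Lemma ipBr a b u : ip u (a - b) = ip u a - ip u b.
Proof. by rewrite /ip mulmxBr. Qed.
Lemma ipZl k a u : ip (k *: a) u = k^*%C *: ip a u.
Proof. by rewrite /ip ctZ -!scalemxAl. Qed.
Lemma ipZr k a u : ip u (k *: a) = k *: ip u a.
Proof. by rewrite /ip -scalemxAr. Qed.

Lemma ip_vecn S T : ip (vecn S) (vecn T) =
  \sum_(k < n.+1) \sum_(l < n.+1) (S k)^t* *m submxblock G k l *m T l.
Proof.
rewrite /ip /vecn tr_mxcol -[G in LHS]submxblockK.
have -> : map_mx Num.conj (\mxrow_(i < n.+1) (S i)^T) = \mxrow_(i < n.+1) (S i)^t*.
  by apply/matrixP => i j; rewrite !mxE.
rewrite mul_mxrow_mxblock mul_mxrow_mxcol exchange_big /=; apply: eq_bigr => l _.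
by rewrite mulmx_suml.
Qed.

Lemma ip_shift (a b : C) t t' s s' : a^*%C = b -> b^*%C = a ->
  ip t' s = ip t s' -> ip (t' - b *: t) (s' - b *: s) = ip (t' - a *: t) (s' - a *: s).
Proof.
move=> ab ba h.
have E (x y : C) : ip (t' - x *: t) (s' - y *: s) =
    ip t' s' - y *: ip t s' - (x^*%C *: ip t s' - (x^*%C * y) *: ip t s).
  by rewrite ipBl (ipBr s') ipZr h ipZl (ipBr s' (y *: s) t) ipZr scalerBr scalerA.
rewrite (E b b) (E a a) ab ba; move: (ip t' s') (ip t s') (ip t s) => X Y Z.
by apply/matrixP => i j; rewrite !mxE; ring.
Qed.

Hypothesis hankG : block_hankel G.

(** Multiplication by the variable is symmetric: shifting the row index or the
    column index of a block gives the same block. *)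
Lemma hankel_shift S T : S n = 0 -> T n = 0 ->
  ip (vecn (shiftn S)) (vecn T) = ip (vecn S) (vecn (shiftn T)).
Proof.
move=> Sn Tn; rewrite !ip_vecn.
rewrite big_ord_recl big1 => [|l _]; last by rewrite /= ct0 !mul0mx.
rewrite add0r [RHS]big_ord_recr /= [X in _ + X]big1 => [|l _]; last first.
  by rewrite Sn ct0 !mul0mx.
rewrite addr0; apply: eq_bigr => k _.
rewrite big_ord_recr /= Tn mulmx0 addr0 [RHS]big_ord_recl /= mulmx0 add0r.
apply: eq_bigr => l _.
have E : submxblock G (lift ord0 k) (widen_ord (leqnSn n) l) =
    submxblock G (widen_ord (leqnSn n) k) (lift ord0 l).
  by apply: hankG; rewrite /= /bump /= !add1n addSn addnS.
by rewrite E.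
Qed.

Definition Kmx (z w : C) : 'M[C]_p := F z *m Gamma *m (F w)^t*.

Lemma KmxE z w : Kmx z w = F z *m Gamma *m (F w)^t*. Proof. by []. Qed.

Let uG : G \in unitmx. Proof. exact: posdef_unit. Qed.

Let Gam_ct : Gamma^t* = Gamma. Proof. by apply: posdef_ct; exact: posdef_inv. Qed.

Lemma Kmx_posdef w : posdefmx (Kmx w w).
Proof.
have -> : Kmx w w = ((F w)^t*)^t* *m Gamma *m (F w)^t* by rewrite trmxCK.
by apply: posdef_congr; [exact: posdef_inv|exact: (@Fmx_ct_inj w)].
Qed.

Lemma Kmx_ct z w : (Kmx z w)^t* = Kmx w z.
Proof. by rewrite /Kmx !ctM trmxCK Gam_ct mulmxA. Qed.

(** Division by [z - a] and multiplication by [z - conj a] is an isometry between the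
    subspaces of polynomials vanishing at [a] and at [conj a], because
    multiplication by the variable is symmetric for a block Hankel Gram matrix;
    so it relates the reproducing kernels [ua] and [ub] of these subspaces. *)
Lemma division_isometry (a w z : C) (c : 'cV[C]_p) (ua ub : 'cV[C]_m) :
  F a *m ua = 0 -> F a^*%C *m ub = 0 ->
  (forall s, F a *m s = 0 -> ip ua s = c^t* *m (F w *m s)) ->
  (forall s, F a^*%C *m s = 0 -> ip ub s = c^t* *m (F w *m s)) ->
  ((z - a^*%C) * (w^*%C - a)) *: (F z *m ua) =
  ((z - a) * (w^*%C - a^*%C)) *: (F z *m ub).
Proof.
set ac := a^*%C; set wc := w^*%C => Fua Fub ra rb.
have [T Tn uaE] := Fmx_root Fua.
pose q := vecn (shiftn T) - ac *: vecn T.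
have Fq y : F y *m q = (y - ac) *: (F y *m vecn T).
  by rewrite mulmxBr Fmx_shiftn // -scalemxAr scalerBl.
(* [q] is the image of [ua] under the isometry; the claim is that the multiples
   of [q] and [ub] agree, and [d] is shown to have norm zero. *)
pose d := (wc - a) *: q - (wc - ac) *: ub.
have Fd : F ac *m d = 0.
  by rewrite mulmxBr -!scalemxAr Fq subrr scale0r Fub !scaler0 subrr.
have [S Sn dE] := Fmx_root Fd.
pose e := vecn (shiftn S) - a *: vecn S.
have Fe y : F y *m e = (y - a) *: (F y *m vecn S).
  by rewrite mulmxBr Fmx_shiftn // -scalemxAr scalerBl.
have Fdy y : F y *m d = (y - ac) *: (F y *m vecn S).
  by rewrite dE mulmxBr Fmx_shiftn // -scalemxAr scalerBl.
have acc : ac^*%C = a by exact: conjcK.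
have iso : ip q d = ip ua e.
  by rewrite dE uaE; apply: ip_shift => //; exact: hankel_shift.
have X1 : ip ua e = (w - a) *: (c^t* *m (F w *m vecn S)).
  have Fae : F a *m e = 0 by rewrite Fe subrr scale0r.
  by rewrite (ra _ Fae) Fe -scalemxAr.
have X2 : ip ub d = (w - ac) *: (c^t* *m (F w *m vecn S)).
  by rewrite (rb _ Fd) Fdy -scalemxAr.
have d0 : d = 0.
  apply: (posdef_eq0 pG); rewrite -/(ip d d).
  have -> : ip d d = ip ((wc - a) *: q - (wc - ac) *: ub) d by [].
  rewrite ipBl !ipZl iso X1 X2.
  have -> : (wc - a)^*%C = w - ac by rewrite rmorphB /= [wc^*%C]conjcK.
  have -> : (wc - ac)^*%C = w - a by rewrite rmorphB /= acc [wc^*%C]conjcK.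
  by rewrite !scalerA [(w - ac) * _]mulrC subrr.
have : (wc - a) *: q = (wc - ac) *: ub by apply/eqP; rewrite -subr_eq0 -/d d0.
move=> /(congr1 (fun u => F z *m u)); rewrite -!scalemxAr Fq => key.
have Fz : F z *m ua = (z - a) *: (F z *m vecn T).
  by rewrite uaE mulmxBr Fmx_shiftn // -scalemxAr scalerBl.
rewrite Fz -[RHS]scalerA -key !scalerA; congr (_ *: _).
by ring.
Qed.

(** [P] spans the reproducing kernel, at the functional [Fw], of the subspace
    killed by [Fb]. *)
Lemma subspace_kernel (Fb Fw : 'M[C]_(p, m)) :
  Fb *m Gamma *m Fb^t* \in unitmx -> exists P : 'M[C]_(m, p),
  [/\ forall X : 'M[C]_(p, m), X *m P = X *m Gamma *m Fw^t* - X *m Gamma *m Fb^t*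
        *m invmx (Fb *m Gamma *m Fb^t*) *m (Fb *m Gamma *m Fw^t*),
      Fb *m P = 0
    & forall (c : 'cV[C]_p) s, Fb *m s = 0 -> ip (P *m c) s = c^t* *m (Fw *m s)].
Proof.
set K := Fb *m Gamma *m Fb^t* => uK.
have Kct : K^t* = K by rewrite /K !ctM trmxCK Gam_ct mulmxA.
have KE : Fb *m Gamma *m Fb^t* = K by [].
clearbody K.
have GG r (X : 'M[C]_(r, m)) : X *m Gamma *m G = X by rewrite mulmxKV.
exists (Gamma *m Fw^t* - Gamma *m Fb^t* *m invmx K *m (Fb *m Gamma *m Fw^t*)).
have PE (X : 'M[C]_(p, m)) :
  X *m (Gamma *m Fw^t* - Gamma *m Fb^t* *m invmx K *m (Fb *m Gamma *m Fw^t*)) =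
  X *m Gamma *m Fw^t* - X *m Gamma *m Fb^t* *m invmx K *m (Fb *m Gamma *m Fw^t*).
  by rewrite mulmxBr !mulmxA.
split=> // [|c s Fs]; first by rewrite PE KE mulmxV // mul1mx subrr.
rewrite /ip; have -> : ((Gamma *m Fw^t* - Gamma *m Fb^t* *m invmx K *m (Fb *m Gamma *m Fw^t*)) *m c)^t* =
    c^t* *m (Fw - Fw *m Gamma *m Fb^t* *m invmx K *m Fb) *m Gamma.
  rewrite (ctM (_ - _)) ctB !ctM (ct_inv K) Kct Gam_ct !trmxCK.
  move: (c^t*) (Fb^t*) (invmx K) => c' Fb' K'.
  by rewrite -[RHS]mulmxA [in RHS]mulmxBl !mulmxA.
rewrite GG -mulmxA mulmxBl -(mulmxA _ Fb) Fs mulmx0 subr0.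
by [].
Qed.

(** [subspace_kernel] at [a] and at its conjugate, compared by
    [division_isometry]. *)
Lemma kernel_isometry (a z w : C) :
  ((z - a^*%C) * (w^*%C - a)) *: (Kmx z w - Kmx z a *m invmx (Kmx a a) *m Kmx a w) =
  ((z - a) * (w^*%C - a^*%C)) *: (Kmx z w -
     Kmx z a^*%C *m invmx (Kmx a^*%C a^*%C) *m Kmx a^*%C w).
Proof.
have uK b : Kmx b b \in unitmx by apply: posdef_unit; exact: Kmx_posdef.
have [P [PE P0 Pr]] := subspace_kernel (F w) (uK a).
have [Q [QE Q0 Qr]] := subspace_kernel (F w) (uK a^*%C).
have PEz : F z *m P = Kmx z w - Kmx z a *m invmx (Kmx a a) *m Kmx a w := PE (F z).
have QEz : F z *m Q = Kmx z w - Kmx z a^*%C *m invmx (Kmx a^*%C a^*%C) *m Kmx a^*%C w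
  := QE (F z).
suff H : ((z - a^*%C) * (w^*%C - a)) *: (F z *m P) =
         ((z - a) * (w^*%C - a^*%C)) *: (F z *m Q).
  by move: H; rewrite PEz QEz.
apply: mx_eq_scale => c.
have P0c : F a *m (P *m c) = 0 by rewrite mulmxA P0 mul0mx.
have Q0c : F a^*%C *m (Q *m c) = 0 by rewrite mulmxA Q0 mul0mx.
exact: (division_isometry z P0c Q0c (Pr c) (Qr c)).
Qed.

End Hankel.
End KernelIdentity.

(** * The kernel formula *)

Section KernelFormula.
Variables (R : realType) (p n : nat).
Local Notation C := R[i].
Local Notation m := (\sum_(i < n.+1) p)%N.

Lemma rhoE (w z : C) : rho w z = - (2 * pi)%:C * 'i%C * (z - w^*%C).
Proof.
rewrite /rho; congr (_ * _ * _); apply/eqP; rewrite eq_complex /=.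
by apply/andP; split; apply/eqP; ring.
Qed.

Lemma rho_diag (a : C) : rho a a = (4 * pi * Im a)%:C.
Proof.
rewrite rhoE; case: a => x y; apply/eqP; rewrite eq_complex /=.
by apply/andP; split; apply/eqP; ring.
Qed.

Lemma rho_diag_gt0 (a : C) : 0 < Im a -> 0 < rho a a.
Proof. by move=> a0; rewrite rho_diag ltcR !mulr_gt0 ?pi_gt0. Qed.

Lemma rho_mul (a z w : C) : rho a z * (rho a w)^*%C =
  (4 * pi ^+ 2)%:C * ((z - a^*%C) * (w^*%C - a)).
Proof.
rewrite !rhoE; case: a => x y; case: z => z1 z2; case: w => w1 w2.
by apply/eqP; rewrite eq_complex /=; apply/andP; split; apply/eqP; ring.
Qed.

Lemma rho_mulC (a z w : C) : rho a^*%C z * (rho a^*%C w)^*%C =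
  (4 * pi ^+ 2)%:C * ((z - a) * (w^*%C - a^*%C)).
Proof. by rewrite rho_mul conjcK. Qed.

Lemma rho_comb (a z w : C) :
  (4 * pi ^+ 2)%:C * ((z - a^*%C) * (w^*%C - a) - (z - a) * (w^*%C - a^*%C)) =
  rho a a * rho w z.
Proof.
rewrite !rhoE; case: a => x y; case: z => z1 z2; case: w => w1 w2.
by apply/eqP; rewrite eq_complex /=; apply/andP; split; apply/eqP; ring.
Qed.

Lemma invsqrtmx_sandwich (X Y K : 'M[C]_p) (k : C) : 0 < k -> posdefmx K ->
  (X *m invsqrtmx (k *: K)) *m (Y *m invsqrtmx (k *: K))^t* =
  k^-1 *: (X *m invmx K *m Y^t*).
Proof.
move=> k0 pK; have [Nct NN] := invsqrtmx_sq (posdefZ k0 pK).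
move: (invsqrtmx _) Nct NN => N Nct NN.
rewrite (ctM Y) Nct -mulmxA (mulmxA N) NN.
have -> : invmx (k *: K) = k^-1 *: invmx K.
  by rewrite invmxZ // ?unitfE ?gt_eqF // unitmxZ ?unitfE ?gt_eqF // posdef_unit.
by rewrite -scalemxAl -scalemxAr mulmxA.
Qed.

Lemma scale_mul_ct (x y : C) (X Y : 'M[C]_p) :
  (x *: X) *m (y *: Y)^t* = (x * y^*%C) *: (X *m Y^t*).
Proof. by rewrite ctZ -scalemxAl -scalemxAr scalerA. Qed.

Lemma kernel_combination (k r c s t : C) (A B L X Y : 'M[C]_p) :
  X = (c * s / k) *: A -> Y = (c * t / k) *: B ->
  s *: (L - A) = t *: (L - B) -> c * (s - t) = k * r -> k != 0 ->
  X - Y = r *: L.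
Proof.
move=> -> -> iso comb k1.
have -> : (c * s / k) *: A - (c * t / k) *: B = (c / k) *: (s *: A - t *: B).
  by rewrite scalerBr !scalerA; congr (_ *: _ - _ *: _); rewrite mulrAC.
have -> : s *: A - t *: B = (s - t) *: L.
  apply/matrixP => i j; move/matrixP: iso => /(_ i j); rewrite !mxE => iso.
  have -> : s * A i j = s * L i j - s * (L i j - A i j) by ring.
  by rewrite iso; ring.
by rewrite scalerA mulrAC comb mulrAC mulfV // mul1r.
Qed.

Variable G : 'M[C]_m.
Hypotheses (pG : posdefmx G) (hankG : block_hankel G).
Local Notation Gamma := (invmx G).
Local Notation F := (Fmx p n).
Local Notation K := (Kmx G).

Definition Eblock (k : C) (b z : C) : 'M[C]_p :=
  rho b z *: (F z *m Gamma *m (F b)^t* *m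
    invsqrtmx (k *: (F b *m Gamma *m (F b)^t*))).

Lemma EblockE k b z : Eblock k b z = rho b z *: (K z b *m invsqrtmx (k *: K b b)).
Proof. by []. Qed.

Lemma Eblock_mul k b z w : 0 < k -> Eblock k b z *m (Eblock k b w)^t* =
  (rho b z * (rho b w)^*%C / k) *: (K z b *m invmx (K b b) *m K b w).
Proof.
move=> k0; rewrite !EblockE scale_mul_ct (invsqrtmx_sandwich _ _ k0 (Kmx_posdef pG b)).
by rewrite scalerA (Kmx_ct pG w b).
Qed.

(** The subtracted terms of the two subspace kernels in [kernel_isometry] are,
    up to the scalars [rho], the two terms of the kernel of the de Branges space. *)
Lemma kernel_formula (a z w : C) : 0 < Im a ->
  Eblock (rho a a) a z *m (Eblock (rho a a) a w)^t* -
  Eblock (rho a a) a^*%C z *m (Eblock (rho a a) a^*%C w)^t* = rho w z *: K z w.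
Proof.
move=> /rho_diag_gt0 k0.
apply: (kernel_combination (k := rho a a) (c := (4 * pi ^+ 2)%:C)
  (s := (z - a^*%C) * (w^*%C - a)) (t := (z - a) * (w^*%C - a^*%C))
  (A := K z a *m invmx (K a a) *m K a w)
  (B := K z a^*%C *m invmx (K a^*%C a^*%C) *m K a^*%C w)).
- by rewrite (Eblock_mul a z w k0) rho_mul.
- by rewrite (Eblock_mul a^*%C z w k0) rho_mulC.
- exact: kernel_isometry.
- exact: rho_comb.
- by rewrite gt_eqF.
Qed.
End KernelFormula.

(** * Polynomials as sums of kernels *)

Section Spanning.
Variables (R : realType) (p n : nat).
Local Notation C := R[i].
Local Notation m := (\sum_(i < n.+1) p)%N.
Local Notation F := (Fmx p n).

Definition node (j : nat) : C := 0 +i* j.+1%:R.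

Lemma node_gt0 j : 0 < Im (node j). Proof. by rewrite /= ltr0n. Qed.

Lemma node_vandermonde : Vandermonde n.+1 (\row_(j < n.+1) (node j)^*%C) \in unitmx.
Proof.
rewrite unitmxE det_Vandermonde unitfE; apply/prodf_neq0 => i _.
apply/prodf_neq0 => j ij; rewrite !mxE subr_eq0 eq_sym /node eq_complex /= eqxx /=.
by rewrite eqr_opp eqr_nat eqSS ltn_eqF.
Qed.

(** The evaluations at [n.+1] distinct points span, by Vandermonde. *)
Lemma Fmx_span (u : 'cV[C]_m) : exists v : 'I_n.+1 -> 'cV[C]_p,
  u = \sum_(j < n.+1) (F (node j))^t* *m v j.
Proof.
set V := Vandermonde n.+1 (\row_(j < n.+1) (node j)^*%C).
pose v (j : 'I_n.+1) := \sum_(l < n.+1) invmx V j l *: coefn u l.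
exists v; rewrite -[LHS]coefnK.
have vecn_sum (T : 'I_n.+1 -> nat -> 'cV[C]_p) :
    \sum_j vecn n (T j) = vecn n (fun k => \sum_j T j k) :> 'cV_m.
  by rewrite /vecn mxcol_sum.
transitivity (\sum_(j < n.+1) vecn n (fun k => (node j)^*%C ^+ k *: v j)); last first.
  by apply: eq_bigr => j _; rewrite Fmx_ctE.
rewrite vecn_sum; apply: eq_mxcol => k.
have -> : \sum_(j < n.+1) (node j)^*%C ^+ k *: v j =
    \sum_(l < n.+1) (V *m invmx V) k l *: coefn u l.
  under eq_bigr do rewrite scaler_sumr.
  rewrite exchange_big /=; apply: eq_bigr => l _.
  by rewrite mxE scaler_suml; apply: eq_bigr => j _; rewrite scalerA !mxE.
rewrite mulmxV ?node_vandermonde // (bigD1 k) //= big1 => [|j jk].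
  by rewrite mxE eqxx scale1r addr0.
by rewrite mxE eq_sym (negbTE jk) scale0r.
Qed.

Variable G : 'M[C]_m.
Hypothesis pG : posdefmx G.

(** The summands are the coefficient vectors of the kernels at the nodes. *)
Lemma kernel_span (u : 'cV[C]_m) : exists v : 'I_n.+1 -> 'cV[C]_p,
  u = \sum_(j < n.+1) invmx G *m ((F (node j))^t* *m v j).
Proof.
have [v vE] := Fmx_span (G *m u); exists v.
by rewrite -mulmx_sumr -vE mulKmx // posdef_unit.
Qed.

Lemma kernel_total z (x : 'cV[C]_p) :
  (forall w, 0 < Im w -> x^t* *m Kmx G z w = 0) -> x = 0.
Proof.
move=> h; apply: (@Fmx_ct_inj _ _ n z).
suff xF : x^t* *m F z = 0 by apply/eqP; rewrite -ct_eq0 (ctM _ x) trmxCK xF.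
apply: mx_eq_col => u; rewrite mul0mx.
have [v ->] := kernel_span u; rewrite mulmx_sumr big1 // => j _.
have := h _ (node_gt0 j); rewrite KmxE !mulmxA => -> .
by rewrite mul0mx.
Qed.

Lemma Fmx_upper_inj (u : 'cV[C]_m) : (forall w, 0 < Im w -> F w *m u = 0) -> u = 0.
Proof.
move=> h; apply: (posdef_eq0 pG).
have [v uE] := kernel_span u.
rewrite -mulmxA; rewrite [in X in X *m _]uE.
have -> : (\sum_(j < n.+1) invmx G *m ((F (node j))^t* *m v j))^t* =
    \sum_(j < n.+1) ((v j)^t* *m F (node j)) *m invmx G.
  rewrite linear_sum /= map_mx_sum; apply: eq_bigr => j _.
  by rewrite (ctM (invmx G)) (ctM _ (v j)) trmxCK (posdef_ct (posdef_inv pG)).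
rewrite mulmx_suml big1 // => j _.
by rewrite mulmxA mulmxKV ?posdef_unit // -mulmxA h ?mulmx0 // node_gt0.
Qed.
End Spanning.

(** * Consequences of the kernel formula *)

Section KernelBounds.
Variables (R : realType) (p : nat).
Local Notation C := R[i].

Lemma sqnormE k (v : 'cV[C]_k) : (v^t* *m v) 0 0 = (sqnorm v)%:C.
Proof.
rewrite mxE sqnorm_sqmod rmorph_sum; apply: eq_bigr => i _; rewrite !mxE.
by case: (v i 0) => x y; apply/eqP; rewrite eq_complex /sqmod /=; apply/andP; split;
  apply/eqP; ring.
Qed.

Lemma sqnormZ k c (v : 'cV[C]_k) : sqnorm (c *: v) = sqmod c * sqnorm v.
Proof.
by rewrite !sqnorm_sqmod mulr_sumr; apply: eq_bigr => i _; rewrite mxE sqmodM.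
Qed.

Lemma sqnormD_le k (u v : 'cV[C]_k) : sqnorm (u + v) <= 2 * sqnorm u + 2 * sqnorm v.
Proof.
rewrite !sqnorm_sqmod !mulr_sumr -big_split /=; apply: ler_sum => i _.
by rewrite mxE sqmodD_le.
Qed.

Lemma sqnormN k (u : 'cV[C]_k) : sqnorm (- u) = sqnorm u.
Proof. by rewrite !sqnorm_sqmod; apply: eq_bigr => i _; rewrite mxE sqmodN. Qed.

Lemma sqnorm0 k : sqnorm (0 : 'cV[C]_k) = 0.
Proof. by rewrite sqnorm_sqmod big1 // => i _; rewrite mxE /sqmod /= expr0n addr0. Qed.

(** The adjoint of a contraction is a contraction: apply the bound to [A v] and
    use [2 |(A v)^* (A v)| <= |A^* A v| ^ 2 + |v| ^ 2]. *)
Lemma ct_contraction k (A : 'M[C]_k) :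
  (forall v : 'cV_k, sqnorm (A^t* *m v) <= sqnorm v) ->
  forall v : 'cV_k, sqnorm (A *m v) <= sqnorm v.
Proof.
move=> h v; have hA := h (A *m v).
set u := A^t* *m (A *m v) in hA.
have E : (v^t* *m u) 0 0 = (sqnorm (A *m v))%:C by rewrite -sqnormE ctM !mulmxA.
have E' : (u^t* *m v) 0 0 = (sqnorm (A *m v))%:C.
  by rewrite -sqnormE (ctM _ (A *m v)) trmxCK mulmxA.
have : 0 <= sqnorm (v - u) by exact: sqnorm_ge0.
suff -> : sqnorm (v - u) = sqnorm v + sqnorm u - 2 * sqnorm (A *m v).
  by move: hA; lra.
apply: complexI; rewrite rmorphB rmorphD rmorphM (rmorph_nat _ 2) /= -(sqnormE (v - u)) -(sqnormE v) -(sqnormE u) ctB mulmxBl !mulmxBr.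
move: (v^t* *m v) (v^t* *m u) (u^t* *m v) (u^t* *m u) E E' => w1 w2 w3 w4 E E'.
by rewrite !mxE E E'; ring.
Qed.
End KernelBounds.

Section Structure.
Variables (R : realType) (p : nat).
Local Notation C := R[i].
Variables (Ep Em : C -> 'M[C]_p) (K : C -> C -> 'M[C]_p).
Hypothesis kerE : forall z w, Ep z *m (Ep w)^t* - Em z *m (Em w)^t* = rho w z *: K z w.
Hypothesis K_posdef : forall z, posdefmx (K z z).
Hypothesis K_total : forall z (x : 'cV[C]_p),
  (forall w, 0 < Im w -> x^t* *m K z w = 0) -> x = 0.

Let diag z (v : 'cV[C]_p) :
  (sqnorm ((Ep z)^t* *m v) - sqnorm ((Em z)^t* *m v))%:C =
  (4 * pi * Im z)%:C * (v^t* *m K z z *m v) 0 0.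
Proof.
have E (A : 'M[C]_p) : (sqnorm (A^t* *m v))%:C = (v^t* *m (A *m A^t*) *m v) 0 0.
  by rewrite -sqnormE ctM trmxCK !mulmxA.
rewrite rmorphB /= (E (Ep z)) (E (Em z)) -rho_diag; have := kerE z z.
move: (Ep z *m _) (Em z *m _) (rho z z) (K z z) => X Y r k XY.
have -> : X = r *: k + Y by rewrite -XY subrK.
by rewrite mulmxDr mulmxDl -scalemxAr -scalemxAl !mxE addrK.
Qed.

Lemma Eminus_le_Eplus z (v : 'cV[C]_p) : 0 <= Im z ->
  sqnorm ((Em z)^t* *m v) <= sqnorm ((Ep z)^t* *m v).
Proof.
move=> z0; rewrite -subr_ge0 -lecR diag mulr_ge0 ?posdef_ge0 //.
by rewrite lecR !mulr_ge0 // pi_ge0.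
Qed.

(** At a real point the kernel formula makes [Em] kill [v] as soon as [Ep] does,
    and then all kernels at this point vanish in the direction [v]. *)
Lemma Eplus_ct_inj z (v : 'cV[C]_p) : 0 <= Im z -> (Ep z)^t* *m v = 0 -> v = 0.
Proof.
move=> z0 Ev; have Emv : (Em z)^t* *m v = 0.
  have := Eminus_le_Eplus v z0; rewrite Ev sqnorm0 => h.
  apply/colP => i; rewrite [RHS]mxE.
  have : sqmod (((Em z)^t* *m v) i 0) <= 0 by apply: le_trans h; exact: sqmod_le_sqnorm.
  rewrite sqmodE => h2; apply/eqP; rewrite -normc_eq0 -sqrf_eq0; apply/eqP.
  by apply/le_anti; rewrite h2 sqr_ge0.
apply: (K_total (z := z)) => w w0.
have : rho w z *: (v^t* *m K z w) = 0.
  rewrite scalemxAr -kerE mulmxBr !mulmxA.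
  have X (A : 'M[C]_p) : A^t* *m v = 0 -> v^t* *m A = 0.
    by move=> h; apply/eqP; rewrite -ct_eq0 (ctM _ A) trmxCK h.
  by rewrite !X // !mul0mx subrr.
move/eqP; rewrite scaler_eq0 => /orP[|/eqP //].
rewrite rhoE !mulf_eq0 subr_eq0 => /orP[/orP[|]|].
- by rewrite oppr_eq0 eq_complex /= eqxx andbT mulf_eq0 !gt_eqF ?pi_gt0.
- by rewrite eq_complex /= oner_eq0 andbF.
- move=> /eqP zw; have zE : Im z = - Im w by rewrite zw; case: (w).
  by move: z0; rewrite zE oppr_ge0 leNgt w0.
Qed.

Lemma Eplus_unit z : 0 <= Im z -> Ep z \in unitmx.
Proof.
move=> z0; rewrite unitmxE unitfE; apply/negP => /det0P[v v0 vA].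
have := @Eplus_ct_inj z (v^t*) z0; rewrite -ctM vA ct0 => /(_ erefl)/eqP.
by rewrite ct_eq0 (negbTE v0).
Qed.

(** The quotient [E_+^-1 E_-], the candidate inner function. *)
Definition theta z := invmx (Ep z) *m Em z.

Lemma theta_contraction z (v : 'cV[C]_p) : 0 <= Im z -> sqnorm (theta z *m v) <= sqnorm v.
Proof.
move=> z0; apply: ct_contraction => {}v.
have u : (Ep z)^t* \in unitmx by rewrite map_unitmx unitmx_tr Eplus_unit.
rewrite /theta ctM ct_inv -mulmxA.
apply: le_trans (Eminus_le_Eplus _ z0) _.
by rewrite mulKVmx.
Qed.

(** The kernel formula with [z = w] real says [Ep Ep^* = Em Em^*]. *)
Lemma theta_unitary x : theta x%:C \is unitarymx.
Proof.
have u := @Eplus_unit x%:C (lexx _).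
apply/unitarymxP; rewrite /theta ctM ct_inv -!mulmxA (mulmxA (Em _)).
have -> : Em x%:C *m (Em x%:C)^t* = Ep x%:C *m (Ep x%:C)^t*.
  apply/esym/eqP; rewrite -subr_eq0 kerE rho_diag /= mulr0 scale0r //.
by rewrite -mulmxA mulKmx // mulmxV // map_unitmx unitmx_tr.
Qed.

Lemma Eplus_kernel z w v : 0 <= Im z -> rho w z != 0 ->
  invmx (Ep z) *m (K z w *m v) =
  (rho w z)^-1 *: ((Ep w)^t* *m v - theta z *m ((Em w)^t* *m v)) :> 'cV_p.
Proof.
move=> z0 r0; have -> : K z w = (rho w z)^-1 *: (rho w z *: K z w).
  by rewrite scalerA mulVf // scale1r.
rewrite -kerE -scalemxAl -scalemxAr; congr (_ *: _).
by rewrite mulmxBl mulmxBr !mulmxA mulVmx ?mul1mx // Eplus_unit.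
Qed.

(** A single bound for all horizontal lines, so that [hardy2_poisson] applies to
    Cauchy kernels. *)
Lemma inv_poisson_bound (w : C) : 0 < Im w ->
  exists2 k, 0 <= k & forall x y, 0 <= y -> sqmod ((x +i* y) - w^*%C)^-1 <= k * poisson 0 1 x.
Proof.
case: w => a c /= c0; exists (2 + (2 * a ^+ 2 + 1) / c ^+ 2).
  by rewrite addr_ge0 // divr_ge0 ?sqr_ge0 // addr_ge0 // mulr_ge0 // sqr_ge0.
move=> x y y0; rewrite sqmodV /sqmod /= /poisson subr0 expr1n opprK.
have d1 : 0 < x ^+ 2 + 1 by rewrite ltr_wpDl ?sqr_ge0.
have c2 : 0 < c ^+ 2 by rewrite exprn_gt0.
have yc : c ^+ 2 <= (y + c) ^+ 2 by rewrite ler_sqr ?nnegrE ?addr_ge0 // ?ler_wpDl // ltW.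
have d2 : 0 < (x - a) ^+ 2 + (y + c) ^+ 2 by apply: ltr_wpDl; [exact: sqr_ge0|exact: lt_le_trans yc].
rewrite -div1r -[X in _ <= X]/(_ / (x ^+ 2 + 1)) ler_pdivrMr // mulrAC ler_pdivlMr //.
rewrite mul1r mulrDl.
have h1 : x ^+ 2 <= 2 * (x - a) ^+ 2 + 2 * a ^+ 2.
  by rewrite -subr_ge0 (_ : _ - _ = (x - 2 * a) ^+ 2) ?sqr_ge0 //; ring.
have h2 : 2 * a ^+ 2 + 1 <= (2 * a ^+ 2 + 1) / c ^+ 2 * ((x - a) ^+ 2 + (y + c) ^+ 2).
  rewrite mulrAC ler_pdivlMr //; apply: ler_wpM2l.
    by rewrite addr_ge0 // mulr_ge0 // sqr_ge0.
  by apply: (le_trans yc); rewrite lerDr sqr_ge0.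
move: h1 h2 yc c2; move: (_ / c ^+ 2 * _) => q.
by move: (sqr_ge0 (y + c)); lra.
Qed.

End Structure.

(** * Matrix functions and boundary values *)

Lemma ae_imp2 d (T : measurableType d) (R : realType) (mu : {measure set T -> \bar R})
    (P Q S : T -> Prop) : (forall x, P x -> Q x -> S x) ->
  {ae mu, forall x, P x} -> {ae mu, forall x, Q x} -> {ae mu, forall x, S x}.
Proof. by move=> PQS; apply: filterS2. Qed.

Section MatrixFunctions.
Variable R : realType.
Local Notation C := R[i].
Local Notation leb := (@lebesgue_measure R).
Local Notation normc := (@ComplexField.Normc.normc R).

Definition mholo k l (A : C -> 'M[C]_(k, l)) z :=
  forall i j, holo (fun w => A w i j) z.

Lemma mholoM k l r (A : C -> 'M[C]_(k, l)) (B : C -> 'M[C]_(l, r)) z :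
  mholo A z -> mholo B z -> mholo (fun w => A w *m B w) z.
Proof.
move=> hA hB i j; under eq_fun do rewrite mxE.
by apply: holo_sum => s _; apply: holoM; [exact: hA|exact: hB].
Qed.

Lemma mholo_cst k l (A : 'M[C]_(k, l)) z : mholo (fun=> A) z.
Proof. by move=> i j; exact: holo_cst. Qed.

Lemma mholoZ k l (f : C -> C) (A : C -> 'M[C]_(k, l)) z :
  holo f z -> mholo A z -> mholo (fun w => f w *: A w) z.
Proof.
by move=> hf hA i j; under eq_fun do rewrite mxE; exact: (holoM hf (hA i j)).
Qed.

Lemma holo_det k (A : C -> 'M[C]_k) z : mholo A z -> holo (fun w => \det (A w)) z.
Proof.
move=> hA; rewrite /determinant; apply: holo_sum => s _.
apply: holoM; first exact: holo_cst.
by apply: holo_prod => i _; exact: hA.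
Qed.

Lemma holo_near_eq (f g : C -> C) z : (\forall w \near (z : C^o), f w = g w) ->
  holo f z -> holo g z.
Proof. by move=> fg; apply: near_eq_derivable => //; rewrite oner_eq0. Qed.

Lemma mholo_inv k (A : C -> 'M[C]_k) z : A z \in unitmx -> mholo A z ->
  mholo (fun w => invmx (A w)) z.
Proof.
rewrite unitmxE unitfE => uA hA i j; have hd := holo_det hA.
apply: (@holo_near_eq (fun w => (\det (A w))^-1 * \adj (A w) i j)).
  have /nbhsC_normc[d d0 Hd] : nbhs (z : C^o) [set w : C^o | \det (A w) != 0].
    have hc : {for (z : C^o), continuous (fun w : C^o => \det (A w) : C^o)} := holo_cont hd.
    apply: (hc [set y | y != 0]); apply/nbhsC_normc.
    exists (normc (\det (A z))) => [|y hy]; first by rewrite normc_gt0.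
    by apply/eqP => y0; move: hy; rewrite y0 sub0r normcNn ltxx.
  apply/nbhsC_normc; exists d => // w /Hd /= Aw.
  by rewrite /invmx unitmxE unitfE Aw [RHS]mxE.
apply: holoM; first exact: holoV.
under eq_fun do rewrite mxE; rewrite /cofactor; apply: holoM; first exact: holo_cst.
by apply: holo_det => i' j'; under eq_fun do rewrite !mxE; exact: hA.
Qed.

Lemma mholo_horiz k l (A : C -> 'M[C]_(k, l)) i j :
  (forall x : R, mholo A x%:C) -> cmeasurable (fun x => A x%:C i j).
Proof.
move=> hA; apply: cmeasurable_cont => x.
apply: (@continuous_comp R C^o C^o (fun x => x +i* 0) (fun z => A z i j) x).
  exact: cont_horiz.
by apply: holo_cont; exact: hA.
Qed.

Lemma holo_vertical (f : C -> C) (x : R) : holo f x%:C ->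
  f (x +i* y) @[y --> 0^'+] --> (f x%:C : C^o).
Proof.
move=> hf.
suff : (fun y => f (x +i* y)) @ nbhs (0 : R) --> (f x%:C : C^o).
  by apply: cvg_trans; apply: cvg_app; exact: cvg_within.
apply: (@continuous_comp R C^o C^o (fun y => x +i* y) f 0).
  exact: cont_vert.
exact: holo_cont.
Qed.

(** Differentiability at a real point gives continuity there, hence
    convergence along the vertical ray. *)
Lemma mholo_boundary k l (A : C -> 'M[C]_(k, l)) : (forall x : R, mholo A x%:C) ->
  boundary_of A (fun x => A x%:C).
Proof.
move=> hA; split; first by move=> i j; exact: mholo_horiz.
by apply: aeW => x i j; exact: (@holo_vertical (fun z => A z i j) x (hA x i j)).
Qed.

Lemma boundary_unique k l (A : C -> 'M[C]_(k, l)) Ab Ab' :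
  boundary_of A Ab -> boundary_of A Ab' -> {ae leb, forall x, Ab x = Ab' x}.
Proof.
move=> [_ h] [_ h']; move: h h'; apply: ae_imp2 => x hx hx'.
apply/matrixP => i j.
exact: (@cvg_unique C^o (@norm_hausdorff C C^o) ((fun y => A (x +i* y) i j) @ 0^'+)
  _ _ _ (hx i j) (hx' i j)).
Qed.

Lemma cmeasurable_cst (k : C) : cmeasurable (fun=> k : C).
Proof. by split; exact: measurable_cst. Qed.

Lemma cmeasurable_conj (f : R -> C) : cmeasurable f -> cmeasurable (fun x => (f x)^*%C).
Proof.
move=> [f1 f2]; split.
  by rewrite (_ : (fun x => Re _) = fun x => Re (f x)) //; apply/funext => x; case: (f x).
rewrite (_ : (fun x => Im _) = fun x => - Im (f x)); first exact: measurable_funN.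
by apply/funext => x; case: (f x).
Qed.

Lemma cmeasurable_sum (I : Type) (s : seq I) (f : I -> R -> C) :
  (forall i, cmeasurable (f i)) -> cmeasurable (fun x => \sum_(i <- s) f i x).
Proof.
move=> fm; elim: s => [|i s IH].
  by under eq_fun do rewrite big_nil; exact: cmeasurable_cst.
under eq_fun do rewrite big_cons -[X in X + _]opprK -[X in - X]mulN1r addrC -[X in _ + - X]mulrC.
apply: cmeasurableB => //; apply: cmeasurableM => //; exact: cmeasurable_cst.
Qed.

Lemma ae_eq_Cint (f g : R -> C) : cmeasurable f -> cmeasurable g ->
  {ae leb, forall x, f x = g x} -> Cint setT f = Cint setT g.
Proof.
move=> [f1 f2] [g1 g2] fg; apply: C_eqP; congr fine; apply: ae_eq_integral => //.
- exact/measurable_EFinP.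
- exact/measurable_EFinP.
- by move: fg; apply: ae_imp => x -> _.
- exact/measurable_EFinP.
- exact/measurable_EFinP.
- by move: fg; apply: ae_imp => x -> _.
Qed.

Lemma cintegrable_conj (f : R -> C) : cintegrable setT f ->
  cintegrable setT (fun x => (f x)^*%C).
Proof.
move=> [f1 f2]; split.
  by rewrite (_ : (fun x => _) = fun x => (Re (f x))%:E) //; apply/funext => x; case: (f x).
rewrite (_ : (fun x => _) = fun x => (- (Im (f x))%:E)%E); first exact: integrableN.
by apply/funext => x; case: (f x).
Qed.

Lemma Cint_conj (f : R -> C) : cintegrable setT f ->
  Cint setT (fun x => (f x)^*%C) = (Cint setT f)^*%C.
Proof.
move=> [f1 f2]; apply: C_eqP => /=.
  by apply: eq_Rintegral => x _; case: (f x).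
rewrite -mulN1r -RintegralZl //; apply: eq_Rintegral => x _.
by rewrite mulN1r; case: (f x).
Qed.

Lemma cintegrable_dom (f : R -> C) (b : R -> R) : cmeasurable f ->
  leb.-integrable setT (EFin \o b) -> (forall x, normc (f x) <= b x) ->
  cintegrable setT f.
Proof.
move=> [f1 f2] bi fb; split; apply: (le_integrable _ _ _ bi) => //.
- exact/measurable_EFinP.
- move=> x _; rewrite /= lee_fin (le_trans (Re_le_normc _)) // (le_trans (fb x)) //.
  exact: ler_norm.
- exact/measurable_EFinP.
- move=> x _; rewrite /= lee_fin (le_trans (Im_le_normc _)) // (le_trans (fb x)) //.
  exact: ler_norm.
Qed.

Lemma inner_measurable k (a b : R -> 'cV[C]_k) :
  (forall i, cmeasurable (fun x => a x i 0)) -> (forall i, cmeasurable (fun x => b x i 0)) ->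
  cmeasurable (fun x => ((a x)^t* *m b x) 0 0).
Proof.
move=> ma mb; under eq_fun do rewrite mxE.
apply: cmeasurable_sum => i; under eq_fun do rewrite !mxE.
by apply: cmeasurableM => //; exact: cmeasurable_conj.
Qed.

Lemma hardy_cauchy_vec p (h : C -> 'cV[C]_p) hb w (v : 'cV[C]_p) :
  hardy2 h -> boundary_of h hb -> 0 < Im w ->
  cintegrable setT (fun x => (x%:C - w)^-1 * (v^t* *m hb x) 0 0) /\
  Cint setT (fun x => (x%:C - w)^-1 * (v^t* *m hb x) 0 0) =
    (2 * pi)%:C * 'i%C * (v^t* *m h w) 0 0.
Proof.
move=> hh hhb w0.
have E : (fun x : R => (x%:C - w)^-1 * (v^t* *m hb x) 0 0) =
    fun x => \sum_i (v i 0)^*%C * (hb x i 0 * (x%:C - w)^-1).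
  apply/funext => x; rewrite mxE mulr_sumr; apply: eq_bigr => i _.
  by rewrite !mxE mulrC mulrA.
rewrite E; have hc i := @hardy_cauchy R p h hb w i hh hhb w0.
have ci i : cintegrable setT (fun x => (v i 0)^*%C * (hb x i 0 * (x%:C - w)^-1)).
  by apply: cintegrableZ => //; exact: (hc i).1.
split; first exact: cintegrable_sum.
rewrite Cint_sum // mxE mulr_sumr; apply: eq_bigr => i _.
by rewrite CintZ //; [rewrite (hc i).2 !mxE mulrCA|exact: (hc i).1].
Qed.

Lemma sqnorm_measurable k (b : R -> 'cV[C]_k) : (forall i, cmeasurable (fun x => b x i 0)) ->
  measurable_fun setT (fun x => sqnorm (b x)).
Proof.
move=> mb; under eq_fun do rewrite sqnorm_sqmod; apply: measurable_sum => i.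
by apply: measurable_funD; apply: measurable_funX; [exact: (mb i).1|exact: (mb i).2].
Qed.

Lemma cvg_bigsum (K : numFieldType) (V : normedModType K) (T : Type)
    (F : set_system T) (I : Type) (s : seq I) (f : I -> T -> V) (l : I -> V) :
  Filter F -> (forall i, f i x @[x --> F] --> l i) ->
  \sum_(i <- s) f i x @[x --> F] --> \sum_(i <- s) l i.
Proof.
move=> FF fl; elim: s => [|i s IH].
  by rewrite big_nil; under eq_fun do rewrite big_nil; exact: cvg_cst.
by rewrite big_cons; under eq_fun do rewrite big_cons; exact: (cvgD (fl i) IH).
Qed.

(** By Fatou's lemma along heights tending to [0]. *)
Lemma hardy2_boundary_integrable p (h : C -> 'cV[C]_p) hb :
  hardy2 h -> boundary_of h hb ->
  leb.-integrable setT (EFin \o (fun x => sqnorm (hb x))).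
Proof.
move=> hh [mhb ae_hb]; have [M hM] := hardy2_bound hh; have [hhol _] := hh.
have m := sqnorm_measurable (fun i => mhb i 0).
have y0 n : 0 < (1 : R) / n.+2%:R by rewrite divr_gt0.
have := @fatou_ae _ _ _ leb (fun n x => sqnorm (h (x +i* (1 / n.+2%:R))))
  (fun x => sqnorm (hb x)) M _ m (fun n x => sqnorm_ge0 _) _ (fun n => hM _ (y0 n)).
move=> H; apply/integrableP; split; first exact/measurable_EFinP.
apply: (@le_lt_trans _ _ M%:E); last by rewrite ltry.
under eq_integral => x _ do rewrite /= ger0_norm ?sqnorm_ge0 //.
apply: H => [n|]; first exact: sqnorm_horiz_measurable.
move: ae_hb; apply: ae_imp => x hx; under eq_fun do rewrite sqnorm_sqmod.
rewrite sqnorm_sqmod; apply: (@cvg_bigsum R R^o) => i.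
apply: (@cvg_comp _ _ _ _ (fun z : C^o => sqmod z) _ (nbhs (hb x i 0 : C^o))); last exact: sqmod_continuous.
apply: (@cvg_comp _ _ _ (fun n : nat => (1 : R) / n.+2%:R) (fun y => h (x +i* y) i 0) _ (0 : R)^'+).
  exact: cvg_at_right_seq.
exact: hx.
Qed.

End MatrixFunctions.

(** * Functions dominated by the Poisson kernel *)

Section PoissonBound.
Variables (R : realType) (p : nat).
Local Notation C := R[i].
Local Notation leb := (@lebesgue_measure R).
Local Notation normc := (@ComplexField.Normc.normc R).

(** Such functions are square integrable on the horizontal lines of the closed
    upper half-plane, with a bound common to all lines. *)
Definition poisson_bounded (f : C -> 'cV[C]_p) := exists2 k : R, 0 <= k &
  forall x y, 0 <= y -> sqnorm (f (x +i* y)) <= k * poisson 0 1 x.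

Lemma poisson_boundedD f g : poisson_bounded f -> poisson_bounded g ->
  poisson_bounded (fun z => f z + g z).
Proof.
move=> [k k0 hk] [l l0 hl]; exists (2 * (k + l)); first by rewrite mulr_ge0 ?addr_ge0.
move=> x y y0; apply: (le_trans (sqnormD_le _ _)).
have -> : 2 * (k + l) * poisson 0 1 x = 2 * (k * poisson 0 1 x) + 2 * (l * poisson 0 1 x).
  by ring.
apply: lerD; apply: ler_wpM2l => //; [exact: hk|exact: hl].
Qed.

Lemma poisson_bounded_sum (I : Type) (s : seq I) (f : I -> C -> 'cV[C]_p) :
  (forall i, poisson_bounded (f i)) -> poisson_bounded (fun z => \sum_(i <- s) f i z).
Proof.
move=> hf; elim: s => [|i s IH].
  by exists 0 => // x y _; rewrite big_nil sqnorm0 mul0r.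
by under eq_fun do rewrite big_cons; exact: poisson_boundedD (hf i) IH.
Qed.

Lemma rho_inv w z : (rho w z)^-1 = (- (2 * pi)%:C * 'i%C)^-1 * (z - w^*%C)^-1 :> C.
Proof. by rewrite rhoE invfM. Qed.

Lemma poisson_bounded_rho w (f : C -> 'cV[C]_p) c : 0 < Im w -> 0 <= c ->
  (forall z, 0 <= Im z -> sqnorm (f z) <= c) ->
  poisson_bounded (fun z => (rho w z)^-1 *: f z).
Proof.
move=> w0 c0 hf; have [k k0 hk] := inv_poisson_bound w0.
pose q : R := sqmod (- (2 * pi)%:C * 'i%C)^-1; have q0 : 0 <= q by exact: sqmod_ge0.
exists (q * k * c); first by rewrite !mulr_ge0.
move=> x y y0; rewrite sqnormZ rho_inv sqmodM -/q.
have -> : q * k * c * poisson 0 1 x = q * (k * poisson 0 1 x) * c by ring.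
apply: ler_pM; rewrite ?mulr_ge0 ?sqmod_ge0 ?sqnorm_ge0 //; last exact: hf.
by apply: ler_wpM2l => //; exact: hk.
Qed.

Lemma rho_neq0 (w z : C) : 0 < Im w -> 0 <= Im z -> rho w z != 0.
Proof.
move=> w0 z0; rewrite rhoE !mulf_neq0 //.
- by rewrite oppr_eq0 eq_complex /= eqxx andbT mulf_eq0 negb_or !gt_eqF ?pi_gt0.
- by rewrite eq_complex /= oner_eq0 andbF.
rewrite subr_eq0; apply/eqP => zw.
have zE : Im z = - Im w by rewrite zw; case: (w).
by move: z0; rewrite zE oppr_ge0 leNgt w0.
Qed.

Lemma rho_inv_conj (w : C) (x : R) :
  ((rho w x%:C)^-1)^*%C = ((2 * pi)%:C * 'i%C)^-1 * (x%:C - w)^-1.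
Proof.
rewrite fmorphV -invfM; congr (_^-1); rewrite rhoE; case: w => a b.
by apply/eqP; rewrite eq_complex /=; apply/andP; split; apply/eqP; ring.
Qed.

(** The reproducing property of the Cauchy kernel in the Hardy space. *)
Lemma cauchy_pairing (h : C -> 'cV[C]_p) hb w (v : 'cV[C]_p) :
  hardy2 h -> boundary_of h hb -> 0 < Im w ->
  cintegrable setT (fun x => ((rho w x%:C)^-1)^*%C * (v^t* *m hb x) 0 0) /\
  Cint setT (fun x => ((rho w x%:C)^-1)^*%C * (v^t* *m hb x) 0 0) = (v^t* *m h w) 0 0.
Proof.
move=> hh hhb w0; have [i1 i2] := hardy_cauchy_vec v hh hhb w0.
under eq_fun do rewrite rho_inv_conj -mulrA.
split; first exact: cintegrableZ.
rewrite CintZ // i2 mulrA mulVf ?mul1r //.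
apply: mulf_neq0.
  by rewrite eq_complex /= eqxx andbT mulf_eq0 negb_or !gt_eqF ?pi_gt0.
by rewrite eq_complex /= oner_eq0 andbF.
Qed.

Lemma inner_conj (a b : 'cV[C]_p) : ((a^t* *m b) 0 0)^*%C = (b^t* *m a) 0 0.
Proof.
rewrite !mxE rmorph_sum; apply: eq_bigr => i _.
by rewrite !mxE rmorphM /= [(_^*%C)^*%C]conjcK mulrC.
Qed.

Lemma normc_inner_le (a b : 'cV[C]_p) : normc ((a^t* *m b) 0 0) <= sqnorm a + sqnorm b.
Proof.
rewrite mxE !sqnorm_sqmod -big_split /=.
elim/big_ind2: _ => [|x1 x2 y1 y2 h1 h2|i _].
- by rewrite -[0 in X in X <= _]/(0%:C) normc_real normr0.
- by apply: (le_trans (normcD _ _)); exact: lerD.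
rewrite !mxE normcMM !sqmodE.
have -> : normc (a i 0)^*%C = normc (a i 0).
  by apply/eqP; rewrite -(@eqrXn2 _ 2) ?normc_ge0 // !normc_sqr; case: (a i 0) => s t /=; rewrite sqrrN.
have := sqr_ge0 (normc (a i 0) - normc (b i 0)).
have := normc_ge0 (a i 0); have := normc_ge0 (b i 0).
by move: (normc (a i 0)) (normc (b i 0)) => s t; nra.
Qed.

Lemma pairing_integrable (f : C -> 'cV[C]_p) (b : R -> 'cV[C]_p) :
  poisson_bounded f -> (forall i, cmeasurable (fun x => f x%:C i 0)) ->
  (forall i, cmeasurable (fun x => b x i 0)) ->
  leb.-integrable setT (EFin \o (fun x => sqnorm (b x))) ->
  cintegrable setT (fun x => ((f x%:C)^t* *m b x) 0 0).
Proof.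
move=> [k k0 hk] mf mb ib.
apply: (@cintegrable_dom _ _ (fun x => k * poisson 0 1 x + sqnorm (b x))).
- exact: inner_measurable.
- have /(integrableZl measurableT k) ip : leb.-integrable setT (EFin \o (poisson 0 1 : R -> R)).
    by apply: integrable_poisson.
  rewrite (_ : EFin \o _ = (fun x => k%:E * (EFin \o poisson 0 1) x + (EFin \o (fun x => sqnorm (b x))) x)%E) //.
  exact: integrableD.
- move=> x; apply: (le_trans (normc_inner_le _ _)); rewrite lerD2r.
  exact: (hk x 0).
Qed.
End PoissonBound.

(** * Realization of the space of polynomials *)

Section Realization.
Variables (R : realType) (p n : nat).
Local Notation C := R[i].
Local Notation m := (\sum_(i < n.+1) p)%N.
Local Notation F := (Fmx p n).
Variable G : 'M[C]_m.
Hypothesis pG : posdefmx G.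
Local Notation Gamma := (invmx G).
Variables Ep Em : C -> 'M[C]_p.
Hypotheses (hEp : forall z, mholo Ep z) (hEm : forall z, mholo Em z).
Hypothesis kerE : forall z w,
  Ep z *m (Ep w)^t* - Em z *m (Em w)^t* = rho w z *: Kmx G z w.
Local Notation theta := (theta Ep Em).
Local Notation quot f := (fun z => invmx (Ep z) *m f z).
Local Notation pol u := (fun z => F z *m u).

Let Kpos := Kmx_posdef pG.
Let Ktot := kernel_total pG.
Let unitE z (z0 : 0 <= Im z) : Ep z \in unitmx := Eplus_unit kerE Kpos Ktot z0.
Let unitEr (x : R) : Ep x%:C \in unitmx. Proof. by apply: unitE => /=. Qed.
Let theta_le z (v : 'cV[C]_p) (z0 : 0 <= Im z) : sqnorm (theta z *m v) <= sqnorm v :=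
  theta_contraction kerE Kpos Ktot v z0.

Lemma pol_holo (u : 'cV[C]_m) z : mholo (pol u) z.
Proof.
move=> i j; rewrite -[u]coefnK; under eq_fun do rewrite Fmx_vecn summxE.
apply: holo_sum => k _; under eq_fun do rewrite mxE.
by apply: holoM; [apply: holoX; exact: holo_id|exact: holo_cst].
Qed.

Lemma quot_holo (f : C -> 'cV[C]_p) z : 0 <= Im z -> mholo f z -> mholo (quot f) z.
Proof. by move=> z0 hf; apply: mholoM => //; apply: mholo_inv => //; exact: unitE. Qed.

Lemma theta_holo z : 0 <= Im z -> mholo theta z.
Proof. by move=> z0; apply: mholoM => //; apply: mholo_inv => //; exact: unitE. Qed.

Lemma quot_boundary (f : C -> 'cV[C]_p) : entire f ->
  boundary_of (quot f) (fun x => invmx (Ep x%:C) *m f x%:C).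
Proof.
move=> hf; apply: (@mholo_boundary _ _ _ (quot f)) => x; apply: quot_holo => //.
by move=> i j; exact: hf.
Qed.

(** The quotient by [Ep] of the kernel at [w] in direction [v], in terms of
    Cauchy kernels; see [quot_kernel]. *)
Definition cauchy_term w (v : 'cV[C]_p) z : 'cV[C]_p :=
  (rho w z)^-1 *: ((Ep w)^t* *m v - theta z *m ((Em w)^t* *m v)).

Lemma quot_kernel w (v : 'cV[C]_p) z : 0 < Im w -> 0 <= Im z ->
  invmx (Ep z) *m (F z *m (Gamma *m ((F w)^t* *m v))) = cauchy_term w v z.
Proof.
move=> w0 z0.
have -> : F z *m (Gamma *m ((F w)^t* *m v)) = Kmx G z w *m v by rewrite KmxE !mulmxA.
by rewrite (Eplus_kernel kerE Kpos Ktot) // rho_neq0.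
Qed.

Lemma quot_pol (u : 'cV[C]_m) : exists v : 'I_n.+1 -> 'cV[C]_p, forall z, 0 <= Im z ->
  invmx (Ep z) *m (F z *m u) = \sum_(j < n.+1) cauchy_term (node R j) (v j) z.
Proof.
have [v uE] := kernel_span pG u; exists v => z z0.
rewrite [in LHS]uE !mulmx_sumr; apply: eq_bigr => j _.
by rewrite quot_kernel // node_gt0.
Qed.

Lemma cauchy_term_bounded w v : 0 < Im w -> poisson_bounded (cauchy_term w v).
Proof.
move=> w0; apply: (@poisson_bounded_rho _ _ _ _
  (2 * sqnorm ((Ep w)^t* *m v) + 2 * sqnorm ((Em w)^t* *m v))) => //.
  by rewrite addr_ge0 // mulr_ge0 // sqnorm_ge0.
move=> z z0; apply: (le_trans (sqnormD_le _ _)); rewrite lerD2l sqnormN.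
by rewrite ler_wpM2l // theta_le.
Qed.

Lemma quot_pol_bounded (u : 'cV[C]_m) : poisson_bounded (quot (pol u)).
Proof.
have [v uE] := quot_pol u.
have [k k0 hk] := poisson_bounded_sum (index_enum 'I_n.+1)
  (fun j : 'I_n.+1 => cauchy_term_bounded (v j) (node_gt0 R j)).
by exists k => // x y y0; rewrite uE //; exact: hk.
Qed.

Lemma hardy2_poisson_bounded (f : C -> 'cV[C]_p) :
  (forall z, 0 <= Im z -> mholo f z) -> poisson_bounded f -> hardy2 f.
Proof.
move=> hf [k k0 hk]; apply: (@hardy2_poisson _ _ _ k) => //.
  by move=> z z0 i j; apply: hf; exact: ltW.
by move=> x y y0; apply: hk; exact: ltW.
Qed.

Lemma quot_pol_hardy (u : 'cV[C]_m) : hardy2 (quot (pol u)).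
Proof.
apply: hardy2_poisson_bounded; last exact: quot_pol_bounded.
by move=> z z0; apply: quot_holo => //; exact: pol_holo.
Qed.

Lemma theta_hardy (h : C -> 'cV[C]_p) : hardy2 h -> hardy2 (fun z => theta z *m h z).
Proof.
move=> hh; apply: (hardy2_contraction hh).
  move=> z z0; apply: mholoM; first by apply: theta_holo; exact: ltW.
  by case: hh => hh _; exact: hh.
by move=> z z0; apply: theta_le; exact: ltW.
Qed.

(** As [theta] is invertible at real points with inverse its adjoint, boundary
    values of [theta h] produce boundary values of [h]. *)
Lemma theta_boundary (h : C -> 'cV[C]_p) kb :
  boundary_of (fun z => theta z *m h z) kb ->
  boundary_of h (fun x => (theta x%:C)^t* *m kb x).
Proof.
move=> [mkb ae_kb].
have th x : mholo theta x%:C by apply: theta_holo => /=.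
split=> [i j|].
  suff : cmeasurable (fun x => ((theta x%:C)^t* *m kb x) i j) by [].
  under eq_fun do rewrite mxE; apply: cmeasurable_sum => l.
  have E x : (theta x%:C)^t* i l = (theta x%:C l i)^*%C by rewrite mxE; congr (_^*%C); rewrite mxE.
  under eq_fun do rewrite E.
  apply: cmeasurableM; last exact: mkb.
  by apply: cmeasurable_conj; exact: (@mholo_horiz _ _ _ theta l i th).
move: ae_kb; apply: ae_imp => x hx i j.
have uth := theta_unitary kerE Kpos Ktot x.
have uth' : theta x%:C \in unitmx by exact: unitarymx_unit.
have -> : (theta x%:C)^t* = invmx (theta x%:C) by rewrite invmx_unitary.
have hinv := mholo_inv uth' (th x).
have hdet := holo_det (th x).
have lim : (invmx (theta (x +i* y)) *m (theta (x +i* y) *m h (x +i* y))) i j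
    @[y --> 0^'+] --> ((invmx (theta x%:C) *m kb x) i j : C^o).
  rewrite [X in _ --> X]mxE; under eq_fun do rewrite mxE.
  apply: (@cvg_bigsum C C^o) => l.
  have h1 : invmx (theta (x +i* y)) i l @[y --> 0^'+] --> (invmx (theta x%:C) i l : C^o).
    exact: (@holo_vertical _ (fun z => invmx (theta z) i l) x (hinv i l)).
  exact: (@cvgM C R _ _ _ _ _ _ h1 (hx l j)).
have nu : \forall y \near 0^'+, \det (theta (x +i* y)) != 0.
  have hv : \det (theta (x +i* y)) @[y --> 0^'+] --> (\det (theta x%:C) : C^o).
    exact: (holo_vertical hdet).
  apply: (hv [set w | w != 0]).
  apply/nbhsC_normc; exists (ComplexField.Normc.normc (\det (theta x%:C))) => [|w hw] /=.
    by rewrite normc_gt0 -unitfE -unitmxE.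
  by apply/eqP => w0; move: hw; rewrite w0 sub0r normcNn ltxx.
apply: cvg_trans lim; apply: near_eq_cvg; near=> y.
have uy : theta (x +i* y) \in unitmx by rewrite unitmxE unitfE; near: y.
exact: (congr1 (fun M : 'cV[C]_p => M i j) (mulKmx uy (h (x +i* y)))).
Unshelve. all: by end_near. Qed.

(** The quotient is a sum of terms [r (c - theta d)] with Cauchy kernels [r].
    Paired with [theta h], the Cauchy formula gives [c^* theta h - d^* h] at the
    point of the kernel, since [theta] is unitary on the line; this vanishes
    because [c^* theta = d^*] there. *)
Lemma quot_pol_orth (u : 'cV[C]_m) (h : C -> 'cV[C]_p) : hardy2 h ->
  hardy2_orth (quot (pol u)) (fun z => theta z *m h z).
Proof.
move=> hh gb kb hgb hkb.
have hk := theta_hardy hh; have hhb := theta_boundary hkb.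
have [v uE] := quot_pol u.
have pe : entire (pol u) by move=> z _; exact: pol_holo.
have gbE := boundary_unique hgb (quot_boundary pe).
pose t (j : 'I_n.+1) (x : R) := ((rho (node R j) x%:C)^-1)^*%C *
    (((Ep (node R j))^t* *m v j)^t* *m kb x) 0 0 -
  ((rho (node R j) x%:C)^-1)^*%C *
    (((Em (node R j))^t* *m v j)^t* *m ((theta x%:C)^t* *m kb x)) 0 0.
have P (j : 'I_n.+1) := cauchy_pairing ((Ep (node R j))^t* *m v j) hk hkb (node_gt0 R j).
have Q (j : 'I_n.+1) := cauchy_pairing ((Em (node R j))^t* *m v j) hh hhb (node_gt0 R j).
have ti (j : 'I_n.+1) : cintegrable setT (t j).
  by apply: cintegrableB => //; [exact: (P j).1|exact: (Q j).1].
have t0 (j : 'I_n.+1) : Cint setT (t j) = 0.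
  rewrite CintB //; [|exact: (P j).1|exact: (Q j).1].
  rewrite (P j).2 (Q j).2; have u0 := unitE (ltW (node_gt0 R j)).
  rewrite (ctM _ (v j)) (ctM _ (v j)) !trmxCK /theta -!mulmxA mulKVmx //.
  by rewrite subrr.
have tE (x : R) : (((kb x)^t* *m (invmx (Ep x%:C) *m (F x%:C *m u))) 0 0) =
    \sum_(j < n.+1) (t j x)^*%C.
  rewrite uE //= mulmx_sumr summxE; apply: eq_bigr => j _.
  have cj (c A B : C) : (c^*%C * A - c^*%C * B)^*%C = c * (A^*%C - B^*%C).
    by rewrite -mulrBr rmorphM rmorphB; congr (_ * _); exact: conjcK.
  rewrite /t cj !inner_conj.
  rewrite /cauchy_term -scalemxAr mxE; congr (_ * _).
  rewrite mulmxBr [LHS]mxE [X in _ + X]mxE; congr (_ - _).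
  by rewrite ctM trmxCK -mulmxA.
have kbm i : cmeasurable (fun x => kb x i 0) by exact: hkb.1.
rewrite -[LHS]/(Cint setT (fun x => ((kb x)^t* *m gb x) 0 0)).
transitivity (Cint setT (fun x => ((kb x)^t* *m (invmx (Ep x%:C) *m (F x%:C *m u))) 0 0)).
  apply: ae_eq_Cint.
  - by apply: inner_measurable => // i; exact: hgb.1.
  - by apply: inner_measurable => // i; exact: (quot_boundary pe).1.
  - by move: gbE; apply: ae_imp => x ->.
under eq_Cint => x _ do rewrite tE.
rewrite Cint_sum // => [|j]; last exact: cintegrable_conj.
by rewrite big1 // => j _; rewrite Cint_conj // t0 conjc0.
Qed.

Lemma scaled_difference (r : C) (a b q : 'cV[C]_p) : ((r *: b)^t* *m q) 0 0 =
  r^*%C * (a^t* *m q) 0 0 - ((r *: (a - b))^t* *m q) 0 0.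
Proof. by rewrite !ctZ ctB -!scalemxAl mulmxBl !mxE; ring. Qed.

(** Paired with the coefficients of a polynomial and integrated, it gives the
    inner product of [f] with this polynomial. *)
Definition moment_density (f : C -> 'cV[C]_p) (x : R) : 'cV[C]_m :=
  (F x%:C)^t* *m (invmx (Ep x%:C *m (Ep x%:C)^t*) *m f x%:C).

Definition moment (f : C -> 'cV[C]_p) : 'cV[C]_m :=
  \col_l Cint setT (fun x => moment_density f x l 0).

Lemma quot_pairing (f : C -> 'cV[C]_p) (u : 'cV[C]_m) (x : R) :
  (invmx (Ep x%:C) *m (F x%:C *m u))^t* *m (invmx (Ep x%:C) *m f x%:C) =
  u^t* *m moment_density f x.
Proof.
have U := unitEr x; have Uc : (Ep x%:C)^t* \in unitmx by rewrite map_unitmx unitmx_tr.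
have invM : invmx (Ep x%:C *m (Ep x%:C)^t*) = invmx ((Ep x%:C)^t*) *m invmx (Ep x%:C).
  have UM : Ep x%:C *m (Ep x%:C)^t* \in unitmx by rewrite unitmx_mul U.
  apply: (can_inj (mulKmx UM)); rewrite mulmxV // -mulmxA (mulmxA _ (invmx _)) mulmxV //.
  by rewrite mul1mx mulmxV.
rewrite /moment_density invM (ctM (invmx _)) (ctM (F _)) ct_inv.
by rewrite !mulmxA.
Qed.

Section Reproduction.
Variable f : C -> 'cV[C]_p.
Hypothesis fB : [/\ entire f, hardy2 (quot f)
  & forall h, hardy2 h -> hardy2_orth (quot f) (fun z => theta z *m h z)].

Let fe : entire f. Proof. by case: fB. Qed.
Let qb : R -> 'cV[C]_p := fun x => invmx (Ep x%:C) *m f x%:C.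
Let qbE : boundary_of (quot f) qb. Proof. exact: quot_boundary. Qed.

Let quot_pairing_integrable (u : 'cV[C]_m) :
  cintegrable setT (fun x => ((invmx (Ep x%:C) *m (F x%:C *m u))^t* *m qb x) 0 0).
Proof.
have [_ hf _] := fB.
have pe : entire (pol u) by move=> z _; exact: pol_holo.
apply: (pairing_integrable (quot_pol_bounded u)).
- by move=> i; exact: (quot_boundary pe).1.
- by move=> i; exact: qbE.1.
exact: (hardy2_boundary_integrable hf qbE).
Qed.

Let density_integrable l : cintegrable setT (fun x => moment_density f x l 0).
Proof.
have := quot_pairing_integrable (delta_mx l 0).
under eq_fun do rewrite quot_pairing.
have -> : (delta_mx l 0 : 'cV[C]_m)^t* = delta_mx 0 l.
  by apply/matrixP => i j; rewrite !mxE conjC_nat andbC.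
by under eq_fun do rewrite -rowE mxE.
Qed.

Lemma moment_pairing (u : 'cV[C]_m) :
  Cint setT (fun x => (u^t* *m moment_density f x) 0 0) = (u^t* *m moment f) 0 0.
Proof.
under eq_Cint => x _ do rewrite mxE.
rewrite Cint_sum // => [|l]; last first.
  by apply: cintegrableZ => //; exact: density_integrable.
by rewrite mxE; apply: eq_bigr => l _; rewrite CintZ //; congr (_ * _); rewrite [RHS]mxE.
Qed.

(** The kernel at [w] differs from a Cauchy kernel, which reproduces the Hardy
    space, by an element of the range of [theta], which is orthogonal to [f]. *)
Lemma reproduction w (v : 'cV[C]_p) : 0 < Im w ->
  (v^t* *m f w) 0 0 = (v^t* *m (F w *m (Gamma *m moment f))) 0 0.
Proof.
move=> w0; have [_ hf orth] := fB.
pose u := Gamma *m ((F w)^t* *m v).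
pose h z := (rho w z)^-1 *: ((Em w)^t* *m v).
have hol_rho z : 0 <= Im z -> holo (fun z => (rho w z)^-1) z.
  move=> z0; apply: holoV; first exact: rho_neq0.
  by apply: holoM; [exact: holo_cst|apply: holoB; [exact: holo_id|exact: holo_cst]].
have hh : hardy2 h.
  apply: hardy2_poisson_bounded.
    by move=> z z0; apply: mholoZ; [exact: hol_rho|exact: mholo_cst].
  exact: (poisson_bounded_rho w0 (sqnorm_ge0 _)).
pose kb (x : R) := theta x%:C *m h x%:C.
have hkb : boundary_of (fun z => theta z *m h z) kb.
  apply: (@mholo_boundary _ _ _ (fun z => theta z *m h z)) => x; apply: mholoM.
    exact: theta_holo.
  by apply: mholoZ; [exact: hol_rho|exact: mholo_cst].
have orth0 : Cint setT (fun x => ((kb x)^t* *m qb x) 0 0) = 0 := orth h hh qb kb qbE hkb.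
have [i1 c1] := cauchy_pairing ((Ep w)^t* *m v) hf qbE w0.
have E (x : R) : ((kb x)^t* *m qb x) 0 0 =
    ((rho w x%:C)^-1)^*%C * (((Ep w)^t* *m v)^t* *m qb x) 0 0 -
    ((invmx (Ep x%:C) *m (F x%:C *m u))^t* *m qb x) 0 0.
  have -> : kb x = (rho w x%:C)^-1 *: (theta x%:C *m ((Em w)^t* *m v)).
    by rewrite /kb /h -scalemxAr.
  rewrite (quot_kernel v w0 (lexx 0 : 0 <= Im x%:C)).
  exact: scaled_difference.
move: orth0; under eq_Cint => x _ do rewrite E.
rewrite (CintB measurableT i1 (quot_pairing_integrable u)).
rewrite c1; under eq_Cint => x _ do rewrite quot_pairing.
rewrite moment_pairing => /eqP; rewrite subr_eq0 => /eqP.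
rewrite (ctM _ v) trmxCK -mulmxA mulKVmx; last by apply: unitE; exact: ltW.
move=> ->; congr (_ 0 0); rewrite /u (ctM Gamma) (ctM _ v) trmxCK.
by rewrite (posdef_ct (posdef_inv pG)) !mulmxA.
Qed.

(** [reproduction] gives the equality on the upper half-plane, and
    [identity_upper] extends it. *)
Lemma space_is_pol w : f w = F w *m (Gamma *m moment f).
Proof.
have up w' : 0 < Im w' -> f w' = F w' *m (Gamma *m moment f).
  move=> w0; apply/colP => i; have := reproduction (delta_mx i 0) w0.
  have -> : (delta_mx i 0 : 'cV[C]_p)^t* = delta_mx 0 i.
    by apply/matrixP => a b; rewrite !mxE conjC_nat andbC.
  by rewrite -!rowE !mxE.
apply/colP => i; apply/eqP; rewrite -subr_eq0; apply/eqP.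
apply: (@identity_upper _ (fun z => f z i 0 - (F z *m (Gamma *m moment f)) i 0)) => z.
  by apply: holoB; [exact: fe|exact: pol_holo].
by move=> z0; rewrite up // subrr.
Qed.

End Reproduction.

Lemma pol_in_space (u : 'cV[C]_m) : [/\ entire (pol u), hardy2 (quot (pol u))
  & forall h, hardy2 h -> hardy2_orth (quot (pol u)) (fun z => theta z *m h z)].
Proof.
split; [by move=> z _; exact: pol_holo|exact: quot_pol_hardy|exact: quot_pol_orth].
Qed.

(** By [space_is_pol] the coefficient vectors [u] and [Gamma *m moment (pol u)] give
    the same polynomial. *)
Lemma moment_pol (u : 'cV[C]_m) : moment (pol u) = G *m u.
Proof.
have uG : G \in unitmx by exact: posdef_unit.
rewrite -[LHS](mulKVmx uG); congr (G *m _); apply/eqP; rewrite -subr_eq0; apply/eqP.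
apply: (Fmx_upper_inj pG) => w w0.
have E : F w *m u = F w *m (Gamma *m moment (pol u)) := space_is_pol (pol_in_space u) w.
by rewrite mulmxBr E subrr.
Qed.

Local Notation E := (fun z => row_mx (Em z) (Ep z)).

Let EpE : Eplus E = Ep. Proof. by apply/funext => z; rewrite /Eplus row_mxKr. Qed.
Let EmE : Eminus E = Em. Proof. by apply/funext => z; rewrite /Eminus row_mxKl. Qed.

Lemma realization : HG_is_de_branges_space G E.
Proof.
split; first split.
- move=> z _ i j; under eq_fun do rewrite mxE.
  by case: (fintype.split j) => k; [exact: hEm|exact: hEp].
- by move=> z z0; rewrite EpE -unitfE -unitmxE; apply: unitE; exact: ltW.
- rewrite EpE EmE; split.
  + by move=> z z0 i j; apply: theta_holo; exact: ltW.
  + by move=> z z0 v; apply: theta_le; exact: ltW.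
  + exists (fun x => theta x%:C).
      by apply: (@mholo_boundary _ _ _ theta) => x; exact: theta_holo.
    by apply: aeW => x; exact: (theta_unitary kerE Kpos Ktot).
- apply/seteqP; split => f.
    move=> [u _ <-]; rewrite /de_branges_space /= EpE EmE; exact: pol_in_space.
  rewrite /de_branges_space /= EpE EmE => fB; exists (Gamma *m moment f) => //.
  by apply/funext => z; rewrite -(space_is_pol fB).
- move=> u v; rewrite /de_branges_inner EpE.
  rewrite -[LHS]/(Cint setT (fun x => ((F x%:C *m v)^t*
    *m invmx (Ep x%:C *m (Ep x%:C)^t*) *m (F x%:C *m u)) 0 0)).
  under eq_Cint => x _ do rewrite (ctM (F x%:C) v) -!mulmxA.
  rewrite -[LHS]/(Cint setT (fun x => (v^t* *m moment_density (pol u) x) 0 0)).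
  by rewrite (moment_pairing (pol_in_space u)) moment_pol mulmxA.
Qed.

End Realization.

(** * Hankel structure and the normalized formulas *)

Section Conclusion.
Variables (R : realType) (p n : nat).
Local Notation C := R[i].
Local Notation m := (\sum_(i < n.+1) p)%N.
Local Notation F := (Fmx p n).
Variable G : 'M[C]_m.
Hypothesis pG : posdefmx G.

Lemma Fmx_holo z : mholo (@Fmx R p n) z.
Proof.
move=> i j; have := @pol_holo R p n (delta_mx j 0) z i 0.
by under eq_fun do rewrite -colE mxE.
Qed.

Lemma Eblock_holo (k b z : C) : mholo (Eblock G k b) z.
Proof.
apply: mholoZ.
  by apply: holoM; [exact: holo_cst|apply: holoB; [exact: holo_id|exact: holo_cst]].
have -> : (fun z => F z *m invmx G *m (F b)^t* *m invsqrtmx (k *: (F b *m invmx G *m (F b)^t*)))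
   = fun z => F z *m (invmx G *m (F b)^t* *m invsqrtmx (k *: (F b *m invmx G *m (F b)^t*))).
  by apply/funext => w; rewrite !mulmxA.
by apply: mholoM; [exact: Fmx_holo|exact: mholo_cst].
Qed.

Lemma Eblock_realization (a : C) : 0 < Im a -> block_hankel G ->
  HG_is_de_branges_space G
    (fun z => row_mx (Eblock G (rho a a) a^*%C z) (Eblock G (rho a a) a z)).
Proof.
move=> a0 hankG; apply: realization => //; [exact: Eblock_holo|exact: Eblock_holo|].
by move=> z w; exact: kernel_formula.
Qed.

Lemma Eblock_normalized (k b z : C) : 0 < k ->
  Eblock G k b z = (rho b z / sqrtC k) *: (F z *m zmx G b).
Proof.
move=> k0; rewrite EblockE (invsqrtmxZ k0 (Kmx_posdef pG b)) -scalemxAr scalerA.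
by rewrite /zmx !mulmxA.
Qed.

Definition monomial (i : 'I_n.+1) (a : 'I_p) : 'cV[C]_m :=
  vecn n (fun k => if k == i then delta_mx a 0 else 0).

Lemma Fmx_monomial z i a : F z *m monomial i a = z ^+ i *: delta_mx a 0.
Proof.
rewrite Fmx_vecn (bigD1 i) //= eqxx big1 ?addr0 // => k ki.
by rewrite (negbTE (_ : (k : nat) != i)) ?scaler0.
Qed.

Lemma ct_delta q (a : 'I_q) : (delta_mx a 0 : 'cV[C]_q)^t* = delta_mx 0 a.
Proof. by apply/matrixP => i j; rewrite !mxE conjC_nat andbC. Qed.

Lemma monomial_form i j a b :
  ((monomial i a)^t* *m G *m monomial j b) 0 0 = submxblock G i j a b.
Proof.
have vE (i' : 'I_n.+1) (a' : 'I_p) (k : 'I_n.+1) : k != i' ->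
    (if (k : nat) == i' then delta_mx a' 0 else 0) = 0 :> 'cV[C]_p.
  by move=> ki; rewrite (negbTE (_ : (k : nat) != i')).
rewrite -[_ *m monomial j b]/(ip G _ _) ip_vecn (bigD1 i) //=.
rewrite [X in _ + X]big1 => [|k ki]; last first.
  by apply: big1 => l _; rewrite vE // ct0 !mul0mx.
rewrite addr0 (bigD1 j) //= [X in _ + X]big1 => [|l lj]; last first.
  by rewrite [X in _ *m X]vE // mulmx0.
by rewrite addr0 !eqxx ct_delta -rowE -colE !mxE.
Qed.

(** The inner product of a de Branges space comes from a matrix measure on the
    line, where a product of monomials depends only on the sum of the degrees. *)
Lemma realization_hankel (E : C -> 'M[C]_(p, p + p)) :
  HG_is_de_branges_space G E -> block_hankel G.
Proof.
move=> [_ _ inner] i j k l ijkl; apply/matrixP => a b.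
rewrite -!monomial_form -!inner /de_branges_inner.
have ent (i' j' : 'I_n.+1) (x : R) (M : 'M[C]_p) :
    ((F x%:C *m monomial i' a)^t* *m M *m (F x%:C *m monomial j' b)) 0 0 =
    x%:C ^+ (i' + j') * M a b.
  rewrite !Fmx_monomial ctZ ct_delta -!scalemxAl -scalemxAr scalerA mxE.
  rewrite -rowE -colE !mxE rmorphXn /= exprD; congr (_ ^+ _ * _ * _).
  by apply/eqP; rewrite eq_complex /= oppr0 !eqxx.
rewrite -[LHS]/(Cint setT _) -[RHS]/(Cint setT _).
by apply: eq_Cint => x _; rewrite !ent ijkl.
Qed.
End Conclusion.

Theorem theorem4p3 (R : realType) (p n : nat) (p_gt0 : (0 < p)%N)
    (n_gt0 : (0 < n)%N) (G : 'M[R[i]]_(\sum_(i < n.+1) p))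
    (G_posdef : posdefmx G) :
  ((exists E : R[i] -> 'M[R[i]]_(p, p + p), HG_is_de_branges_space G E)
     <-> block_hankel G)
  /\
  (block_hankel G -> forall a : R[i], upper_half_plane a ->
    let F := Fmx p n in
    let Gamma := invmx G in
    let Ep := fun z => rho a z *: (F z *m Gamma *m (F a)^t*
      *m invsqrtmx (rho a a *: (F a *m Gamma *m (F a)^t*))) in
    let Em := fun z => rho a^*%C z *: (F z *m Gamma *m (F a^*%C)^t*
      *m invsqrtmx (rho a a *: (F a^*%C *m Gamma *m (F a^*%C)^t*))) in
    [/\ HG_is_de_branges_space G (fun z => row_mx (Em z) (Ep z)),
        forall z, Ep z = (rho a z / sqrtC (rho a a)) *: (F z *m zmx G a)
      & forall z, Em z = (rho a^*%C z / sqrtC (rho a a)) *: (F z *m zmx G a^*%C)]).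
Proof.
split.
  split=> [[E hE]|hankG]; first exact: realization_hankel hE.
  exists (fun z => row_mx (Eblock G (rho 'i%C 'i%C) 'i%C^*%C z) (Eblock G (rho 'i%C 'i%C) 'i%C z)).
  by apply: Eblock_realization => //=; exact: ltr01.
move=> hankG a a0; split; first exact: Eblock_realization.
  by move=> z; apply: Eblock_normalized => //; exact: rho_diag_gt0.
by move=> z; apply: Eblock_normalized => //; exact: rho_diag_gt0.
Qed.
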